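(* Let $K>0$ and let $M\in\mathcal{M}^{+}(\Delta_s,\mathcal{C}_K)$. Then $M$ can be uniquely expressed as $$M=\sum_{n=1}^{\infty}\ \sum_{i=-n+1}^{n-1}\alpha_{ni}L_{ni},$$ where $L_{ni}$ are the minimal solutions of degree $n$ and $\alpha_{ni}$ are complex constants. The right-hand side converges absolutely and uniformly on every compact subset of $\mathcal{C}_K$, and for every $K'$ with $0<K'<K$ there is a positive constant $C'$ such that $$|\alpha_{ni}|\le C'\exp(-K'n)\quad\text{for all } n\ge1,\ |i|\le n-1 .$$
   Context: For $K>0$ the cyclic invariant annulus is $\mathcal{C}_K=\{(w,z)\in\mathbb{C}^2 : e^{-K}<s<e^{K}\text{ for } s=|w|,|z|,|wz|\}$. $\mathcal{H}^{+}(\mathcal{C}_K)$ is the set of holomorphic functions $f$ on $\mathcal{C}_K$ with $f(w,z)=f(z,w)$. The naive symmetric difference operator is $\Delta_s(w)=\frac12\left(w-\frac1w\right)$. $\mathcal{M}^{+}(\Delta_s,\mathcal{C}_K)$ is the set of all $M\in\mathcal{H}^{+}(\mathcal{C}_K)$ that satisfy the (2-body) cyclic Leibniz rule with $\Delta_s$: $$M(w,z)\,\Delta_s\!\left(\tfrac1{wz}\right)+M\!\left(z,\tfrac1{wz}\right)\Delta_s(w)+M\!\left(\tfrac1{wz},w\right)\Delta_s(z)=0\quad\text{for all }(w,z)\in\mathcal{C}_K .$$ No normalization of $M$ is imposed. Minimal solutions: for each $n\ge1$ there are $2n-1$ Laurent polynomials $L_{n,j}$, $|j|\le n-1$, given by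 $$L_{n,n-1-2i}=w^{n}z^{n-1-i}+\frac{w^{i}}{z^{n-1-i}}+\frac1{w^nz^i}+(w\leftrightarrow z),\qquad i=0,\dots,n-1,$$ $$L_{n,n-2i}=w^{n-1}z^{n-i}+\frac{w^i}{z^{n-i}}+\frac1{w^{n-1}z^i}+(w\leftrightarrow z),\qquad i=1,\dots,n-1,$$ where $+(w\leftrightarrow z)$ means adding the three terms obtained by interchanging $w$ and $z$ (coinciding terms are counted with multiplicity). *)

(* Defs.v *)
From Stdlib Require Export Reals ZArith List Lia.
From Coquelicot Require Export Coquelicot.

Open Scope R_scope.

Definition cyclic_annulus (K : R) (p : C * C) : Prop :=
  let inside (s : R) := exp (- K) < s < exp K in
  inside (Cmod (fst p)) /\ inside (Cmod (snd p)) /\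
  inside (Cmod (fst p * snd p)%C).

(* Functions on a domain [D] of C^2 are total functions whose values outside
   [D] are ignored.  Holomorphic means complex (i.e. C-linearly) Frechet
   differentiable at every point of the open set [D]. *)
Definition holomorphic_on (D : C * C -> Prop) (f : C -> C -> C) : Prop :=
  forall p : C * C, D p ->
    @ex_filterdiff C_AbsRing
      (prod_NormedModule C_AbsRing C_NormedModule C_NormedModule)
      C_NormedModule
      (fun q : C * C => f (fst q) (snd q)) (locally p).

Definition sym_holomorphic (K : R) (f : C -> C -> C) : Prop :=
  holomorphic_on (cyclic_annulus K) f /\
  forall w z : C, cyclic_annulus K (w, z) -> f w z = f z w.

Definition Delta_s (w : C) : C := (/ 2 * (w - / w))%C.

Definition cyclic_Leibniz (Delta : C -> C) (K : R) (M : C -> C -> C) : Prop :=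
  forall w z : C, cyclic_annulus K (w, z) ->
    (M w z * Delta (/ (w * z)) + M z (/ (w * z)) * Delta w
       + M (/ (w * z)) w * Delta z)%C = RtoC 0.

Definition CLR_solution (Delta : C -> C) (K : R) (M : C -> C -> C) : Prop :=
  sym_holomorphic K M /\ cyclic_Leibniz Delta K M.

Definition add_swap (g : C -> C -> C) (w z : C) : C := (g w z + g z w)%C.

(* L_{n, n-1-2i}, for 0 <= i <= n-1. *)
Definition L_first (n i : nat) : C -> C -> C :=
  add_swap (fun w z =>
    w ^ n * z ^ (n - 1 - i) + w ^ i / z ^ (n - 1 - i)
      + 1 / (w ^ n * z ^ i))%C.

(* L_{n, n-2i}, for 1 <= i <= n-1. *)
Definition L_second (n i : nat) : C -> C -> C :=
  add_swap (fun w z =>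
    w ^ (n - 1) * z ^ (n - i) + w ^ i / z ^ (n - i)
      + 1 / (w ^ (n - 1) * z ^ i))%C.

(* L_{n,j}, meaningful for n >= 1 and |j| <= n-1: the parity of n-1-j tells
   the two families apart, see [L_min_first] and [L_min_second]. *)
Definition L_min (n : nat) (j : Z) : C -> C -> C :=
  if Z.even (Z.of_nat n - 1 - j)
  then L_first n (Z.to_nat ((Z.of_nat n - 1 - j) / 2))
  else L_second n (Z.to_nat ((Z.of_nat n - j) / 2)).

Lemma L_min_first (n i : nat) :
  (i < n)%nat -> L_min n (Z.of_nat n - 1 - 2 * Z.of_nat i) = L_first n i.
Proof.
intros Hi; unfold L_min.
replace (Z.of_nat n - 1 - (Z.of_nat n - 1 - 2 * Z.of_nat i))%Z
  with (2 * Z.of_nat i)%Z by lia.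
rewrite Z.even_mul; simpl Z.even; cbv iota beta.
rewrite Z.mul_comm, Z.div_mul by lia.
now rewrite Nat2Z.id.
Qed.

Lemma L_min_second (n i : nat) :
  (1 <= i < n)%nat -> L_min n (Z.of_nat n - 2 * Z.of_nat i) = L_second n i.
Proof.
intros Hi; unfold L_min.
replace (Z.of_nat n - 1 - (Z.of_nat n - 2 * Z.of_nat i))%Z
  with (- (1) + 2 * Z.of_nat i)%Z by lia.
rewrite Z.even_add_mul_2; simpl Z.even; cbv iota beta.
replace (Z.of_nat n - (Z.of_nat n - 2 * Z.of_nat i))%Z
  with (Z.of_nat i * 2)%Z by lia.
rewrite Z.div_mul by lia.
now rewrite Nat2Z.id.
Qed.

(* sum_{n=1}^{N} sum_{j=-n+1}^{n-1} a_{n,j}; the inner sum runs over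
   j = k - (n-1) with 0 <= k <= 2n-2. *)
Definition triangle_sum {G : AbelianMonoid} (a : nat -> Z -> G) (N : nat) : G :=
  sum_n_m
    (fun n => sum_n (fun k => a n (Z.of_nat k - (Z.of_nat n - 1))%Z) (2 * n - 2))
    1 N.

Definition compact_set {T : UniformSpace} (Q : T -> Prop) : Prop :=
  forall (I : Type) (U : I -> T -> Prop),
    (forall i, open (U i)) ->
    (forall x, Q x -> exists i, U i x) ->
    exists l : list I, forall x, Q x -> exists i, In i l /\ U i x.

Definition unif_cv_on {T : Type} {V : UniformSpace} (Q : T -> Prop)
    (F : nat -> T -> V) (f : T -> V) : Prop :=
  forall eps : posreal, exists N0 : nat, forall N : nat, (N0 <= N)%nat ->
    forall x : T, Q x -> ball (f x) eps (F N x).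

Definition L_term (alpha : nat -> Z -> C) (p : C * C) (n : nat) (j : Z) : C :=
  (alpha n j * L_min n j (fst p) (snd p))%C.

(* The series sum_n sum_j alpha_{nj} L_{nj}, summed over n in blocks, converges
   to [M] uniformly on every compact subset of the annulus. *)
Definition L_expansion (K : R) (alpha : nat -> Z -> C) (M : C -> C -> C) : Prop :=
  forall Q : C * C -> Prop, compact_set Q ->
    (forall p, Q p -> cyclic_annulus K p) ->
    unif_cv_on Q (fun N p => triangle_sum (L_term alpha p) N : C)
      (fun p => M (fst p) (snd p)).

(* The series of moduli converges uniformly on every compact subset. *)
Definition L_abs_unif_cv (K : R) (alpha : nat -> Z -> C) : Prop :=
  forall Q : C * C -> Prop, compact_set Q ->
    (forall p, Q p -> cyclic_annulus K p) ->
    exists S : C * C -> R,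
      unif_cv_on Q
        (fun N p => triangle_sum (fun n j => Cmod (L_term alpha p n j)) N : R) S.

(* Main.v *)
(** [M] has an absolutely convergent Laurent series with coefficients c(a, b) that decay like
    exp(- K' max(|a|, |b|, |a - b|)) for every K' < K.  Taking means over the unit torus, the
    cyclic Leibniz rule becomes a linear relation between six of the c(a, b).  Comparing the
    coefficients of the monomials w^a z^b with those of the sought expansion gives, for each
    coefficient of a minimal solution, a first order recursion in n with step 2; its only
    decaying solution is a series in the c(a, b), and the relation shows that this solution
    satisfies all the remaining comparisons.  Conversely the comparisons determine the
    coefficients one after the other, starting from that of L_{1,0}, which gives uniqueness.
    Since M is only assumed complex differentiable, Cauchy's theorem is proved by bisection
    in logarithmic coordinates, and the Laurent series is obtained from it by Chernoff's
    telescoping trick. *)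

Require Import Defs.
From Stdlib Require Import Lra Psatz Classical ClassicalEpsilon.

(** * Bisection of rectangles *)

(** With |w| = e^u and |z| = e^v the annulus becomes the hexagon |u|, |v|, |u + v| < K, and [zdeg]
    is the norm dual to it: it measures both the growth of w^a z^b and the decay of its coefficient.
    The monomials of L_{n,j} all have [zdeg] n - 1 or n, so a given monomial meets only the blocks
    zdeg and zdeg + 1. This is why each comparison has at most two unknowns, why a coefficient of
    the partial sums is stationary in N, and why a partial sum differs from a Laurent polynomial of
    M only at monomials with zdeg >= N; no double series is rearranged. The system of comparisons is
    overdetermined. Those with a > b > 0 or a > 0 > b yield the coefficients, given decay. Each of
    the others says that an expression in n vanishes, which holds because it is 2-periodic in n and
    tends to 0; the one at the origin is a combination of two of these. Convergence is first proved
    at each point, which identifies the sum; a geometric bound on the blocks then makes it uniform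
    on smaller closed hexagons, one of which contains any given compact subset. *)

(** A triple x, y, s stands for the rectangle with corner (x, y) and sides s * h and s * k. A
    failing property fails on nested quarters shrinking to a point, against the local hypothesis
    there. Boundedness, a tube lemma, Fubini, Goursat and compactness of the torus are all
    instances. *)
Lemma rectangle_induction (a c h k : R) (P : R -> R -> R -> Prop) :
  0 <= h -> 0 <= k ->
  (forall x y s, 0 < s -> a <= x -> x + s * h <= a + h ->
     c <= y -> y + s * k <= c + k ->
     P x y (s / 2) -> P (x + s / 2 * h) y (s / 2) ->
     P x (y + s / 2 * k) (s / 2) -> P (x + s / 2 * h) (y + s / 2 * k) (s / 2) ->
     P x y s) ->
  (forall x0 y0, a <= x0 <= a + h -> c <= y0 <= c + k ->
     exists d, 0 < d /\
       forall x y s, 0 < s < d -> a <= x -> x + s * h <= a + h ->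
         c <= y -> y + s * k <= c + k ->
         x <= x0 <= x + s * h -> y <= y0 <= y + s * k -> P x y s) ->
  P a c 1.
Proof.
intros Hh Hk Hsplit Hloc; apply NNPP; intros Hbad.
set (s := fun n : nat => (/ 2) ^ n).
assert (Hs : forall n, 0 < s n) by (intros n; apply pow_lt; lra).
assert (HS : forall n, s (S n) = s n / 2) by (intros n; unfold s; simpl; field).
set (Bad := fun n (p : R * R) =>
  ~ P (fst p) (snd p) (s n) /\
  (a <= fst p /\ fst p + s n * h <= a + h) /\
  (c <= snd p /\ snd p + s n * k <= c + k)).
set (Next := fun n (p q : R * R) =>
  Bad (S n) q /\
  (fst p <= fst q /\ fst q + s (S n) * h <= fst p + s n * h) /\
  (snd p <= snd q /\ snd q + s (S n) * k <= snd p + s n * k)).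
assert (step : forall n p, Bad n p -> exists q, Next n p q).
{ intros n [x y] (HP & [Hx1 Hx2] & [Hy1 Hy2]); simpl in *.
  apply NNPP; intros Hno; apply HP.
  assert (0 <= s n * h) by (apply Rmult_le_pos; [apply Rlt_le, Hs|lra]).
  assert (0 <= s n * k) by (apply Rmult_le_pos; [apply Rlt_le, Hs|lra]).
  apply Hsplit; auto; apply NNPP; intros HP'; apply Hno;
    [exists (x, y)|exists (x + s n / 2 * h, y)
    |exists (x, y + s n / 2 * k)|exists (x + s n / 2 * h, y + s n / 2 * k)];
    unfold Next, Bad; rewrite HS; simpl; repeat split; auto; lra. }
(* [epsilon] returns an arbitrary pair when there is no bad quarter; [Hu] shows that this never
   happens along the sequence. *)
set (nxt := fun n p => epsilon (inhabits p) (Next n p)).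
set (u := fix u n := match n with O => (a, c) | S m => nxt m (u m) end).
assert (Hu : forall n, Bad n (u n)).
{ induction n.
  - unfold Bad, s; simpl; rewrite !Rmult_1_l; repeat split; auto; lra.
  - simpl; destruct (epsilon_spec (inhabits (u n)) (Next n (u n)) (step _ _ IHn)) as [H _].
    exact H. }
assert (Hn : forall n, Next n (u n) (u (S n))).
{ intros n; exact (epsilon_spec (inhabits (u n)) (Next n (u n)) (step _ _ (Hu n))). }
(* Nested intervals, stated for a projection [f] so as to serve both coordinates. *)
assert (limit : forall (f : R * R -> R) (l : R), 0 <= l ->
  (forall n, f (u n) <= f (u (S n)) /\ f (u (S n)) + s (S n) * l <= f (u n) + s n * l) ->
  exists x0, forall n, f (u n) <= x0 <= f (u n) + s n * l).
{ intros f l Hl Hf.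
  assert (M : forall n m, (n <= m)%nat ->
    f (u n) <= f (u m) /\ f (u m) + s m * l <= f (u n) + s n * l).
  { intros n m; induction 1 as [|m _ IH]; [lra|]; specialize (Hf m); lra. }
  assert (B : forall n m, f (u n) <= f (u m) + s m * l).
  { intros n m; assert (0 <= s n * l) by (apply Rmult_le_pos; [apply Rlt_le, Hs|lra]).
    assert (0 <= s m * l) by (apply Rmult_le_pos; [apply Rlt_le, Hs|lra]).
    destruct (Nat.le_ge_cases n m) as [H1|H1]; specialize (M _ _ H1); lra. }
  destruct (completeness (fun x => exists n, x = f (u n))) as [x0 [H1 H2]].
  - exists (f (u O) + s O * l); intros x [n ->]; apply B.
  - exists (f (u O)), O; reflexivity.
  - exists x0; intros n; split; [apply H1; now exists n|].
    apply H2; intros x [m ->]; apply B. }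
destruct (limit fst h Hh) as [x0 Hx0]; [intros n; apply (Hn n)|].
destruct (limit snd k Hk) as [y0 Hy0]; [intros n; apply (Hn n)|].
assert (Hs0 : s O = 1) by reflexivity.
pose proof (Hx0 O) as Hx00; pose proof (Hy0 O) as Hy00; rewrite Hs0 in *; simpl in *.
destruct (Hloc x0 y0) as [d [Hd HP]]; [lra|lra|].
destruct (pow_lt_1_zero (/ 2)) with (y := d) as [n Hlt];
  [rewrite Rabs_pos_eq; lra|lra|].
specialize (Hlt n (le_n n)); rewrite Rabs_pos_eq in Hlt by (apply pow_le; lra).
destruct (Hu n) as (HnP & [? ?] & [? ?]); apply HnP.
apply HP; auto.
Qed.

(** This is e^(u + i t): u is the logarithm of the modulus and t the angle, so a circle is a
    vertical segment and an annulus a strip of period 2 pi in t. *)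
Definition cexp (u t : R) : C := (exp u * cos t, exp u * sin t).
(** * Integrals of complex-valued functions of a real variable *)

Notation Rcontinuous f t :=
  (continuous (T := R_UniformSpace) (U := C_UniformSpace) f t).
Notation Ccontinuous f w :=
  (continuous (T := C_UniformSpace) (U := C_UniformSpace) f w).
Notation is_CInt := (is_RInt (V := C_R_NormedModule)).
Notation ex_CInt := (ex_RInt (V := C_R_NormedModule)).

Definition CInt (f : R -> C) (a b : R) : C :=
  RInt (V := C_R_CompleteNormedModule) f a b.

Lemma is_CInt_unique f a b l : is_CInt f a b l -> CInt f a b = l.
Proof. exact (is_RInt_unique (V := C_R_CompleteNormedModule) f a b l). Qed.

Lemma CInt_correct f a b : ex_CInt f a b -> is_CInt f a b (CInt f a b).
Proof. exact (RInt_correct (V := C_R_CompleteNormedModule) f a b). Qed.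

Lemma ex_CInt_continuous (f : R -> C) a b :
  a <= b -> (forall t, a <= t <= b -> Rcontinuous f t) -> ex_CInt f a b.
Proof.
intros Hab H; apply (ex_RInt_continuous (V := C_R_CompleteNormedModule)).
intros t Ht; apply H; now rewrite Rmin_left, Rmax_right in Ht by lra.
Qed.

Lemma C_R_norm (x : C) : @norm R_AbsRing C_R_NormedModule x = Cmod x.
Proof.
unfold norm; simpl; unfold prod_norm, norm; simpl; unfold abs; simpl.
unfold Cmod; f_equal; simpl; rewrite !Rmult_1_r, <- !Rabs_mult.
now rewrite !(Rabs_pos_eq (_ * _)) by (apply Rle_0_sqr).
Qed.

Lemma is_CInt_bound f a b l B :
  a <= b -> (forall t, a <= t <= b -> Cmod (f t) <= B) ->
  is_CInt f a b l -> Cmod l <= (b - a) * B.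
Proof.
intros Hab HB H; rewrite <- C_R_norm.
apply norm_RInt_le_const with f; auto; intros t Ht; rewrite C_R_norm; auto.
Qed.

Lemma CInt_bound f a b B :
  a <= b -> (forall t, a <= t <= b -> Cmod (f t) <= B) ->
  ex_CInt f a b -> Cmod (CInt f a b) <= (b - a) * B.
Proof. intros ? ? H; eapply is_CInt_bound; eauto using CInt_correct. Qed.

(** Here C is a real normed module, so a complex factor has to be distributed over real and
    imaginary parts. *)
Lemma is_CInt_scal f a b l k :
  is_CInt f a b l -> is_CInt (fun t => k * f t)%C a b (k * l)%C.
Proof.
intros H.
pose proof (is_RInt_fct_extend_fst _ _ _ _ H) as H1.
pose proof (is_RInt_fct_extend_snd _ _ _ _ H) as H2.
apply (is_RInt_fct_extend_pair (U := R_NormedModule) (V := R_NormedModule)).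
- exact (is_RInt_minus _ _ _ _ _ _ (is_RInt_scal _ _ _ (fst k) _ H1)
           (is_RInt_scal _ _ _ (snd k) _ H2)).
- exact (is_RInt_plus _ _ _ _ _ _ (is_RInt_scal _ _ _ (fst k) _ H2)
           (is_RInt_scal _ _ _ (snd k) _ H1)).
Qed.

Lemma is_CInt_plus f g a b l m :
  is_CInt f a b l -> is_CInt g a b m ->
  is_CInt (fun t => f t + g t)%C a b (l + m)%C.
Proof. exact (is_RInt_plus (V := C_R_NormedModule) f g a b l m). Qed.

Lemma is_CInt_minus f g a b l m :
  is_CInt f a b l -> is_CInt g a b m ->
  is_CInt (fun t => f t - g t)%C a b (l - m)%C.
Proof. exact (is_RInt_minus (V := C_R_NormedModule) f g a b l m). Qed.

Lemma is_CInt_const a b (k : C) : is_CInt (fun _ => k) a b (RtoC (b - a) * k)%C.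
Proof.
replace (RtoC (b - a) * k)%C with (@scal R_AbsRing C_R_NormedModule (b - a) k).
- apply (is_RInt_const (V := C_R_NormedModule)).
- destruct k as [x y]; unfold scal; simpl; unfold prod_scal, scal; simpl.
  unfold mult; simpl; unfold Cmult; simpl; f_equal; ring.
Qed.

Lemma CInt_ext f g a b :
  a <= b -> (forall t, a <= t <= b -> f t = g t) -> CInt f a b = CInt g a b.
Proof.
intros Hab H; apply (RInt_ext (V := C_R_CompleteNormedModule)); intros t Ht.
rewrite Rmin_left, Rmax_right in Ht by lra; apply H; lra.
Qed.

Lemma CInt_Chasles f a b c :
  ex_CInt f a b -> ex_CInt f b c -> (CInt f a b + CInt f b c)%C = CInt f a c.
Proof. exact (RInt_Chasles (V := C_R_CompleteNormedModule) f a b c). Qed.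

(** The balls of [C_UniformSpace] are boxes; norm balls generate the same neighbourhoods. *)
Lemma continuous_Cmod {U : UniformSpace} (f : U -> C) x :
  continuous (U := C_UniformSpace) f x <->
  forall eps, 0 < eps -> locally x (fun y => Cmod (f y - f x)%C < eps).
Proof.
split.
- intros H eps He.
  exact (proj1 (filterlim_locally_ball_norm (K := C_AbsRing) (U := C_NormedModule) f (f x)) H
           (mkposreal eps He)).
- intros H.
  apply (proj2 (filterlim_locally_ball_norm (K := C_AbsRing) (U := C_NormedModule) f (f x))).
  intros [eps He]; apply (H eps He).
Qed.

Lemma Ccontinuous_eps (f : C -> C) w :
  Ccontinuous f w <->
  forall eps, 0 < eps -> exists d, 0 < d /\
    forall w', Cmod (w' - w)%C < d -> Cmod (f w' - f w)%C < eps.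
Proof.
rewrite continuous_Cmod; split; intros H eps He.
- specialize (H eps He).
  apply (locally_norm_le_locally (K := C_AbsRing) (V := C_NormedModule)) in H.
  destruct H as [[d Hd] H]; exists d; split; auto.
- destruct (H eps He) as [d [Hd H']].
  apply (locally_le_locally_norm (K := C_AbsRing) (V := C_NormedModule)).
  exists (mkposreal d Hd); intros y Hy; apply H', Hy.
Qed.

Definition continuous2 (H : R -> R -> C) (x y : R) : Prop :=
  continuous (T := prod_UniformSpace R_UniformSpace R_UniformSpace)
    (U := C_UniformSpace) (fun p => H (fst p) (snd p)) (x, y).

Lemma continuous2_eps H x y :
  continuous2 H x y ->
  forall eps, 0 < eps -> exists d, 0 < d /\
    forall x' y', Rabs (x' - x) < d -> Rabs (y' - y) < d ->
      Cmod (H x' y' - H x y)%C < eps.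
Proof.
intros Hc eps He.
destruct (proj1 (continuous_Cmod _ _) Hc eps He) as [[d Hd] Hb].
exists d; split; auto; intros x' y' Hx Hy.
apply (Hb (x', y')); split; assumption.
Qed.

Lemma continuous2_l H x y : continuous2 H x y -> Rcontinuous (fun t => H t y) x.
Proof.
intros Hc.
apply (continuous_comp_2 (U := R_UniformSpace) (V := R_UniformSpace)
  (W := R_UniformSpace) (X := C_UniformSpace) (fun t => t) (fun _ => y) H);
  [apply continuous_id|apply continuous_const|exact Hc].
Qed.

Lemma continuous2_r H x y : continuous2 H x y -> Rcontinuous (fun t => H x t) y.
Proof.
intros Hc.
apply (continuous_comp_2 (U := R_UniformSpace) (V := R_UniformSpace)
  (W := R_UniformSpace) (X := C_UniformSpace) (fun _ => x) (fun t => t) H);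
  [apply continuous_const|apply continuous_id|exact Hc].
Qed.

Lemma continuous_cexp u t : continuous2 cexp u t.
Proof.
assert (He : forall p : R * R,
  continuous (T := prod_UniformSpace R_UniformSpace R_UniformSpace)
    (U := R_UniformSpace) (fun p => exp (fst p)) p).
{ intros [x y]; apply (continuous_comp (V := R_UniformSpace) (fun p : R * R => fst p) exp);
  [apply continuous_fst|apply continuous_exp]. }
assert (Ht : forall (g : R -> R) p, (forall t, continuous g t) ->
  continuous (T := prod_UniformSpace R_UniformSpace R_UniformSpace)
    (U := R_UniformSpace) (fun p => g (snd p)) p).
{ intros g [x y] Hg; apply (continuous_comp (V := R_UniformSpace) (fun p : R * R => snd p) g);
  [apply continuous_snd|apply Hg]. }
apply (continuous_comp_2 (U := prod_UniformSpace R_UniformSpace R_UniformSpace)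
  (V := R_UniformSpace) (W := R_UniformSpace) (X := C_UniformSpace)
  (fun p => exp (fst p) * cos (snd p)) (fun p => exp (fst p) * sin (snd p))
  (fun x y => (x, y))).
- apply (continuous_mult (K := R_AbsRing)); [apply He|apply Ht, continuous_cos].
- apply (continuous_mult (K := R_AbsRing)); [apply He|apply Ht, continuous_sin].
- apply continuous_ext with (fun p => p); [intros []; reflexivity|apply continuous_id].
Qed.

Lemma cexp_plus a b s t : cexp (a + b) (s + t) = (cexp a s * cexp b t)%C.
Proof.
unfold cexp, Cmult; simpl; rewrite exp_plus, cos_plus, sin_plus; f_equal; ring.
Qed.

Lemma cexp_0 : cexp 0 0 = 1%C.
Proof. unfold cexp; rewrite exp_0, cos_0, sin_0; unfold RtoC; f_equal; ring. Qed.

Lemma Cmod_cexp u t : Cmod (cexp u t) = exp u.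
Proof.
unfold cexp, Cmod; simpl.
replace (_ + _) with (exp u * exp u * ((sin t)² + (cos t)²)) by (unfold Rsqr; ring).
rewrite sin2_cos2, Rmult_1_r; apply sqrt_square, Rlt_le, exp_pos.
Qed.

Lemma cexp_neq_0 u t : cexp u t <> 0%C.
Proof. apply Cmod_gt_0; rewrite Cmod_cexp; apply exp_pos. Qed.

Lemma cexp_2PI u t : cexp u (t + 2 * PI) = cexp u t.
Proof. unfold cexp; now rewrite cos_plus, sin_plus, cos_2PI, sin_2PI, !Rmult_1_r, !Rmult_0_r, Rminus_0_r, Rplus_0_r. Qed.

Lemma is_CInt_cexp_u t a b :
  is_CInt (fun u => cexp u t) a b (cexp b t - cexp a t)%C.
Proof.
assert (H : forall k, is_RInt (V := R_NormedModule) (fun u => exp u * k) a b (exp b * k - exp a * k)).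
{ intros k.
  apply (is_RInt_derive (V := R_CompleteNormedModule) (fun u => exp u * k) (fun u => exp u * k)).
  - intros u _; auto_derive; auto; ring.
  - intros u _; apply (continuous_mult (K := R_AbsRing)); [apply continuous_exp|apply continuous_const]. }
exact (is_RInt_fct_extend_pair (U := R_NormedModule) (V := R_NormedModule)
  (fun u => cexp u t) a b _ _ (H (cos t)) (H (sin t))).
Qed.

Lemma is_CInt_cexp_t k u a b :
  is_CInt (fun t => RtoC k * Ci * cexp u (k * t))%C a b (cexp u (k * b) - cexp u (k * a))%C.
Proof.
assert (Hk : forall t, continuous (fun t => k * t) t)
  by (intros; apply (continuous_scal_r (V := R_NormedModule)), continuous_id).
assert (H1 : is_RInt (V := R_NormedModule) (fun t => k * (- (exp u * sin (k * t)))) a b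
    (exp u * cos (k * b) - exp u * cos (k * a))).
{ apply (is_RInt_derive (V := R_CompleteNormedModule) (fun t => exp u * cos (k * t))).
  - intros t _; auto_derive; auto; ring.
  - intros t _; apply (continuous_scal_r (V := R_NormedModule)), (continuous_opp (V := R_NormedModule)).
    apply (continuous_scal_r (V := R_NormedModule)).
    apply (continuous_comp (fun t => k * t) sin); [apply Hk|apply continuous_sin]. }
assert (H2 : is_RInt (V := R_NormedModule) (fun t => k * (exp u * cos (k * t))) a b
    (exp u * sin (k * b) - exp u * sin (k * a))).
{ apply (is_RInt_derive (V := R_CompleteNormedModule) (fun t => exp u * sin (k * t))).
  - intros t _; auto_derive; auto; ring.
  - intros t _; apply (continuous_scal_r (V := R_NormedModule)).
    apply (continuous_scal_r (V := R_NormedModule)).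
    apply (continuous_comp (fun t => k * t) cos); [apply Hk|apply continuous_cos]. }
apply is_RInt_ext with (2 := is_RInt_fct_extend_pair (U := R_NormedModule) (V := R_NormedModule)
  (fun t => (k * (- (exp u * sin (k * t))), k * (exp u * cos (k * t)))) a b _ _ H1 H2).
intros t _; unfold cexp, Ci, RtoC, Cmult; simpl; f_equal; ring.
Qed.

Lemma exp_le_exp x y : x <= y -> exp x <= exp y.
Proof.
intros [H| ->]; [now apply Rlt_le, exp_increasing|apply Rle_refl].
Qed.

(** Both partial derivatives have modulus exp u, so integrating along a horizontal and then a
    vertical segment gives the two terms. *)
Lemma cexp_lipschitz U u t u0 t0 : u <= U -> u0 <= U ->
  Cmod (cexp u t - cexp u0 t0)%C <= exp U * (Rabs (u - u0) + Rabs (t - t0)).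
Proof.
intros Hu Hu0.
replace (cexp u t - cexp u0 t0)%C
  with ((cexp u t - cexp u0 t) + (cexp u0 t - cexp u0 t0))%C by ring.
eapply Rle_trans; [apply Cmod_triangle|].
rewrite Rmult_plus_distr_l; apply Rplus_le_compat.
- rewrite Rmult_comm.
  pose proof (norm_RInt_le_const_abs (V := C_R_NormedModule) (fun u => cexp u t) u0 u
    (cexp u t - cexp u0 t)%C (exp U)) as E.
  rewrite C_R_norm in E; apply E; [|exact (is_CInt_cexp_u t u0 u)].
  intros v Hv; rewrite C_R_norm, Cmod_cexp; apply exp_le_exp.
  apply Rle_trans with (1 := proj2 Hv); apply Rmax_lub; auto.
- rewrite Rmult_comm.
  pose proof (norm_RInt_le_const_abs (V := C_R_NormedModule)
    (fun t => RtoC 1 * Ci * cexp u0 (1 * t))%C t0 t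
    (cexp u0 (1 * t) - cexp u0 (1 * t0))%C (exp U)) as E.
  rewrite C_R_norm, !Rmult_1_l in E; apply E.
  + intros v Hv; rewrite C_R_norm, !Cmod_mult, Cmod_1, Cmod_Ci, Cmod_cexp, !Rmult_1_l.
    now apply exp_le_exp.
  + pose proof (is_CInt_cexp_t 1 u0 t0 t) as H1; rewrite !Rmult_1_l in H1; exact H1.
Qed.

Lemma CInt_minus f g a b : ex_CInt f a b -> ex_CInt g a b ->
  CInt (fun t => f t - g t)%C a b = (CInt f a b - CInt g a b)%C.
Proof. intros; apply is_CInt_unique, is_CInt_minus; now apply CInt_correct. Qed.

Lemma CInt_plus f g a b : ex_CInt f a b -> ex_CInt g a b ->
  CInt (fun t => f t + g t)%C a b = (CInt f a b + CInt g a b)%C.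
Proof. intros; apply is_CInt_unique, is_CInt_plus; now apply CInt_correct. Qed.

Lemma CInt_scal f a b k : ex_CInt f a b ->
  CInt (fun t => k * f t)%C a b = (k * CInt f a b)%C.
Proof. intros; apply is_CInt_unique, is_CInt_scal; now apply CInt_correct. Qed.

Lemma CInt_const a b (k : C) : CInt (fun _ => k) a b = (RtoC (b - a) * k)%C.
Proof. apply is_CInt_unique, is_CInt_const. Qed.

Lemma Rcontinuous_plus (f g : R -> C) t :
  Rcontinuous f t -> Rcontinuous g t -> Rcontinuous (fun t => f t + g t)%C t.
Proof. exact (continuous_plus (V := C_NormedModule) f g t). Qed.

Lemma Rcontinuous_minus (f g : R -> C) t :
  Rcontinuous f t -> Rcontinuous g t -> Rcontinuous (fun t => f t - g t)%C t.
Proof. exact (continuous_minus (V := C_NormedModule) f g t). Qed.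

Lemma Rcontinuous_scal (f : R -> C) k t :
  Rcontinuous f t -> Rcontinuous (fun t => k * f t)%C t.
Proof. exact (continuous_scal_r (V := C_NormedModule) k f t). Qed.

(** * Compactness arguments on rectangles *)

Lemma continuous2_bounded F a c h k : 0 <= h -> 0 <= k ->
  (forall u t, a <= u <= a + h -> c <= t <= c + k -> continuous2 F u t) ->
  exists B, 0 < B /\
    forall u t, a <= u <= a + h -> c <= t <= c + k -> Cmod (F u t) <= B.
Proof.
intros Hh Hk HF.
pose (P x y s := exists B, 0 < B /\
  forall u t, x <= u <= x + s * h -> y <= t <= y + s * k -> Cmod (F u t) <= B).
enough (HP : P a c 1) by (unfold P in HP; now rewrite !Rmult_1_l in HP).
apply (rectangle_induction a c h k); auto.
- intros x y s Hs _ _ _ _ [B1 [P1 H1]] [B2 [P2 H2]] [B3 [P3 H3]] [B4 [P4 H4]].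
  exists (B1 + B2 + B3 + B4); split; [lra|]; intros u t Hu Ht.
  destruct (Rle_dec u (x + s / 2 * h)); destruct (Rle_dec t (y + s / 2 * k));
  [specialize (H1 u t)|specialize (H3 u t)|specialize (H2 u t)|specialize (H4 u t)]; lra.
- intros x0 y0 Hx0 Hy0.
  destruct (continuous2_eps _ _ _ (HF _ _ Hx0 Hy0) 1 Rlt_0_1) as [d [Hd H]].
  (* Below this scale both sides s * h and s * k are less than d; the + 1 keeps the quotient
     meaningful when h = k = 0. Later bisections use the same radius. *)
  assert (Hhk : 0 < d / (h + k + 1)) by (apply Rdiv_lt_0_compat; lra).
  exists (d / (h + k + 1)); split; auto.
  intros x y s [Hs Hsd] _ _ _ _ Hx Hy.
  apply (Rmult_lt_compat_r (h + k + 1)) in Hsd; [|lra].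
  unfold Rdiv in Hsd; rewrite Rmult_assoc, Rinv_l, Rmult_1_r in Hsd by lra.
  assert (0 <= s * h) by nra; assert (0 <= s * k) by nra.
  exists (Cmod (F x0 y0) + 1); split; [pose proof (Cmod_ge_0 (F x0 y0)); lra|].
  intros u t Hu Ht.
  replace (F u t) with (F x0 y0 + (F u t - F x0 y0))%C by ring.
  eapply Rle_trans; [apply Cmod_triangle|apply Rplus_le_compat_l, Rlt_le, H];
    apply Rabs_def1; lra.
Qed.

(** A tube lemma: the bisected rectangle has width h = 0 and [P] ignores its abscissa, so only the
    segment in t is halved. *)
Lemma continuous2_uniform F u0 c k : 0 <= k ->
  (forall t, c <= t <= c + k -> continuous2 F u0 t) ->
  forall eps, 0 < eps -> exists d, 0 < d /\
    forall u t, Rabs (u - u0) < d -> c <= t <= c + k -> Cmod (F u t - F u0 t)%C <= eps.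
Proof.
intros Hk HF eps He.
pose (P (x y s : R) := exists d, 0 < d /\
    forall u t, Rabs (u - u0) < d -> y <= t <= y + s * k -> Cmod (F u t - F u0 t)%C <= eps).
enough (HP : P u0 c 1) by (unfold P in HP; now rewrite !Rmult_1_l in HP).
apply (rectangle_induction u0 c 0 k); auto; [lra| |].
- intros x y s Hs _ _ _ _ [B1 [P1 H1]] [B2 [P2 H2]] [B3 [P3 H3]] [B4 [P4 H4]].
  exists (Rmin B1 B3); split; [now apply Rmin_pos|]; intros u t Hu Ht.
  pose proof (Rmin_l B1 B3); pose proof (Rmin_r B1 B3).
  destruct (Rle_dec t (y + s / 2 * k)); [apply H1|apply H3]; lra.
- intros x0 y0 Hx0 Hy0.
  assert (x0 = u0) by lra; subst x0.
  destruct (continuous2_eps _ _ _ (HF _ Hy0) (eps / 2)) as [d [Hd H]]; [lra|].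
  assert (Hhk : 0 < d / (k + 1)) by (apply Rdiv_lt_0_compat; lra).
  exists (d / (k + 1)); split; auto.
  intros x y s [Hs Hsd] _ _ _ _ Hx Hy.
  apply (Rmult_lt_compat_r (k + 1)) in Hsd; [|lra].
  unfold Rdiv in Hsd; rewrite Rmult_assoc, Rinv_l, Rmult_1_r in Hsd by lra.
  assert (0 <= s * k) by nra.
  exists d; split; auto; intros u t Hu Ht.
  replace (F u t - F u0 t)%C with ((F u t - F u0 y0) + - (F u0 t - F u0 y0))%C by ring.
  eapply Rle_trans; [apply Cmod_triangle|]; rewrite Cmod_opp.
  replace eps with (eps / 2 + eps / 2) by lra.
  assert (Rabs (t - y0) < d) by (apply Rabs_def1; lra).
  apply Rplus_le_compat; apply Rlt_le, H; auto.
  now rewrite Rminus_diag, Rabs_R0.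
Qed.

Lemma ex_CInt_r F a b x : a <= b -> (forall u t, continuous2 F u t) ->
  ex_CInt (fun t => F x t) a b.
Proof. intros; apply ex_CInt_continuous; auto; intros; now apply continuous2_r. Qed.

Lemma CInt_param_continuous F c d u0 : c <= d ->
  (forall u t, continuous2 F u t) -> Rcontinuous (fun u => CInt (fun t => F u t) c d) u0.
Proof.
intros Hcd HF; apply (proj2 (continuous_Cmod _ _)); intros eps He.
destruct (continuous2_uniform F u0 c (d - c)) with (eps := eps / (d - c + 1))
  as [r [Hr H]]; auto; [lra|apply Rdiv_lt_0_compat; lra|].
exists (mkposreal r Hr); intros u Hu.
rewrite <- CInt_minus by now apply ex_CInt_r.
eapply Rle_lt_trans.
- apply CInt_bound with (B := eps / (d - c + 1)); auto.
  + intros t Ht; apply H; [exact Hu|lra].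
  + apply ex_CInt_continuous; auto; intros t _.
    apply Rcontinuous_minus; now apply continuous2_r.
- apply Rmult_lt_reg_r with (d - c + 1); [lra|].
  unfold Rdiv; rewrite <- (Rmult_assoc (d - c)), Rmult_assoc, Rinv_l by lra; nra.
Qed.

(** * Fubini on rectangles *)

Definition iterated_CInt (F : R -> R -> C) (x y h k : R) : C :=
  CInt (fun u => CInt (fun t => F u t) y (y + k)) x (x + h).

Lemma continuous2_swap F x y : continuous2 F x y -> continuous2 (fun t u => F u t) y x.
Proof.
intros H; apply (continuous_comp_2 (U := prod_UniformSpace R_UniformSpace R_UniformSpace)
  (V := R_UniformSpace) (W := R_UniformSpace) (X := C_UniformSpace) snd fst F);
  [apply continuous_snd|apply continuous_fst|exact H].
Qed.

Lemma continuous2_const (k : C) x y : continuous2 (fun _ _ => k) x y.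
Proof. apply continuous_const. Qed.

Lemma continuous2_minus F G x y : continuous2 F x y -> continuous2 G x y ->
  continuous2 (fun u t => F u t - G u t)%C x y.
Proof.
exact (continuous_minus (V := C_NormedModule)
  (fun p => F (fst p) (snd p)) (fun p => G (fst p) (snd p)) (x, y)).
Qed.

Lemma ex_iterated F x y h k : 0 <= h -> 0 <= k -> (forall u t, continuous2 F u t) ->
  ex_CInt (fun u => CInt (fun t => F u t) y (y + k)) x (x + h).
Proof.
intros; apply ex_CInt_continuous; [lra|]; intros; apply CInt_param_continuous; auto; lra.
Qed.

Lemma iterated_CInt_split F x y h k : 0 <= h -> 0 <= k ->
  (forall u t, continuous2 F u t) ->
  iterated_CInt F x y (2 * h) (2 * k) =
    (iterated_CInt F x y h k + iterated_CInt F (x + h) y h k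
     + iterated_CInt F x (y + k) h k + iterated_CInt F (x + h) (y + k) h k)%C.
Proof.
intros Hh Hk HF; unfold iterated_CInt.
assert (V : forall x, CInt (fun u => CInt (fun t => F u t) y (y + 2 * k)) x (x + h) =
  (CInt (fun u => CInt (fun t => F u t) y (y + k)) x (x + h) +
   CInt (fun u => CInt (fun t => F u t) (y + k) (y + k + k)) x (x + h))%C).
{ intros x'; rewrite <- CInt_plus by now apply ex_iterated.
  apply CInt_ext; [lra|]; intros u _.
  replace (y + 2 * k) with (y + k + k) by ring.
  symmetry; apply CInt_Chasles; apply ex_CInt_r; auto; lra. }
rewrite <- (CInt_Chasles _ x (x + h) (x + 2 * h)).
- replace (x + 2 * h) with (x + h + h) by ring; rewrite !V; ring.
- apply ex_iterated; auto; lra.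
- replace (x + 2 * h) with (x + h + h) by ring; apply ex_iterated; auto; lra.
Qed.

Lemma iterated_CInt_minus F G x y h k : 0 <= h -> 0 <= k ->
  (forall u t, continuous2 F u t) -> (forall u t, continuous2 G u t) ->
  iterated_CInt (fun u t => F u t - G u t)%C x y h k =
    (iterated_CInt F x y h k - iterated_CInt G x y h k)%C.
Proof.
intros; unfold iterated_CInt; rewrite <- CInt_minus by now apply ex_iterated.
apply CInt_ext; [lra|]; intros; apply CInt_minus; apply ex_CInt_r; auto; lra.
Qed.

Lemma iterated_CInt_bound F x y h k B : 0 <= h -> 0 <= k ->
  (forall u t, continuous2 F u t) ->
  (forall u t, x <= u <= x + h -> y <= t <= y + k -> Cmod (F u t) <= B) ->
  Cmod (iterated_CInt F x y h k) <= h * (k * B).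
Proof.
intros Hh Hk HF HB; unfold iterated_CInt.
replace (h * (k * B)) with ((x + h - x) * ((y + k - y) * B)) by ring.
apply CInt_bound; [lra| |now apply ex_iterated].
intros u Hu; apply CInt_bound; [lra|auto|apply ex_CInt_r; auto; lra].
Qed.

(** The gap between the two iterated integrals is additive under bisection and vanishes for
    constants. A continuous F is locally constant up to e, which bounds the gap by eps * s^2 at
    scale s; this bound is itself additive, since 4 * (s/2)^2 = s^2. *)
Lemma CInt_Fubini F a c h k : 0 <= h -> 0 <= k ->
  (forall u t, continuous2 F u t) ->
  iterated_CInt F a c h k = iterated_CInt (fun t u => F u t) c a k h.
Proof.
intros Hh Hk HF.
pose (gap (F : R -> R -> C) x y h k :=
  (iterated_CInt F x y h k - iterated_CInt (fun t u => F u t) y x k h)%C).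
enough (H : Cmod (gap F a c h k) <= 0).
{ assert (E : gap F a c h k = 0%C)
    by (apply Cmod_eq_0; pose proof (Cmod_ge_0 (gap F a c h k)); lra).
  unfold gap in E; rewrite <- (Cplus_0_r (iterated_CInt (fun t u => F u t) c a k h)), <- E; ring. }
assert (HF' : forall t u, continuous2 (fun t u => F u t) t u)
  by (intros; now apply continuous2_swap).
apply le_epsilon; intros eps He; rewrite Rplus_0_l.
pose (P x y s := Cmod (gap F x y (s * h) (s * k)) <= eps * (s * s)).
enough (HP : P a c 1) by (unfold P in HP; now rewrite !Rmult_1_l, Rmult_1_r in HP).
apply (rectangle_induction a c h k); auto; unfold P.
- intros x y s Hs _ _ _ _ H1 H2 H3 H4.
  set (h' := s / 2 * h) in *; set (k' := s / 2 * k) in *.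
  set (x' := x + h') in *; set (y' := y + k') in *.
  assert (0 <= h') by (unfold h'; nra); assert (0 <= k') by (unfold k'; nra).
  replace (gap F x y (s * h) (s * k)) with
    (gap F x y h' k' + gap F x' y h' k' + (gap F x y' h' k' + gap F x' y' h' k'))%C.
  { eapply Rle_trans; [apply Cmod_triangle|].
    eapply Rle_trans; [apply Rplus_le_compat; apply Cmod_triangle|]; lra. }
  unfold gap.
  replace (s * h) with (2 * h') by (unfold h'; field).
  replace (s * k) with (2 * k') by (unfold k'; field).
  unfold x', y'; rewrite !iterated_CInt_split by auto; ring.
- intros x0 y0 Hx0 Hy0.
  (* The two integrals of F minus its value at the point contribute 2 * (s * h) * (s * k) * e <= eps
     * s^2; the + 1 covers h * k = 0. *)
  set (e := eps / (2 * (h * k) + 1)).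
  assert (Hhk0 : 0 <= h * k) by nra.
  assert (0 < e) by (apply Rdiv_lt_0_compat; lra).
  assert (He' : e * (2 * (h * k) + 1) = eps) by (unfold e; field; lra).
  destruct (continuous2_eps _ _ _ (HF x0 y0) e) as [d [Hd H']]; [lra|].
  assert (Hhk : 0 < d / (h + k + 1)) by (apply Rdiv_lt_0_compat; lra).
  exists (d / (h + k + 1)); split; auto.
  intros x y s [Hs Hsd] _ _ _ _ Hx Hy.
  apply (Rmult_lt_compat_r (h + k + 1)) in Hsd; [|lra].
  unfold Rdiv in Hsd; rewrite Rmult_assoc, Rinv_l, Rmult_1_r in Hsd by lra.
  assert (0 <= s * h) by nra; assert (0 <= s * k) by nra.
  pose proof (continuous2_const (F x0 y0)) as Hc.
  assert (Hm : forall u t, continuous2 (fun u t => F u t - F x0 y0)%C u t)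
    by (intros; apply continuous2_minus; auto).
  assert (Hm' : forall u t, continuous2 (fun u t => F t u - F x0 y0)%C u t)
    by (intros; apply continuous2_minus; auto).
  replace (gap F x y (s * h) (s * k)) with
    (iterated_CInt (fun u t => F u t - F x0 y0)%C x y (s * h)%R (s * k)%R
     + - iterated_CInt (fun t u => F u t - F x0 y0)%C y x (s * k)%R (s * h)%R)%C.
  + eapply Rle_trans; [apply Cmod_triangle|]; rewrite Cmod_opp.
    apply Rle_trans with (s * h * (s * k * e) + s * k * (s * h * e)).
    * apply Rplus_le_compat; apply iterated_CInt_bound; auto;
      intros u t Hu Ht; apply Rlt_le, H'; apply Rabs_def1; lra.
    * rewrite <- He'; assert (0 <= s * s * e) by nra; nra.
  + unfold gap; rewrite !iterated_CInt_minus by auto.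
    replace (iterated_CInt (fun _ _ => F x0 y0) y x (s * k) (s * h))
      with (iterated_CInt (fun _ _ => F x0 y0) x y (s * h) (s * k)); [ring|].
    unfold iterated_CInt; rewrite !CInt_const.
    replace (x + s * h - x) with (s * h) by ring.
    replace (y + s * k - y) with (s * k) by ring; ring.
Qed.

(** * Circular means of holomorphic functions *)

(* Caratheodory's form of complex differentiability: [q w] is the derivative. *)
Definition Cdiff (f : C -> C) (w : C) : Prop :=
  exists q : C -> C, Ccontinuous q w /\
    forall w', f w' = (f w + q w' * (w' - w))%C.

Lemma continuous_Cmult {U : UniformSpace} (f g : U -> C) x :
  continuous (U := C_UniformSpace) f x -> continuous (U := C_UniformSpace) g x ->
  continuous (U := C_UniformSpace) (fun y => f y * g y)%C x.
Proof.
rewrite !continuous_Cmod; intros Hf Hg eps He.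
set (A := Cmod (f x)); set (B := Cmod (g x)).
assert (HA : 0 <= A) by apply Cmod_ge_0; assert (HB : 0 <= B) by apply Cmod_ge_0.
set (d := Rmin 1 (eps / (A + B + 1))).
assert (Hd : 0 < d) by (apply Rmin_pos; [lra|apply Rdiv_lt_0_compat; lra]).
assert (Hd1 : d <= 1) by apply Rmin_l.
assert (Hde : d * (A + B + 1) <= eps).
{ replace eps with (eps / (A + B + 1) * (A + B + 1)) by (field; lra).
  apply Rmult_le_compat_r; [lra|apply Rmin_r]. }
apply filter_imp with (2 := filter_and _ _ (Hf d Hd) (Hg d Hd)).
intros y [H1 H2].
replace (f y * g y - f x * g x)%C
  with ((f y - f x) * (g y - g x) + ((f y - f x) * g x + f x * (g y - g x)))%C by ring.
eapply Rle_lt_trans; [apply Cmod_triangle|].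
eapply Rle_lt_trans; [apply Rplus_le_compat_l, Cmod_triangle|].
rewrite !Cmod_mult; fold A B.
pose proof (Cmod_ge_0 (f y - f x)%C); pose proof (Cmod_ge_0 (g y - g x)%C).
assert (Cmod (f y - f x)%C * Cmod (g y - g x)%C < d * 1) by nra.
assert (Cmod (f y - f x)%C * B <= d * B) by nra.
assert (A * Cmod (g y - g x)%C <= A * d) by nra.
lra.
Qed.

Lemma Ccontinuous_mult f g w : Ccontinuous f w -> Ccontinuous g w ->
  Ccontinuous (fun w => f w * g w)%C w.
Proof. exact (continuous_Cmult f g w). Qed.

Lemma Ccontinuous_plus f g w : Ccontinuous f w -> Ccontinuous g w ->
  Ccontinuous (fun w => f w + g w)%C w.
Proof. exact (continuous_plus (V := C_NormedModule) f g w). Qed.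

Lemma Ccontinuous_minus f g w : Ccontinuous f w -> Ccontinuous g w ->
  Ccontinuous (fun w => f w - g w)%C w.
Proof. exact (continuous_minus (V := C_NormedModule) f g w). Qed.

Lemma Cdiff_continuous f w : Cdiff f w -> Ccontinuous f w.
Proof.
intros [q [Hq H]].
apply continuous_ext with (fun w' => f w + q w' * (w' - w))%C; [intros; symmetry; apply H|].
apply Ccontinuous_plus; [apply continuous_const|].
apply Ccontinuous_mult; auto.
apply Ccontinuous_minus; [apply continuous_id|apply continuous_const].
Qed.

Lemma Cdiff_id w : Cdiff (fun w => w) w.
Proof. exists (fun _ => 1%C); split; [apply continuous_const|intros; ring]. Qed.

Lemma Cdiff_const k w : Cdiff (fun _ => k) w.
Proof. exists (fun _ => 0%C); split; [apply continuous_const|intros; ring]. Qed.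

Lemma Cdiff_mult f g w : Cdiff f w -> Cdiff g w -> Cdiff (fun w => f w * g w)%C w.
Proof.
intros Hf [r [Hr Hg]]; pose proof (Cdiff_continuous _ _ Hf) as Hc.
destruct Hf as [q [Hq Hf]].
exists (fun w' => q w' * g w + f w' * r w')%C; split.
- apply Ccontinuous_plus; apply Ccontinuous_mult; auto; apply continuous_const.
- intros w'; rewrite (Hg w') at 1; rewrite Hf; ring.
Qed.

Lemma Ccontinuous_inv (g : C -> C) w :
  g w <> 0%C -> Ccontinuous g w -> Ccontinuous (fun w => / g w)%C w.
Proof.
intros Hw Hg; apply Ccontinuous_eps; intros eps He.
pose proof (proj1 (Cmod_gt_0 _) Hw) as Hm; set (m := Cmod (g w)) in *.
destruct (proj1 (Ccontinuous_eps _ _) Hg (Rmin (m / 2) (eps * (m * m / 2)))) as [d [Hd H]].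
{ apply Rmin_pos; [lra|]; apply Rmult_lt_0_compat; [lra|nra]. }
exists d; split; auto; intros w' Hw'.
specialize (H w' Hw').
pose proof (Rmin_l (m / 2) (eps * (m * m / 2))); pose proof (Rmin_r (m / 2) (eps * (m * m / 2))).
assert (m / 2 < Cmod (g w')).
{ pose proof (Cmod_triangle (g w') (- (g w' - g w))%C) as T.
  replace (g w' + - (g w' - g w))%C with (g w) in T by ring.
  rewrite Cmod_opp in T; fold m in T; lra. }
assert (g w' <> 0%C) by (apply Cmod_gt_0; lra).
replace (/ g w' - / g w)%C with (- (g w' - g w) * / (g w' * g w))%C by (field; auto).
rewrite Cmod_mult, Cmod_opp, Cmod_inv, Cmod_mult by (apply Cmult_neq_0; auto).
fold m.
apply Rmult_lt_reg_r with (Cmod (g w') * m); [nra|].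
rewrite Rmult_assoc, Rinv_l, Rmult_1_r by nra.
apply Rlt_le_trans with (eps * (m * m / 2)); [lra|].
apply Rmult_le_compat_l; [lra|nra].
Qed.

Lemma Cminus_eq_0 (x y : C) : (x - y)%C = 0%C -> x = y.
Proof. intros H; replace x with (x - y + y)%C by ring; rewrite H; ring. Qed.

(** [Cdiff] demands its identity at every point. Where it fails one has w' <> w, so q can be
    redefined there as the difference quotient without affecting its continuity at w. *)
Lemma Cdiff_local f q w : Ccontinuous q w ->
  locally (T := C_UniformSpace) w (fun w' => f w' = (f w + q w' * (w' - w))%C) ->
  Cdiff f w.
Proof.
intros Hq Hloc.
exists (fun w' => if excluded_middle_informative (f w' = (f w + q w' * (w' - w))%C)
  then q w' else ((f w' - f w) / (w' - w))%C); split.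
- apply continuous_ext_loc with (2 := Hq).
  apply filter_imp with (2 := Hloc); intros w' E.
  now destruct excluded_middle_informative.
- intros w'; destruct excluded_middle_informative as [E|E]; [exact E|].
  assert (w' - w <> 0)%C.
  { intros E0; apply E; rewrite (Cminus_eq_0 _ _ E0); ring. }
  field; auto.
Qed.

Lemma Cdiff_Cinv (w : C) : w <> 0%C -> Cdiff Cinv w.
Proof.
intros Hw; apply Cdiff_local with (fun w' => - / (w' * w))%C.
- apply (continuous_opp (V := C_NormedModule)), Ccontinuous_inv.
  + exact (Cmult_neq_0 w w Hw Hw).
  + apply Ccontinuous_mult; [apply continuous_id|apply continuous_const].
- pose proof (proj1 (Cmod_gt_0 _) Hw) as Hm.
  apply (locally_le_locally_norm (K := C_AbsRing) (V := C_NormedModule)).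
  exists (mkposreal _ Hm); intros w' Hw'; change C in w'; change (Cmod (w' - w)%C < Cmod w) in Hw'.
  assert (w' <> 0%C).
  { intros ->; replace (0 - w)%C with (- w)%C in Hw' by ring; rewrite Cmod_opp in Hw'; lra. }
  field; auto.
Qed.

(** * Integer powers *)

(** One of the two truncated exponents is always 0. This form needs no case split on the sign of a:
    differentiability is the product rule. *)
Definition Czpow (w : C) (a : Z) : C := (w ^ Z.to_nat a * (/ w) ^ Z.to_nat (- a))%C.

Lemma Czpow_0 w : Czpow w 0 = 1%C.
Proof. unfold Czpow; simpl; ring. Qed.

Lemma Czpow_succ (w : C) a : w <> 0%C -> Czpow w (a + 1) = (w * Czpow w a)%C.
Proof.
intros Hw; unfold Czpow; destruct (Z_le_gt_dec 0 a).
- replace (Z.to_nat (a + 1)) with (S (Z.to_nat a)) by lia.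
  replace (Z.to_nat (- (a + 1))) with O by lia; replace (Z.to_nat (- a)) with O by lia.
  simpl; ring.
- replace (Z.to_nat (- a)) with (S (Z.to_nat (- (a + 1)))) by lia.
  replace (Z.to_nat (a + 1)) with O by lia; replace (Z.to_nat a) with O by lia.
  simpl; field; auto.
Qed.

Lemma Czpow_pred (w : C) a : w <> 0%C -> Czpow w (a - 1) = (/ w * Czpow w a)%C.
Proof.
intros Hw; replace a with (a - 1 + 1)%Z at 2 by lia; rewrite Czpow_succ by auto; field; auto.
Qed.

Lemma Czpow_add (w : C) a b : w <> 0%C -> Czpow w (a + b) = (Czpow w a * Czpow w b)%C.
Proof.
intros Hw; revert b; apply Z.peano_ind.
- rewrite Z.add_0_r, Czpow_0; ring.
- intros b IH; rewrite <- Z.add_1_r, Z.add_assoc, !Czpow_succ, IH by auto; ring.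
- intros b IH; rewrite <- Z.sub_1_r, Z.add_sub_assoc, !Czpow_pred, IH by auto; ring.
Qed.

Lemma Czpow_mult (w z : C) a : w <> 0%C -> z <> 0%C ->
  Czpow (w * z) a = (Czpow w a * Czpow z a)%C.
Proof.
intros Hw Hz; unfold Czpow.
replace (/ (w * z))%C with (/ w * / z)%C by (field; auto).
rewrite !Cpow_mult_l; ring.
Qed.

Lemma Czpow_inv (w : C) a : w <> 0%C -> Czpow (/ w) a = Czpow w (- a).
Proof.
intros Hw; unfold Czpow; rewrite Z.opp_involutive.
replace (/ / w)%C with w by (field; auto); ring.
Qed.

Lemma Czpow_neg (w : C) a : w <> 0%C -> Czpow w (- a) = (/ Czpow w a)%C.
Proof.
intros Hw; assert (E : (Czpow w a * Czpow w (- a))%C = 1%C)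
  by (rewrite <- Czpow_add, Z.add_opp_diag_r by auto; apply Czpow_0).
assert (Czpow w a <> 0%C).
{ intros H; rewrite H, Cmult_0_l in E; injection E; lra. }
rewrite <- (Cmult_1_l (/ _)), <- E; field; auto.
Qed.

Lemma Czpow_nat w n : Czpow w (Z.of_nat n) = (w ^ n)%C.
Proof.
unfold Czpow; rewrite Nat2Z.id; replace (Z.to_nat (- Z.of_nat n)) with O by lia; simpl; ring.
Qed.

Lemma Czpow_cexp u t a : Czpow (cexp u t) a = cexp (IZR a * u) (IZR a * t).
Proof.
pose proof (cexp_neq_0 u t) as Hw.
assert (E : cexp (- u) (- t) = (/ cexp u t)%C).
{ assert (E : (cexp (- u) (- t) * cexp u t)%C = 1%C).
  { rewrite <- cexp_plus, <- cexp_0; f_equal; ring. }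
  rewrite <- (Cmult_1_l (/ _)), <- E; field; auto. }
revert a; apply Z.peano_ind.
- rewrite Czpow_0, !Rmult_0_l; symmetry; apply cexp_0.
- intros a IH; rewrite <- Z.add_1_r, Czpow_succ, IH, plus_IZR, <- cexp_plus by auto.
  f_equal; ring.
- intros a IH; rewrite <- Z.sub_1_r, Czpow_pred, IH, minus_IZR, <- E, <- cexp_plus by auto.
  f_equal; ring.
Qed.

Lemma Cmod_Czpow w u a : Cmod w = exp u -> Cmod (Czpow w a) = exp (IZR a * u).
Proof.
intros Hu; pose proof (exp_pos u) as Hp.
assert (Hw : w <> 0%C) by (apply Cmod_gt_0; lra).
revert a; apply Z.peano_ind.
- now rewrite Czpow_0, Cmod_1, Rmult_0_l, exp_0.
- intros a IH; rewrite <- Z.add_1_r, Czpow_succ, Cmod_mult, IH, Hu, <- exp_plus, plus_IZR by auto.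
  f_equal; ring.
- intros a IH; rewrite <- Z.sub_1_r, Czpow_pred, Cmod_mult, Cmod_inv, IH, Hu,
    <- exp_Ropp, <- exp_plus, minus_IZR by auto.
  f_equal; ring.
Qed.

Lemma Cdiff_pow f n w : Cdiff f w -> Cdiff (fun w => f w ^ n)%C w.
Proof.
intros Hf; induction n as [|n IH]; [exact (Cdiff_const 1%C w)|exact (Cdiff_mult _ _ _ Hf IH)].
Qed.

Lemma Cdiff_Czpow a (w : C) : w <> 0%C -> Cdiff (fun w => Czpow w a) w.
Proof.
intros Hw; apply Cdiff_mult; apply Cdiff_pow; [apply Cdiff_id|now apply Cdiff_Cinv].
Qed.

(** * Cauchy's theorem for annuli *)

(** The integral of F (du + i dt) counterclockwise around the rectangle, whence the factors [Ci] on
    the vertical sides. *)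
Definition boundary_CInt (F : R -> R -> C) (x y h k : R) : C :=
  (CInt (fun u => F u y) x (x + h) + Ci * CInt (fun t => F (x + h)%R t) y (y + k)
   - CInt (fun u => F u (y + k)%R) x (x + h) - Ci * CInt (fun t => F x t) y (y + k))%C.

Definition continuous2_on (F : R -> R -> C) (x y h k : R) : Prop :=
  forall u t, x <= u <= x + h -> y <= t <= y + k -> continuous2 F u t.

Lemma continuous2_on_l F x y h k t : 0 <= h -> continuous2_on F x y h k ->
  y <= t <= y + k -> ex_CInt (fun u => F u t) x (x + h).
Proof.
intros; apply ex_CInt_continuous; [lra|]; intros; apply continuous2_l; auto.
Qed.

Lemma continuous2_on_r F x y h k u : 0 <= k -> continuous2_on F x y h k ->
  x <= u <= x + h -> ex_CInt (fun t => F u t) y (y + k).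
Proof.
intros; apply ex_CInt_continuous; [lra|]; intros; apply continuous2_r; auto.
Qed.

Lemma boundary_CInt_split F x y h k : 0 <= h -> 0 <= k ->
  continuous2_on F x y (2 * h) (2 * k) ->
  boundary_CInt F x y (2 * h) (2 * k) =
    (boundary_CInt F x y h k + boundary_CInt F (x + h) y h k
     + (boundary_CInt F x (y + k) h k + boundary_CInt F (x + h) (y + k) h k))%C.
Proof.
intros Hh Hk HF; unfold boundary_CInt.
replace (x + 2 * h) with (x + h + h) by ring.
replace (y + 2 * k) with (y + k + k) by ring.
assert (H1 : forall t, y <= t <= y + 2 * k ->
  CInt (fun u => F u t) x (x + h + h) =
  (CInt (fun u => F u t) x (x + h) + CInt (fun u => F u t) (x + h) (x + h + h))%C).
{ intros t Ht; symmetry; apply CInt_Chasles;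
  (apply ex_CInt_continuous; [lra|]; intros; apply continuous2_l, HF; lra). }
assert (H2 : forall u, x <= u <= x + 2 * h ->
  CInt (fun t => F u t) y (y + k + k) =
  (CInt (fun t => F u t) y (y + k) + CInt (fun t => F u t) (y + k) (y + k + k))%C).
{ intros u Hu; symmetry; apply CInt_Chasles;
  (apply ex_CInt_continuous; [lra|]; intros; apply continuous2_r, HF; lra). }
rewrite !H1, !H2 by lra; ring.
Qed.

Lemma boundary_CInt_minus F G x y h k : 0 <= h -> 0 <= k ->
  continuous2_on F x y h k -> continuous2_on G x y h k ->
  boundary_CInt (fun u t => F u t - G u t)%C x y h k =
    (boundary_CInt F x y h k - boundary_CInt G x y h k)%C.
Proof.
intros Hh Hk HF HG; unfold boundary_CInt.
rewrite !CInt_minus by (apply (continuous2_on_l _ x y h k) || apply (continuous2_on_r _ x y h k); auto; lra).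
change (CInt (F x)) with (CInt (fun t => F x t)); change (CInt (G x)) with (CInt (fun t => G x t)).
change (CInt (F (x + h))) with (CInt (fun t => F (x + h)%R t)).
change (CInt (G (x + h))) with (CInt (fun t => G (x + h)%R t)); ring.
Qed.

Lemma boundary_CInt_bound F x y h k B : 0 <= h -> 0 <= k ->
  continuous2_on F x y h k ->
  (forall u t, x <= u <= x + h -> y <= t <= y + k -> Cmod (F u t) <= B) ->
  Cmod (boundary_CInt F x y h k) <= 2 * (h + k) * B.
Proof.
intros Hh Hk HF HB; unfold boundary_CInt, Cminus.
assert (H1 : forall t, y <= t <= y + k -> Cmod (CInt (fun u => F u t) x (x + h)) <= h * B).
{ intros t Ht; replace (h * B) with ((x + h - x) * B) by ring.
  apply CInt_bound; [lra|auto|apply (continuous2_on_l _ x y h k); auto]. }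
assert (H2 : forall u, x <= u <= x + h -> Cmod (Ci * CInt (fun t => F u t) y (y + k))%C <= k * B).
{ intros u Hu; rewrite Cmod_mult, Cmod_Ci, Rmult_1_l; replace (k * B) with ((y + k - y) * B) by ring.
  apply CInt_bound; [lra|auto|apply (continuous2_on_r _ x y h k); auto]. }
eapply Rle_trans; [apply Cmod_triangle|]; rewrite Cmod_opp.
eapply Rle_trans; [apply Rplus_le_compat_r, Cmod_triangle|]; rewrite Cmod_opp.
eapply Rle_trans; [apply Rplus_le_compat_r, Rplus_le_compat_r, Cmod_triangle|].
pose proof (H1 y); pose proof (H1 (y + k)); pose proof (H2 x); pose proof (H2 (x + h)); lra.
Qed.

Lemma Ci_sqr : (Ci * Ci)%C = (- (1))%C.
Proof. unfold Ci, Cmult, Copp; simpl; unfold RtoC; f_equal; ring. Qed.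

(* In logarithmic coordinates [boundary_CInt] is the integral of [F dw / w]. *)
Lemma boundary_CInt_affine A B x y h k :
  boundary_CInt (fun u t => B + A * cexp u t)%C x y h k = 0%C.
Proof.
assert (H1 : forall t, CInt (fun u => B + A * cexp u t)%C x (x + h) =
  (RtoC h * B + A * (cexp (x + h) t - cexp x t))%C).
{ intros t; apply is_CInt_unique; replace (RtoC h) with (RtoC (x + h - x)) by (f_equal; ring).
  apply is_CInt_plus; [apply is_CInt_const|apply is_CInt_scal, is_CInt_cexp_u]. }
assert (H2 : forall u, CInt (fun t => B + A * cexp u t)%C y (y + k) =
  (RtoC k * B + (- Ci * A) * (cexp u (y + k) - cexp u y))%C).
{ intros u; apply is_CInt_unique; replace (RtoC k) with (RtoC (y + k - y)) by (f_equal; ring).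
  apply is_CInt_plus; [apply is_CInt_const|].
  pose proof (is_CInt_scal _ _ _ _ (- Ci * A)%C (is_CInt_cexp_t 1 u y (y + k))) as H.
  rewrite !Rmult_1_l in H; revert H; apply is_RInt_ext; intros t _.
  rewrite Rmult_1_l; match goal with |- ?a = ?b => change (@eq C a b) end.
  replace (- Ci * A * (RtoC 1 * Ci * cexp u t))%C with (- (Ci * Ci) * A * cexp u t)%C by ring.
  rewrite Ci_sqr; ring. }
unfold boundary_CInt; rewrite !H1, !H2.
(* [ring] treats [Ci] as an atom; isolating - (Ci * Ci) lets [Ci_sqr] turn it into 1. *)
replace (Ci * (RtoC k * B + - Ci * A * (cexp (x + h) (y + k) - cexp (x + h) y)))%C
  with (Ci * RtoC k * B + A * (cexp (x + h) (y + k) - cexp (x + h) y) * - (Ci * Ci))%C by ring.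
replace (Ci * (RtoC k * B + - Ci * A * (cexp x (y + k) - cexp x y)))%C
  with (Ci * RtoC k * B + A * (cexp x (y + k) - cexp x y) * - (Ci * Ci))%C by ring.
rewrite Ci_sqr; ring.
Qed.

Lemma continuous2_cexp (f : C -> C) u t : Ccontinuous f (cexp u t) ->
  continuous2 (fun u t => f (cexp u t)) u t.
Proof.
intros H; exact (continuous_comp (U := prod_UniformSpace R_UniformSpace R_UniformSpace)
  (V := C_UniformSpace) (W := C_UniformSpace)
  (fun p => cexp (fst p) (snd p)) f (u, t) (continuous_cexp u t) H).
Qed.

(** At scale s around w0 the function differs from its first order part by at most e * |w - w0| =
    O(e * s) on a boundary of length O(s), and the affine part integrates to 0. The result is at
    most eps * s^2, a bound that adds up under bisection. *)
Lemma Goursat f a c h k : 0 <= h -> 0 <= k ->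
  (forall w, exp a <= Cmod w <= exp (a + h) -> Cdiff f w) ->
  boundary_CInt (fun u t => f (cexp u t)) a c h k = 0%C.
Proof.
intros Hh Hk Hf; set (F := fun u t => f (cexp u t)).
assert (Hin : forall u t, a <= u <= a + h -> Cdiff f (cexp u t)).
{ intros u t Hu; apply Hf; rewrite Cmod_cexp; split; apply exp_le_exp; lra. }
assert (HF : continuous2_on F a c h k).
{ intros u t Hu _; apply continuous2_cexp, Cdiff_continuous; auto. }
apply Cmod_eq_0, Rle_antisym; [|apply Cmod_ge_0].
apply le_epsilon; intros eps He; rewrite Rplus_0_l.
pose (P x y s := Cmod (boundary_CInt F x y (s * h) (s * k)) <= eps * (s * s)).
enough (HP : P a c 1) by (unfold P in HP; now rewrite !Rmult_1_l, Rmult_1_r in HP).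
apply (rectangle_induction a c h k); auto; unfold P.
- intros x y s Hs Hx1 Hx2 Hy1 Hy2 H1 H2 H3 H4.
  set (h' := s / 2 * h) in *; set (k' := s / 2 * k) in *.
  assert (0 <= h') by (unfold h'; nra); assert (0 <= k') by (unfold k'; nra).
  assert (Eh : s * h = 2 * h') by (unfold h'; field).
  assert (Ek : s * k = 2 * k') by (unfold k'; field).
  rewrite Eh, Ek in *; rewrite boundary_CInt_split; auto.
  + eapply Rle_trans; [apply Cmod_triangle|].
    eapply Rle_trans; [apply Rplus_le_compat; apply Cmod_triangle|]; lra.
  + intros u t Hu Ht; apply HF; lra.
- intros x0 y0 Hx0 Hy0.
  (* Chosen to match 2 * (h + k), the boundary length, times exp (a + h) * (h + k), the bound on |w
     - w0| from [cexp_lipschitz], both at scale 1. *)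
  set (e := eps / (2 * (h + k) * (exp (a + h) * (h + k)) + 1)).
  pose proof (exp_pos (a + h)) as HE.
  assert (HM : 0 <= 2 * (h + k) * (exp (a + h) * (h + k))).
  { apply Rmult_le_pos; [lra|]; apply Rmult_le_pos; lra. }
  assert (Hpe : 0 < e) by (apply Rdiv_lt_0_compat; lra).
  assert (He' : e * (2 * (h + k) * (exp (a + h) * (h + k)) + 1) = eps) by (unfold e; field; lra).
  destruct (Hin x0 y0 Hx0) as [q [Hq Hfq]].
  set (w0 := cexp x0 y0) in *.
  destruct (continuous2_eps _ _ _ (continuous2_cexp q x0 y0 Hq) e) as [d [Hd H']]; [lra|].
  assert (Hhk : 0 < d / (h + k + 1)) by (apply Rdiv_lt_0_compat; lra).
  exists (d / (h + k + 1)); split; auto.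
  intros x y s [Hs Hsd] Hx1 Hx2 Hy1 Hy2 Hx Hy.
  apply (Rmult_lt_compat_r (h + k + 1)) in Hsd; [|lra].
  unfold Rdiv in Hsd; rewrite Rmult_assoc, Rinv_l, Rmult_1_r in Hsd by lra.
  assert (0 <= s * h) by nra; assert (0 <= s * k) by nra.
  set (G := fun u t => ((f w0 - q w0 * w0) + q w0 * cexp u t)%C).
  assert (HFs : continuous2_on F x y (s * h) (s * k)) by (intros u t Hu Ht; apply HF; lra).
  assert (HGs : continuous2_on G x y (s * h) (s * k)).
  { intros u t _ _; apply (continuous2_cexp (fun w => (f w0 - q w0 * w0) + q w0 * w)%C).
    apply Ccontinuous_plus; [apply continuous_const|].
    apply Ccontinuous_mult; [apply continuous_const|apply continuous_id]. }
  replace (boundary_CInt F x y (s * h) (s * k))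
    with (boundary_CInt (fun u t => F u t - G u t)%C x y (s * h) (s * k)).
  2: { rewrite boundary_CInt_minus by auto.
       unfold G; rewrite boundary_CInt_affine; ring. }
  apply Rle_trans with (2 * (s * h + s * k) * (e * (exp (a + h) * (s * h + s * k)))).
  + apply boundary_CInt_bound; auto.
    * intros u t Hu Ht; apply continuous2_minus; auto.
    * intros u t Hu Ht; unfold F, G; rewrite (Hfq (cexp u t)).
      replace (f w0 + q (cexp u t) * (cexp u t - w0) - (f w0 - q w0 * w0 + q w0 * cexp u t))%C
        with ((q (cexp u t) - q w0) * (cexp u t - w0))%C by ring.
      rewrite Cmod_mult; apply Rmult_le_compat; try apply Cmod_ge_0.
      -- apply Rlt_le, H'; apply Rabs_def1; lra.
      -- eapply Rle_trans; [apply (cexp_lipschitz (a + h)); lra|].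
         apply Rmult_le_compat_l; [lra|].
         apply Rplus_le_compat; apply Rabs_le; lra.
  + rewrite <- He'; assert (0 <= s * s * e) by nra; nra.
Qed.

(** * Means over circles *)

Definition cmean (f : C -> C) (u : R) : C :=
  (RtoC (/ (2 * PI)) * CInt (fun t => f (cexp u t)) 0 (2 * PI))%C.

Definition circle_continuous (f : C -> C) (u : R) : Prop :=
  forall t, Rcontinuous (fun t => f (cexp u t)) t.

Lemma circle_continuous_C f u : (forall w, Cmod w = exp u -> Ccontinuous f w) ->
  circle_continuous f u.
Proof.
intros H t; apply (continuous2_r (fun u t => f (cexp u t))), continuous2_cexp, H, Cmod_cexp.
Qed.

Lemma TwoPI_pos : 0 < 2 * PI.
Proof. pose proof PI_RGT_0; lra. Qed.

Lemma ex_circle f u : circle_continuous f u ->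
  ex_CInt (fun t => f (cexp u t)) 0 (2 * PI).
Proof.
intros H; pose proof TwoPI_pos; apply ex_CInt_continuous; [lra|].
intros t _; apply H.
Qed.

Lemma cmean_minus f g u : circle_continuous f u -> circle_continuous g u ->
  cmean (fun w => f w - g w)%C u = (cmean f u - cmean g u)%C.
Proof.
intros Hf Hg; unfold cmean; rewrite CInt_minus by now apply ex_circle.
ring.
Qed.

Lemma cmean_plus f g u : circle_continuous f u -> circle_continuous g u ->
  cmean (fun w => f w + g w)%C u = (cmean f u + cmean g u)%C.
Proof.
intros Hf Hg; unfold cmean; rewrite CInt_plus by now apply ex_circle.
ring.
Qed.

Lemma cmean_scal f k u : circle_continuous f u ->
  cmean (fun w => k * f w)%C u = (k * cmean f u)%C.
Proof.
intros Hf; unfold cmean; rewrite CInt_scal by now apply ex_circle.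
ring.
Qed.

Lemma cmean_ext f g u : (forall w, Cmod w = exp u -> f w = g w) -> cmean f u = cmean g u.
Proof.
intros H; unfold cmean; f_equal; pose proof TwoPI_pos; apply CInt_ext; [lra|].
intros t _; apply H, Cmod_cexp.
Qed.

Lemma cmean_bound f u B : circle_continuous f u ->
  (forall w, Cmod w = exp u -> Cmod (f w) <= B) -> Cmod (cmean f u) <= B.
Proof.
intros Hf HB; unfold cmean; pose proof TwoPI_pos.
rewrite Cmod_mult, Cmod_R, Rabs_pos_eq by (apply Rlt_le, Rinv_0_lt_compat; lra).
apply Rmult_le_reg_l with (2 * PI); [lra|].
rewrite <- Rmult_assoc, Rinv_r, Rmult_1_l by lra.
pose proof (CInt_bound (fun t => f (cexp u t)) 0 (2 * PI) B) as Hb; rewrite Rminus_0_r in Hb.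
apply Hb; [lra| |now apply ex_circle]; intros t _; apply HB, Cmod_cexp.
Qed.

(** Goursat on the rectangle [u, v] x [0, 2 pi]: the horizontal sides cancel by periodicity, and the
    vertical ones are the two circles. *)
Lemma cmean_Cauchy f u v : u <= v ->
  (forall w, exp u <= Cmod w <= exp v -> Cdiff f w) -> cmean f u = cmean f v.
Proof.
intros Huv Hf; pose proof TwoPI_pos.
pose proof (Goursat f u 0 (v - u) (2 * PI)) as G; unfold boundary_CInt in G.
replace (u + (v - u)) with v in G by ring; rewrite Rplus_0_l in G.
assert (E : CInt (fun u => f (cexp u 0)) u v = CInt (fun u => f (cexp u (2 * PI))) u v).
{ apply CInt_ext; auto; intros x _; now rewrite <- (cexp_2PI x 0), Rplus_0_l. }
rewrite E in G; unfold cmean; f_equal; apply Cminus_eq_0.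
specialize (G ltac:(lra) ltac:(lra) Hf).
set (I1 := CInt (fun t => f (cexp u t)) 0 (2 * PI)) in *.
set (I2 := CInt (fun t => f (cexp v t)) 0 (2 * PI)) in *.
(* A polynomial identity in [Ci]: its first term contains Ci * I2 - Ci * I1, which is 0 by [G], and
   its last factor is 1 + (Ci * Ci)^3 = 0. *)
replace (I1 - I2)%C with (Ci * (Ci * I2 - Ci * I1) * ((Ci * Ci) * (Ci * Ci)) + (I1 - I2) * (1 + (Ci * Ci) * (Ci * Ci) * (Ci * Ci)))%C by ring.
replace (Ci * I2 - Ci * I1)%C with (RtoC 0) by (etransitivity; [symmetry; exact G|ring]).
rewrite Ci_sqr; ring.
Qed.

Lemma cmean_continuous f u0 eps : 0 < eps ->
  (forall w, Cmod w = exp u0 -> Ccontinuous f w) ->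
  exists d, 0 < d /\ forall u, Rabs (u - u0) < d -> circle_continuous f u ->
    Cmod (cmean f u - cmean f u0)%C <= eps.
Proof.
intros He Hf; pose proof (circle_continuous_C f u0 Hf); pose proof TwoPI_pos.
destruct (continuous2_uniform (fun u t => f (cexp u t)) u0 0 (2 * PI)) with (eps := eps)
  as [d [Hd H']]; auto; [lra|intros; apply continuous2_cexp, Hf, Cmod_cexp|].
exists d; split; auto; intros u Hu Hfu.
unfold cmean.
replace (RtoC (/ (2 * PI)) * CInt (fun t => f (cexp u t)) 0 (2 * PI)
   - RtoC (/ (2 * PI)) * CInt (fun t => f (cexp u0 t)) 0 (2 * PI))%C
  with (RtoC (/ (2 * PI)) * CInt (fun t => f (cexp u t) - f (cexp u0 t))%C 0 (2 * PI))%C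
  by (rewrite CInt_minus by (now apply ex_circle); ring).
rewrite Cmod_mult, Cmod_R, Rabs_pos_eq by (apply Rlt_le, Rinv_0_lt_compat; lra).
apply Rmult_le_reg_l with (2 * PI); [lra|].
rewrite <- Rmult_assoc, Rinv_r, Rmult_1_l by lra.
pose proof (CInt_bound (fun t => f (cexp u t) - f (cexp u0 t))%C 0 (2 * PI) eps) as Hb.
rewrite Rminus_0_r in Hb; apply Hb; [lra| |].
- intros t Ht; apply H'; [auto|lra].
- eexists; apply is_CInt_minus; apply CInt_correct, ex_circle; auto.
Qed.

(** Meant for a difference quotient at w0, which is only known to be continuous at w0 itself, a
    point of a bounding circle. Continuity of the mean in the radius extends the equality from
    interior circles. *)
Lemma cmean_Cauchy_open f u v : u < v ->
  (forall w, exp u <= Cmod w <= exp v -> Ccontinuous f w) ->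
  (forall w, exp u < Cmod w < exp v -> Cdiff f w) -> cmean f u = cmean f v.
Proof.
intros Huv Hc Hd.
assert (Hcirc0 : forall x, u <= x <= v -> forall w, Cmod w = exp x -> Ccontinuous f w).
{ intros x Hx w Hw; apply Hc; rewrite Hw; split; apply exp_le_exp; lra. }
assert (Hcirc : forall x, u <= x <= v -> circle_continuous f x).
{ intros x Hx; exact (circle_continuous_C f x (Hcirc0 x Hx)). }
assert (mid : forall x y, u < x -> x <= y -> y < v -> cmean f x = cmean f y).
{ intros x y Hx Hxy Hy; apply cmean_Cauchy; auto; intros w Hw; apply Hd.
  pose proof (exp_increasing u x Hx); pose proof (exp_increasing y v Hy); lra. }
set (m := (u + v) / 2); assert (u < m < v) by (unfold m; lra).
assert (L : forall x, x = u \/ x = v -> cmean f x = cmean f m).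
{ intros x Hx; apply Cminus_eq_0, Cmod_eq_0, Rle_antisym; [|apply Cmod_ge_0].
  apply le_epsilon; intros eps He; rewrite Rplus_0_l.
  destruct (cmean_continuous f x eps He) as [d [Hdp H']]; [apply Hcirc0; lra|].
  set (r := Rmin (d / 2) ((v - u) / 2)).
  assert (0 < r) by (apply Rmin_pos; lra).
  pose proof (Rmin_l (d / 2) ((v - u) / 2)) as Hr1.
  pose proof (Rmin_r (d / 2) ((v - u) / 2)) as Hr2; fold r in Hr1, Hr2.
  rewrite <- Cmod_opp.
  destruct Hx as [-> | ->].
  - rewrite <- (mid (u + r) m) by (unfold m; lra).
    replace (- (cmean f u - cmean f (u + r)))%C with (cmean f (u + r) - cmean f u)%C by ring.
    apply H'; [apply Rabs_def1; lra|apply Hcirc; lra].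
  - rewrite (mid m (v - r)) by (unfold m; lra).
    replace (- (cmean f v - cmean f (v - r)))%C with (cmean f (v - r) - cmean f v)%C by ring.
    apply H'; [apply Rabs_def1; lra|apply Hcirc; lra]. }
rewrite (L u), (L v); auto.
Qed.

(** * Laurent expansion in one variable *)

Fixpoint Zsum (f : Z -> C) (N : nat) : C :=
  match N with
  | O => f 0%Z
  | S n => (Zsum f n + (f (Z.of_nat (S n)) + f (- Z.of_nat (S n))%Z))%C
  end.

Lemma Zsum_S f n :
  Zsum f (S n) = (Zsum f n + (f (Z.of_nat (S n)) + f (- Z.of_nat (S n))%Z))%C.
Proof. reflexivity. Qed.

Lemma Zsum_ext f g N : (forall a, (Z.abs a <= Z.of_nat N)%Z -> f a = g a) ->
  Zsum f N = Zsum g N.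
Proof.
induction N as [|N IH]; intros H; [apply H; lia|].
rewrite ?Zsum_S; rewrite IH by (intros; apply H; lia); do 2 f_equal; apply H; lia.
Qed.

Lemma Zsum_plus f g N : Zsum (fun a => f a + g a)%C N = (Zsum f N + Zsum g N)%C.
Proof. induction N as [|N IH]; [simpl|rewrite !Zsum_S, IH]; ring. Qed.

Lemma Zsum_minus f g N : Zsum (fun a => f a - g a)%C N = (Zsum f N - Zsum g N)%C.
Proof. induction N as [|N IH]; [simpl|rewrite !Zsum_S, IH]; ring. Qed.

Lemma Zsum_scal k f N : Zsum (fun a => k * f a)%C N = (k * Zsum f N)%C.
Proof. induction N as [|N IH]; [simpl|rewrite !Zsum_S, IH]; ring. Qed.

Lemma Zsum_0 f N : (forall a, (Z.abs a <= Z.of_nat N)%Z -> f a = RtoC 0) ->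
  Zsum f N = RtoC 0.
Proof.
induction N as [|N IH]; intros H; [apply H; lia|].
rewrite ?Zsum_S; rewrite IH by (intros; apply H; lia).
rewrite !H by lia; ring.
Qed.

Lemma Zsum_single f N a : (Z.abs a <= Z.of_nat N)%Z ->
  (forall b, b <> a -> f b = RtoC 0) -> Zsum f N = f a.
Proof.
intros Ha H; induction N as [|N IH]; [simpl; f_equal; lia|].
rewrite ?Zsum_S; destruct (Z_le_gt_dec (Z.abs a) (Z.of_nat N)) as [H1|H1].
- rewrite IH, !(H (Z.of_nat (S N))), !(H (- Z.of_nat (S N))%Z) by lia; ring.
- rewrite Zsum_0 by (intros; apply H; lia).
  destruct (Z_le_gt_dec 0 a).
  + replace (Z.of_nat (S N)) with a by lia; rewrite (H (- a)%Z) by lia; ring.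
  + replace (- Z.of_nat (S N))%Z with a by lia.
    replace (Z.of_nat (S N)) with (- a)%Z by lia; rewrite (H (- a)%Z) by lia; ring.
Qed.

Lemma Zsum_bound f N B : (forall a, (Z.abs a <= Z.of_nat N)%Z -> Cmod (f a) <= B) ->
  Cmod (Zsum f N) <= (2 * INR N + 1) * B.
Proof.
induction N as [|N IH]; intros H.
- simpl; rewrite Rmult_0_r, Rplus_0_l, Rmult_1_l; apply H; lia.
- rewrite S_INR; rewrite ?Zsum_S.
  eapply Rle_trans; [apply Cmod_triangle|].
  eapply Rle_trans; [apply Rplus_le_compat_l, Cmod_triangle|].
  pose proof (H (Z.of_nat (S N)) ltac:(lia)); pose proof (H (- Z.of_nat (S N))%Z ltac:(lia)).
  specialize (IH (fun a Ha => H a ltac:(lia))); lra.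
Qed.

Lemma Zsum_telescope T N :
  Zsum (fun a => T a - T (a + 1)%Z)%C N = (T (- Z.of_nat N)%Z - T (Z.of_nat N + 1)%Z)%C.
Proof.
induction N as [|N IH]; [reflexivity|].
rewrite ?Zsum_S; rewrite IH.
replace (- Z.of_nat (S N) + 1)%Z with (- Z.of_nat N)%Z by lia.
replace (Z.of_nat N + 1)%Z with (Z.of_nat (S N)) by lia; ring.
Qed.

(** * Means of Laurent monomials *)

Lemma circle_continuous_Czpow a u : circle_continuous (fun w => Czpow w a) u.
Proof.
apply circle_continuous_C; intros w Hw; apply Cdiff_continuous, Cdiff_Czpow, Cmod_gt_0.
rewrite Hw; apply exp_pos.
Qed.

Lemma circle_continuous_mult f g u : circle_continuous f u -> circle_continuous g u ->
  circle_continuous (fun w => f w * g w)%C u.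
Proof. intros Hf Hg t; apply (continuous_Cmult (fun t => f (cexp u t)) (fun t => g (cexp u t))); auto. Qed.

Lemma circle_continuous_minus f g u : circle_continuous f u -> circle_continuous g u ->
  circle_continuous (fun w => f w - g w)%C u.
Proof. intros Hf Hg t; apply (Rcontinuous_minus (fun t => f (cexp u t)) (fun t => g (cexp u t))); auto. Qed.

Lemma circle_continuous_plus f g u : circle_continuous f u -> circle_continuous g u ->
  circle_continuous (fun w => f w + g w)%C u.
Proof. intros Hf Hg t; apply (Rcontinuous_plus (fun t => f (cexp u t)) (fun t => g (cexp u t))); auto. Qed.

Lemma circle_continuous_const k u : circle_continuous (fun _ => k) u.
Proof. intros t; apply continuous_const. Qed.

Lemma circle_continuous_Zsum (F : Z -> C -> C) N u :
  (forall a, circle_continuous (F a) u) ->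
  circle_continuous (fun w => Zsum (fun a => F a w) N) u.
Proof.
intros H; induction N as [|N IH]; [apply H|].
apply circle_continuous_plus; auto; apply circle_continuous_plus; auto.
Qed.

Lemma cmean_Zsum (F : Z -> C -> C) N u : (forall a, circle_continuous (F a) u) ->
  cmean (fun w => Zsum (fun a => F a w) N) u = Zsum (fun a => cmean (F a) u) N.
Proof.
intros H; induction N as [|N IH]; [reflexivity|].
change (cmean (fun w => Zsum (fun a => F a w) N
  + (F (Z.of_nat (S N)) w + F (- Z.of_nat (S N))%Z w))%C u = Zsum (fun a => cmean (F a) u) (S N)).
rewrite cmean_plus, Zsum_S, <- IH, cmean_plus; auto.
- now apply circle_continuous_Zsum.
- now apply circle_continuous_plus.
Qed.

Lemma cmean_const k u : cmean (fun _ => k) u = k.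
Proof.
unfold cmean; rewrite CInt_const, Rminus_0_r, Cmult_assoc, <- RtoC_mult, Rinv_l, Cmult_1_l.
- reflexivity.
- pose proof PI_RGT_0; lra.
Qed.

(** For a <> 0, i a w^a is the derivative of the periodic function w^a of the angle, so it
    integrates to 0 over a period. *)
Lemma cmean_Czpow a u : cmean (fun w => Czpow w a) u = if Z.eq_dec a 0 then RtoC 1 else RtoC 0.
Proof.
destruct Z.eq_dec as [->|Ha].
- rewrite <- (cmean_const (RtoC 1) u); apply cmean_ext; intros; apply Czpow_0.
- unfold cmean; set (k := (RtoC (IZR a) * Ci)%C).
  assert (Hk : k <> RtoC 0).
  { apply Cmult_neq_0.
    * intros E; apply RtoC_inj, eq_IZR in E; auto.
    * intros E; pose proof Ci_sqr as H; rewrite E in H; injection H; lra. }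
  assert (cancel : forall X, (k * X)%C = RtoC 0 -> X = RtoC 0).
  { intros X E; replace X with (/ k * (k * X))%C by (field; auto); rewrite E; ring. }
  apply cancel.
  + pose proof (is_CInt_unique _ _ _ _ (is_CInt_cexp_t (IZR a) (IZR a * u) 0 (2 * PI))) as H.
    fold k in H; rewrite CInt_scal in H.
    * erewrite CInt_ext with (g := fun t => cexp (IZR a * u) (IZR a * t));
        [|pose proof TwoPI_pos; lra|intros; apply Czpow_cexp].
      replace (cexp (IZR a * u) (IZR a * (2 * PI))) with (cexp (IZR a * u) (IZR a * 0)) in H.
      -- transitivity (RtoC (/ (2 * PI)) * (RtoC 0))%C; [|ring].
         replace (RtoC 0) with (cexp (IZR a * u) (IZR a * 0) - cexp (IZR a * u) (IZR a * 0))%C by ring.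
         rewrite <- H; ring.
      -- rewrite <- !Czpow_cexp; f_equal; now rewrite <- (cexp_2PI u 0), Rplus_0_l.
    * apply ex_RInt_ext with (fun t => Czpow (cexp u t) a); [intros; apply Czpow_cexp|].
      apply (ex_circle (fun w => Czpow w a)), circle_continuous_Czpow.
Qed.

(* Chernoff's trick: with f(w) = f(w0) + g(w) (w - w0) the partial sums of the Laurent
   series telescope to two Laurent coefficients of g, which are estimated on the circles
   |w| = e^(u +- e) on both sides of w0. *)
Lemma Laurent_remainder f u e B w0 N : 0 < e -> Cmod w0 = exp u ->
  (forall w, exp (u - e) <= Cmod w <= exp (u + e) -> Cdiff f w) ->
  (forall w, Cmod w = exp (u - e) \/ Cmod w = exp u \/ Cmod w = exp (u + e) -> Cmod (f w) <= B) ->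
  Cmod (f w0 - Zsum (fun a => cmean (fun w => f w * Czpow w (- a))%C u * Czpow w0 a)%C N)%C
    <= 4 * B / (exp e - 1) * exp (- (INR N * e)).
Proof.
intros He Hw0 Hd HB.
assert (Hin : forall v, u - e <= v <= u + e -> exp (u - e) <= exp v <= exp (u + e))
  by (intros v Hv; split; apply exp_le_exp; lra).
assert (Hw0z : w0 <> 0%C) by (apply Cmod_gt_0; rewrite Hw0; apply exp_pos).
destruct (Hd w0) as [g [Hg Hfg]]; [rewrite Hw0; apply Hin; lra|].
assert (Hgd : forall w, exp (u - e) <= Cmod w <= exp (u + e) -> w <> w0 -> Cdiff g w).
{ intros w Hw Hne.
  assert (Hne' : (w - w0)%C <> 0%C) by (intros E; apply Hne, Cminus_eq_0, E).
  assert (Hm : Cdiff (fun w => / (w - w0))%C w).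
  { apply Cdiff_local with (fun w' => - / ((w' - w0) * (w - w0)))%C.
    - apply (continuous_opp (V := C_NormedModule)), Ccontinuous_inv.
      + exact (Cmult_neq_0 _ _ Hne' Hne').
      + apply Ccontinuous_mult; [|apply continuous_const].
        apply Ccontinuous_minus; [apply continuous_id|apply continuous_const].
    - apply (locally_le_locally_norm (K := C_AbsRing) (V := C_NormedModule)).
      exists (mkposreal _ (proj1 (Cmod_gt_0 _) Hne')); intros w' Hw'; change C in w'.
      change (Cmod (w' - w)%C < Cmod (w - w0)%C) in Hw'.
      assert ((w' - w0)%C <> 0%C).
      { intros E; apply Cminus_eq_0 in E; subst w'.
        rewrite <- Cmod_opp in Hw'; replace (- (w0 - w))%C with (w - w0)%C in Hw' by ring; lra. }
      field; auto. }
  assert (Hm' : Cdiff (fun w => (f w - f w0) * / (w - w0))%C w).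
  { apply Cdiff_mult; auto; destruct (Hd w Hw) as [q [Hq Hfq]]; exists q; split; auto.
    intros w'; rewrite (Hfq w'); ring. }
  destruct Hm' as [q [Hq Hfq]]; apply Cdiff_local with q; auto.
  apply (locally_le_locally_norm (K := C_AbsRing) (V := C_NormedModule)).
  exists (mkposreal _ (proj1 (Cmod_gt_0 _) Hne')); intros w' Hw'; change C in w'.
  change (Cmod (w' - w)%C < Cmod (w - w0)%C) in Hw'.
  assert ((w' - w0)%C <> 0%C).
  { intros E; apply Cminus_eq_0 in E; subst w'.
    rewrite <- Cmod_opp in Hw'; replace (- (w0 - w))%C with (w - w0)%C in Hw' by ring; lra. }
  specialize (Hfq w'); rewrite (Hfg w'), (Hfg w) in Hfq.
  replace (g w') with ((f w0 + g w' * (w' - w0) - f w0) * / (w' - w0))%C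
    by (field; auto).
  rewrite Hfq; field; auto. }
assert (Hgc : forall w, exp (u - e) <= Cmod w <= exp (u + e) -> Ccontinuous g w).
{ intros w Hw; destruct (classic (w = w0)) as [->|Hne]; auto.
  apply Cdiff_continuous; auto. }
set (G := fun a : Z => cmean (fun w => g w * Czpow w (- a))%C u).
assert (Hcg : forall a v, u - e <= v <= u + e -> circle_continuous (fun w => g w * Czpow w a)%C v).
{ intros a v Hv; apply circle_continuous_mult; [|apply circle_continuous_Czpow].
  apply circle_continuous_C; intros w Hw; apply Hgc; rewrite Hw; auto. }
assert (Hnz : forall w, exp (u - e) <= Cmod w -> w <> 0%C).
{ intros w Hw; apply Cmod_gt_0; pose proof (exp_pos (u - e)); lra. }
(* From f = f(w0) + w g - w0 g, the coefficient of index a is G(a - 1) - w0 G(a), plus f(w0) if a =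
   0. The unreduced a + 1 - 1 fits the form of [Zsum_telescope]. *)
assert (Hcoef : forall a, (cmean (fun w => f w * Czpow w (- a)) u * Czpow w0 a)%C =
  ((if Z.eq_dec a 0 then f w0 else RtoC 0) +
   (G (a - 1)%Z * Czpow w0 a - G (a + 1 - 1)%Z * Czpow w0 (a + 1)))%C).
{ intros a.
  assert (E : cmean (fun w => f w * Czpow w (- a))%C u =
    (f w0 * cmean (fun w => Czpow w (- a)) u + (G (a - 1)%Z - w0 * G a))%C).
  { unfold G; rewrite <- !cmean_scal, <- cmean_minus, <- cmean_plus.
    - apply cmean_ext; intros w Hw; rewrite (Hfg w).
      replace (- (a - 1))%Z with (- a + 1)%Z by lia.
      rewrite Czpow_succ by (apply Hnz; rewrite Hw; apply Hin; lra); ring.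
    - apply circle_continuous_mult; [apply circle_continuous_const|apply circle_continuous_Czpow].
    - apply circle_continuous_minus; [apply Hcg; lra|].
      apply circle_continuous_mult; [apply circle_continuous_const|apply Hcg; lra].
    - apply Hcg; lra.
    - apply circle_continuous_mult; [apply circle_continuous_const|apply Hcg; lra].
    - apply Hcg; lra.
    - apply circle_continuous_Czpow. }
  rewrite E, cmean_Czpow, Czpow_succ by auto.
  replace (a + 1 - 1)%Z with a by lia.
  destruct (Z.eq_dec a 0) as [->|Ha]; destruct Z.eq_dec as [H0|H0]; try lia.
  - rewrite Czpow_0; ring.
  - ring. }
rewrite (Zsum_ext _ _ _ (fun a _ => Hcoef a)), Zsum_plus.
rewrite (Zsum_single (fun a => if Z.eq_dec a 0 then f w0 else RtoC 0) N 0)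
  by (lia || (intros b Hb; destruct Z.eq_dec; [lia|auto])).
destruct (Z.eq_dec 0 0) as [_|?]; [|lia].
rewrite (Zsum_telescope (fun a => G (a - 1)%Z * Czpow w0 a)%C).
replace (Z.of_nat N + 1 - 1)%Z with (Z.of_nat N) by lia.
set (X := (G (- Z.of_nat N - 1)%Z * Czpow w0 (- Z.of_nat N))%C).
set (Y := (G (Z.of_nat N) * Czpow w0 (Z.of_nat N + 1))%C).
replace (f w0 - (f w0 + (X - Y)))%C with (Y + - X)%C by ring.
eapply Rle_trans; [apply Cmod_triangle|]; rewrite Cmod_opp.
assert (Hexp : 0 < exp e - 1) by (pose proof (exp_ineq1 e); lra).
pose proof (exp_pos u) as Hpu.
assert (HB0 : 0 <= B) by (eapply Rle_trans; [apply Cmod_ge_0|apply (HB w0); auto]).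
assert (Hgb : forall w d, 0 < d -> d <= Cmod (w - w0)%C -> Cmod (f w) <= B -> Cmod (g w) <= 2 * B / d).
{ intros w d Hdp Hdw Hfw.
  apply Rmult_le_reg_r with d; auto.
  unfold Rdiv; rewrite Rmult_assoc, Rinv_l, Rmult_1_r by lra.
  apply Rle_trans with (Cmod (g w) * Cmod (w - w0)%C);
    [apply Rmult_le_compat_l; auto; apply Cmod_ge_0|].
  rewrite <- Cmod_mult.
  replace (g w * (w - w0))%C with (f w + - f w0)%C by (rewrite (Hfg w); ring).
  eapply Rle_trans; [apply Cmod_triangle|]; rewrite Cmod_opp.
  pose proof (HB w0); lra. }
(* Index N gains exp (- N e) on the larger circle, index - N - 1 on the smaller one. The distance of
   these circles to w0 is at least exp u (exp e - 1), respectively exp (u - e) (exp e - 1), which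
   bounds g through [Hgb]. *)
assert (HY : Cmod Y <= 2 * B / (exp e - 1) * exp (- (INR N * e))).
{ unfold Y, G; rewrite (cmean_Cauchy_open _ u (u + e)); [|lra| |].
  - rewrite Cmod_mult, (Cmod_Czpow w0 u) by auto.
    set (d := exp u * (exp e - 1)).
    assert (Hdp : 0 < d) by (apply Rmult_lt_0_compat; lra).
    apply Rle_trans with ((2 * B / d * exp (IZR (- Z.of_nat N) * (u + e))) * exp (IZR (Z.of_nat N + 1) * u)).
    + apply Rmult_le_compat_r; [apply Rlt_le, exp_pos|].
      apply cmean_bound; [apply Hcg; lra|]; intros w Hw.
      rewrite Cmod_mult, (Cmod_Czpow w (u + e)) by auto.
      apply Rmult_le_compat_r; [apply Rlt_le, exp_pos|].
      apply Hgb; auto.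
      pose proof (Cmod_triangle (w - w0)%C w0) as T.
      replace (w - w0 + w0)%C with w in T by ring.
      rewrite Hw, Hw0, exp_plus in T; unfold d; lra.
    + rewrite Rmult_assoc, <- exp_plus, opp_IZR, plus_IZR, <- INR_IZR_INZ.
      replace (- INR N * (u + e) + (INR N + 1) * u) with (u + - (INR N * e)) by ring.
      rewrite exp_plus; unfold d; right; field; lra.
  - intros w Hw; apply Ccontinuous_mult.
    + apply Hgc; split; [|lra]; eapply Rle_trans with (2 := proj1 Hw); apply exp_le_exp; lra.
    + apply Cdiff_continuous, Cdiff_Czpow, Cmod_gt_0; lra.
  - intros w Hw; apply Cdiff_mult.
    + apply Hgd; [split; [|lra]|intros ->; lra].
      apply Rle_trans with (exp u); [apply exp_le_exp|]; lra.
    + apply Cdiff_Czpow, Cmod_gt_0; lra. }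
assert (HX : Cmod X <= 2 * B / (exp e - 1) * exp (- (INR N * e))).
{ unfold X, G; rewrite <- (cmean_Cauchy_open _ (u - e) u); [|lra| |].
  - rewrite Cmod_mult, (Cmod_Czpow w0 u) by auto.
    set (d := exp (u - e) * (exp e - 1)).
    pose proof (exp_pos (u - e)) as Hpue.
    assert (Hdp : 0 < d) by (apply Rmult_lt_0_compat; lra).
    apply Rle_trans with ((2 * B / d * exp (IZR (- (- Z.of_nat N - 1)) * (u - e))) * exp (IZR (- Z.of_nat N) * u)).
    + apply Rmult_le_compat_r; [apply Rlt_le, exp_pos|].
      apply cmean_bound; [apply Hcg; lra|]; intros w Hw.
      rewrite Cmod_mult, (Cmod_Czpow w (u - e)) by auto.
      apply Rmult_le_compat_r; [apply Rlt_le, exp_pos|].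
      apply Hgb; auto.
      pose proof (Cmod_triangle (w0 - w)%C w) as T.
      rewrite <- (Cmod_opp (w - w0)%C); replace (- (w - w0))%C with (w0 - w)%C by ring.
      replace (w0 - w + w)%C with w0 in T by ring.
      rewrite Hw, Hw0 in T.
      replace (exp u) with (exp (u - e) * exp e) in T by (rewrite <- exp_plus; f_equal; ring).
      unfold d; lra.
    + rewrite Rmult_assoc, <- exp_plus, !opp_IZR, minus_IZR, opp_IZR, <- INR_IZR_INZ.
      replace (- (- INR N - 1) * (u - e) + - INR N * u) with ((u - e) + - (INR N * e)) by ring.
      rewrite exp_plus; unfold d; right; field; lra.
  - intros w Hw; pose proof (exp_pos (u - e)); apply Ccontinuous_mult.
    + apply Hgc; split; [lra|]; eapply Rle_trans with (1 := proj2 Hw); apply exp_le_exp; lra.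
    + apply Cdiff_continuous, Cdiff_Czpow, Cmod_gt_0; lra.
  - intros w Hw; pose proof (exp_pos (u - e)); apply Cdiff_mult.
    + apply Hgd; [split; [lra|]|intros ->; lra].
      apply Rle_trans with (exp u); [|apply exp_le_exp]; lra.
    + apply Cdiff_Czpow, Cmod_gt_0; lra. }
unfold Rdiv in *; lra.
Qed.

(** * Laurent coefficients on the annulus *)

Definition torus_continuous (M : C -> C -> C) (u v : R) : Prop :=
  forall s t, continuous2 (fun s t => M (cexp u s) (cexp v t)) s t.

Lemma torus_continuous_mult f g u v : torus_continuous f u v -> torus_continuous g u v ->
  torus_continuous (fun w z => f w z * g w z)%C u v.
Proof.
intros Hf Hg s t; apply (continuous_Cmult
  (fun p : R * R => f (cexp u (fst p)) (cexp v (snd p)))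
  (fun p : R * R => g (cexp u (fst p)) (cexp v (snd p)))); [apply Hf|apply Hg].
Qed.

Lemma torus_continuous_plus f g u v : torus_continuous f u v -> torus_continuous g u v ->
  torus_continuous (fun w z => f w z + g w z)%C u v.
Proof.
intros Hf Hg s t; exact (continuous_plus (V := C_NormedModule)
  (fun p : R * R => f (cexp u (fst p)) (cexp v (snd p)))
  (fun p : R * R => g (cexp u (fst p)) (cexp v (snd p))) (s, t) (Hf s t) (Hg s t)).
Qed.

Lemma torus_continuous_const k u v : torus_continuous (fun _ _ => k) u v.
Proof. intros s t; apply continuous2_const. Qed.

Lemma torus_continuous_l (f : C -> C) u v : circle_continuous f u ->
  torus_continuous (fun w _ => f w) u v.
Proof.
intros Hf s t; exact (continuous_comp (U := prod_UniformSpace R_UniformSpace R_UniformSpace)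
  (V := R_UniformSpace) (W := C_UniformSpace) fst (fun s => f (cexp u s)) (s, t)
  (continuous_fst s t) (Hf s)).
Qed.

Lemma torus_continuous_r (f : C -> C) u v : circle_continuous f v ->
  torus_continuous (fun _ z => f z) u v.
Proof.
intros Hf s t; exact (continuous_comp (U := prod_UniformSpace R_UniformSpace R_UniformSpace)
  (V := R_UniformSpace) (W := C_UniformSpace) snd (fun s => f (cexp v s)) (s, t)
  (continuous_snd s t) (Hf t)).
Qed.

Lemma torus_continuous_swap M u v : torus_continuous M u v ->
  torus_continuous (fun z w => M w z) v u.
Proof. intros H s t; exact (continuous2_swap _ _ _ (H t s)). Qed.

Lemma torus_slice_l M u v t : torus_continuous M u v ->
  circle_continuous (fun w => M w (cexp v t)) u.
Proof. intros H s; exact (continuous2_l _ _ _ (H s t)). Qed.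

Lemma torus_mean M u v : torus_continuous M u v ->
  circle_continuous (fun z => cmean (fun w => M w z) u) v.
Proof.
intros H t; unfold cmean; apply Rcontinuous_scal.
apply (CInt_param_continuous (fun t s => M (cexp u s) (cexp v t)));
  [pose proof TwoPI_pos; lra|apply (torus_continuous_swap _ _ _ H)].
Qed.

Definition dmean (M : C -> C -> C) (u v : R) : C := cmean (fun z => cmean (fun w => M w z) u) v.

(** Continuity on circles and tori is stated with angles, the extensionality of means with points;
    this passes from the latter to the former. *)
Lemma circle_point z v : Cmod z = exp v -> exists t, z = cexp v t.
Proof.
intros Hz; pose proof (exp_pos v) as Hv.
set (x := fst z / exp v); set (y := snd z / exp v).
assert (E : x * x + y * y = 1).
{ unfold x, y; replace (fst z / exp v * (fst z / exp v) + snd z / exp v * (snd z / exp v))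
    with ((fst z ^ 2 + snd z ^ 2) / (exp v) ^ 2) by (field; lra).
  rewrite <- Hz; unfold Cmod; rewrite pow2_sqrt.
  - field; intros E0; assert (Cmod z = 0) by (unfold Cmod; now rewrite E0, sqrt_0); lra.
  - pose proof (pow2_ge_0 (fst z)); pose proof (pow2_ge_0 (snd z)); lra. }
assert (Hx : -1 <= x <= 1) by nra.
assert (Hs : sin (acos x) * sin (acos x) = y * y).
{ pose proof (sin2_cos2 (acos x)) as S; unfold Rsqr in S; rewrite cos_acos in S by auto; lra. }
assert (Hsy : sin (acos x) = y \/ sin (acos x) = - y).
{ destruct (Rsqr_eq _ _ Hs); auto. }
assert (Ez : z = (exp v * x, exp v * y)).
{ destruct z as [a b]; unfold x, y; simpl; f_equal; field; lra. }
destruct Hsy as [S|S]; [exists (acos x)|exists (- acos x)]; unfold cexp;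
  rewrite ?cos_neg, ?sin_neg, cos_acos, S, ?Ropp_involutive by auto; exact Ez.
Qed.

Lemma dmean_ext f g u v :
  (forall w z, Cmod w = exp u -> Cmod z = exp v -> f w z = g w z) -> dmean f u v = dmean g u v.
Proof. intros H; apply cmean_ext; intros z Hz; apply cmean_ext; auto. Qed.

Lemma dmean_plus f g u v : torus_continuous f u v -> torus_continuous g u v ->
  dmean (fun w z => f w z + g w z)%C u v = (dmean f u v + dmean g u v)%C.
Proof.
intros Hf Hg; unfold dmean; rewrite <- cmean_plus by (apply torus_mean; auto).
apply cmean_ext; intros z Hz; destruct (circle_point z v Hz) as [t ->].
apply cmean_plus; apply torus_slice_l; auto.
Qed.

Lemma dmean_scal k f u v : torus_continuous f u v ->
  dmean (fun w z => k * f w z)%C u v = (k * dmean f u v)%C.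
Proof.
intros Hf; unfold dmean; rewrite <- cmean_scal by (apply torus_mean; auto).
apply cmean_ext; intros z Hz; destruct (circle_point z v Hz) as [t ->].
apply cmean_scal; apply torus_slice_l; auto.
Qed.

Lemma dmean_bound f u v B : torus_continuous f u v ->
  (forall w z, Cmod w = exp u -> Cmod z = exp v -> Cmod (f w z) <= B) ->
  Cmod (dmean f u v) <= B.
Proof.
intros Hf HB; apply cmean_bound; [now apply torus_mean|].
intros z Hz; apply cmean_bound; auto.
destruct (circle_point z v Hz) as [t ->]; apply torus_slice_l; auto.
Qed.

Lemma dmean_swap f u v : torus_continuous f u v ->
  dmean f u v = dmean (fun z w => f w z) v u.
Proof.
intros Hf; pose proof TwoPI_pos.
pose proof (CInt_Fubini (fun s t => f (cexp u s) (cexp v t)) 0 0 (2 * PI) (2 * PI)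
  ltac:(lra) ltac:(lra) Hf) as F.
unfold iterated_CInt in F; rewrite !Rplus_0_l in F.
assert (E : forall g u v, torus_continuous g u v -> dmean g u v =
  (RtoC (/ (2 * PI)) * (RtoC (/ (2 * PI)) *
    CInt (fun t => CInt (fun s => g (cexp u s) (cexp v t)) 0 (2 * PI)) 0 (2 * PI)))%C).
{ intros g u' v' Hg; unfold dmean, cmean; f_equal; apply CInt_scal.
  apply ex_CInt_continuous; [lra|]; intros t _.
  apply (CInt_param_continuous (fun t s => g (cexp u' s) (cexp v' t))); [lra|].
  apply (torus_continuous_swap _ _ _ Hg). }
rewrite E by auto; rewrite E by (now apply torus_continuous_swap).
now rewrite F.
Qed.

(** Restricting the angle to one bounded period makes the compactness arguments on rectangles
    applicable to circles and tori. *)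
Lemma circle_angle w x : Cmod w = exp x -> exists s, -PI <= s <= - PI + 2 * PI /\ w = cexp x s.
Proof.
intros Hw; pose proof PI_RGT_0; destruct (circle_point w x Hw) as [t ->].
  set (n := up ((- PI - t) / (2 * PI))).
  destruct (archimed ((- PI - t) / (2 * PI))) as [N1 N2]; fold n in N1, N2.
  exists (t + IZR n * (2 * PI)); split.
  - apply (Rmult_lt_compat_r (2 * PI)) in N1; [|lra].
    apply (Rmult_le_compat_r (2 * PI)) in N2; [|lra].
    rewrite Rmult_minus_distr_r in N2.
    replace ((- PI - t) / (2 * PI) * (2 * PI)) with (- PI - t) in * by (field; lra); lra.
  - assert (P : cexp 0 (IZR n * (2 * PI)) = RtoC 1).
    { rewrite <- (Rmult_0_r (IZR n)) at 1; rewrite <- Czpow_cexp.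
      rewrite <- (Rplus_0_l (2 * PI)), cexp_2PI, cexp_0; unfold Czpow.
      replace (/ RtoC 1)%C with (RtoC 1) by (field; intros E; apply RtoC_inj in E; lra).
      rewrite !Cpow_1_l; ring. }
    rewrite <- (Rplus_0_r x) at 2; rewrite cexp_plus, P; ring.
Qed.

Lemma torus_bounded f u v : torus_continuous f u v -> exists B, 0 < B /\
  forall w z, Cmod w = exp u -> Cmod z = exp v -> Cmod (f w z) <= B.
Proof.
intros Hf; pose proof PI_RGT_0.
destruct (continuous2_bounded (fun s t => f (cexp u s) (cexp v t)) (- PI) (- PI) (2 * PI) (2 * PI))
  as [B [HB H1]]; [lra|lra|intros; apply Hf|].
exists B; split; auto.
intros w z Hw Hz; destruct (circle_angle _ _ Hw) as [s [Hs ->]]; destruct (circle_angle _ _ Hz) as [t [Ht ->]]; auto.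
Qed.

(** * The annulus in logarithmic coordinates *)

Definition hexagon (K u v : R) : Prop := Rabs u < K /\ Rabs v < K /\ Rabs (u + v) < K.

Lemma exp_interval K u : exp (- K) < exp u < exp K <-> Rabs u < K.
Proof.
split.
- intros [H1 H2]; apply exp_lt_inv in H1; apply exp_lt_inv in H2; apply Rabs_def1; lra.
- intros H; apply Rabs_def2 in H; split; apply exp_increasing; lra.
Qed.

Lemma annulus_hexagon K u v w z : Cmod w = exp u -> Cmod z = exp v ->
  cyclic_annulus K (w, z) <-> hexagon K u v.
Proof.
intros Hw Hz; unfold cyclic_annulus, hexagon; cbn [fst snd].
rewrite Cmod_mult, Hw, Hz, <- exp_plus, !exp_interval; tauto.
Qed.

Lemma annulus_log K w z : cyclic_annulus K (w, z) ->
  exists u v, Cmod w = exp u /\ Cmod z = exp v /\ hexagon K u v.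
Proof.
intros H; exists (ln (Cmod w)), (ln (Cmod z)).
assert (Hw : Cmod w = exp (ln (Cmod w))).
{ symmetry; apply exp_ln; destruct H as [[H _] _]; simpl in H; pose proof (exp_pos (- K)); lra. }
assert (Hz : Cmod z = exp (ln (Cmod z))).
{ symmetry; apply exp_ln; destruct H as [_ [[H _] _]]; simpl in H; pose proof (exp_pos (- K)); lra. }
split; [|split]; auto; now apply (annulus_hexagon K _ _ w z).
Qed.

Notation C2 := (prod_NormedModule C_AbsRing C_NormedModule C_NormedModule).

(** The map j runs along a complex line with direction d. The difference quotient of F along it,
    completed by the value l d at w, is the function that [Cdiff] asks for. *)
Lemma Cdiff_slice (F : C * C -> C) (j : C -> C * C) (w : C) (d : C2) :
  @ex_filterdiff C_AbsRing C2 C_NormedModule F (locally (j w)) ->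
  continuous (T := C_UniformSpace) (U := C2) j w ->
  (forall w' : C, @minus C2 (j w') (j w) = @scal C_AbsRing C2 (w' - w)%C d) ->
  Cdiff (fun w' => F (j w')) w.
Proof.
intros [l [Hl Hdom]] Hj Hd.
specialize (Hdom (j w) (fun P H => H)).
exists (fun w' => if excluded_middle_informative (w' = w) then l d
  else ((F (j w') - F (j w)) / (w' - w))%C); split.
- apply (proj2 (continuous_Cmod _ _)); intros eps He.
  pose proof (norm_ge_0 d) as Hn.
  (* The direction may have any norm, even 0: dividing by norm d + 1 is always possible, and the 2
     makes the final inequality strict. *)
  assert (He' : 0 < eps / (2 * (norm d + 1))) by (apply Rdiv_lt_0_compat; lra).
  pose proof (Hj _ (Hdom (mkposreal _ He'))) as Hloc.
  unfold filtermap in Hloc; revert Hloc; apply filter_imp; intros w' H; cbn [pos] in H.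
  destruct (excluded_middle_informative (w = w)) as [_|?]; [|congruence].
  destruct excluded_middle_informative as [->|Hne].
  + replace (l d - l d)%C with (RtoC 0) by ring; rewrite Cmod_0; lra.
  + assert (Hne' : (w' - w)%C <> RtoC 0) by (intros E; apply Hne, Cminus_eq_0, E).
    pose proof (proj1 (Cmod_gt_0 _) Hne') as Hp.
    rewrite Hd, (linear_scal _ Hl) in H.
    change (Cmod (F (j w') - F (j w) - (w' - w) * l d)%C
      <= eps / (2 * (norm d + 1)) * norm (@scal C_AbsRing C2 (w' - w)%C d)) in H.
    pose proof (norm_scal (K := C_AbsRing) (V := C2) (w' - w)%C d) as Hs.
    change (abs (w' - w)%C) with (Cmod (w' - w)%C) in Hs.
    replace ((F (j w') - F (j w)) / (w' - w) - l d)%C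
      with ((F (j w') - F (j w) - (w' - w) * l d) * / (w' - w))%C by (field; auto).
    rewrite Cmod_mult, Cmod_inv by auto.
    apply Rmult_lt_reg_r with (Cmod (w' - w)%C); auto.
    rewrite Rmult_assoc, Rinv_l, Rmult_1_r by lra.
    apply Rle_lt_trans with (eps / (2 * (norm d + 1)) * (Cmod (w' - w)%C * norm d)).
    { eapply Rle_trans; [exact H|]; apply Rmult_le_compat_l; [lra|exact Hs]. }
    apply Rmult_lt_reg_r with (2 * (norm d + 1)); [lra|].
    replace (eps / (2 * (norm d + 1)) * (Cmod (w' - w)%C * norm d) * (2 * (norm d + 1)))
      with (eps * Cmod (w' - w)%C * norm d) by (field; lra).
    assert (0 < eps * Cmod (w' - w)%C) by now apply Rmult_lt_0_compat.
    nra.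
- intros w'; destruct excluded_middle_informative as [->|Hne]; [ring|].
  assert (Hne' : (w' - w)%C <> RtoC 0) by (intros E; apply Hne, Cminus_eq_0, E).
  field; auto.
Qed.

(** What is used of holomorphy from here on: continuity on tori, for Fubini, and differentiability
    in each variable, for Cauchy's theorem. *)
Definition separately_holomorphic (K : R) (M : C -> C -> C) : Prop :=
  (forall u v, hexagon K u v -> torus_continuous M u v) /\
  (forall u v w z, hexagon K u v -> Cmod w = exp u -> Cmod z = exp v ->
     Cdiff (fun w => M w z) w /\ Cdiff (fun z => M w z) z).

Lemma holomorphic_separately K M :
  holomorphic_on (cyclic_annulus K) M -> separately_holomorphic K M.
Proof.
intros HM; split.
- intros u v Huv s t.
  assert (Hin : cyclic_annulus K (cexp u s, cexp v t))
    by (apply (annulus_hexagon K u v); auto using Cmod_cexp).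
  pose proof (filterdiff_continuous (K := C_AbsRing) (U := C2) (V := C_NormedModule) _ _
    (HM _ Hin)) as Hc.
  apply (continuous_comp_2 (U := prod_UniformSpace R_UniformSpace R_UniformSpace)
    (V := C_UniformSpace) (W := C_UniformSpace) (X := C_UniformSpace)
    (fun p => cexp u (fst p)) (fun p => cexp v (snd p)) M).
  + apply (continuous_comp (U := prod_UniformSpace R_UniformSpace R_UniformSpace)
      (V := R_UniformSpace) (W := C_UniformSpace) fst (cexp u));
      [apply continuous_fst|apply (continuous2_r cexp), continuous_cexp].
  + apply (continuous_comp (U := prod_UniformSpace R_UniformSpace R_UniformSpace)
      (V := R_UniformSpace) (W := C_UniformSpace) snd (cexp v));
      [apply continuous_snd|apply (continuous2_r cexp), continuous_cexp].
  + exact Hc.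
- intros u v w z Huv Hw Hz.
  assert (Hin : cyclic_annulus K (w, z)) by (apply (annulus_hexagon K u v); auto).
  pose proof (HM _ Hin) as Hd; split.
  + apply (Cdiff_slice (fun q => M (fst q) (snd q)) (fun w => (w, z)) w (RtoC 1, RtoC 0)); [exact Hd| |].
    * intros P [e He]; exists e; intros y Hy; apply He; split; [exact Hy|apply ball_center].
    * intros w'; change (((w' + - w)%C, (z + - z)%C) = (((w' - w) * RtoC 1)%C, ((w' - w) * RtoC 0)%C)).
      apply f_equal2; ring.
  + apply (Cdiff_slice (fun q => M (fst q) (snd q)) (fun z => (w, z)) z (RtoC 0, RtoC 1)); [exact Hd| |].
    * intros P [e He]; exists e; intros y Hy; apply He; split; [apply ball_center|exact Hy].
    * intros w'; change (((w + - w)%C, (w' + - z)%C) = (((w' - z) * RtoC 0)%C, ((w' - z) * RtoC 1)%C)).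
      apply f_equal2; ring.
Qed.

(** * Cauchy estimates for the Laurent coefficients *)

Definition Laurent_coef (M : C -> C -> C) (a b : Z) : C :=
  dmean (fun w z => M w z * Czpow w (- a) * Czpow z (- b))%C 0 0.

Lemma torus_monomial M a b u v : torus_continuous M u v ->
  torus_continuous (fun w z => M w z * Czpow w a * Czpow z b)%C u v.
Proof.
intros H; apply torus_continuous_mult; [apply torus_continuous_mult; auto|].
- apply (torus_continuous_l (fun w => Czpow w a)), circle_continuous_Czpow.
- apply (torus_continuous_r (fun w => Czpow w b)), circle_continuous_Czpow.
Qed.

Lemma Cmod_log w a b : exp a <= Cmod w <= exp b -> exists x, a <= x <= b /\ Cmod w = exp x.
Proof.
intros [H1 H2]; pose proof (exp_pos a); exists (ln (Cmod w)).
assert (E : exp (ln (Cmod w)) = Cmod w) by (apply exp_ln; lra).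
rewrite <- E in H1, H2; split; [split|auto]; apply Rnot_lt_le; intros Hlt;
  apply exp_increasing in Hlt; lra.
Qed.

(** The two conditions on x say that it lies between 0 and u, whatever the sign of u. *)
Lemma cmean_Cauchy_0 f u :
  (forall x w, Rabs x <= Rabs u -> 0 <= x * u -> Cmod w = exp x -> Cdiff f w) ->
  cmean f u = cmean f 0.
Proof.
intros H.
destruct (Rle_dec 0 u) as [Hu|Hu].
- symmetry; apply cmean_Cauchy; auto; intros w Hw.
  destruct (Cmod_log _ _ _ Hw) as [x [Hx E]]; apply (H x); auto; [|nra].
  rewrite !Rabs_pos_eq; lra.
- apply cmean_Cauchy; [lra|]; intros w Hw.
  destruct (Cmod_log _ _ _ Hw) as [x [Hx E]]; apply (H x); auto; [|nra].
  rewrite !Rabs_left1; lra.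
Qed.

Lemma exp_neq_0 (w : C) u : Cmod w = exp u -> w <> RtoC 0.
Proof. intros H; apply Cmod_gt_0; rewrite H; apply exp_pos. Qed.

(* Any point of the hexagon is reached from the origin by two moves along the axes
   inside the hexagon. *)
Lemma Laurent_coef_radius K M a b u v : separately_holomorphic K M -> hexagon K u v ->
  dmean (fun w z => M w z * Czpow w (- a) * Czpow z (- b))%C u v = Laurent_coef M a b.
Proof.
intros [Hc Hd] Huv.
assert (Hx : forall x, Rabs x <= Rabs u -> hexagon K x 0).
{ intros x Hx; destruct Huv as (H1 & H2 & H3); unfold hexagon; rewrite Rplus_0_r, Rabs_R0.
  pose proof (Rabs_pos v); lra. }
(* The sign condition places u + y between u and u + v, both of absolute value below K. *)
assert (Hy : forall y, Rabs y <= Rabs v -> 0 <= y * v -> hexagon K u y).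
{ intros y H1 H2; destruct Huv as (H3 & H4 & H5); unfold hexagon; split; [|split]; try lra.
  revert H1 H2 H3 H4 H5; unfold Rabs; repeat destruct Rcase_abs; intros; nra. }
transitivity (dmean (fun w z => M w z * Czpow w (- a) * Czpow z (- b))%C u 0).
- rewrite (dmean_swap _ u v (torus_monomial M (- a) (- b) u v (Hc u v Huv))).
  rewrite (dmean_swap _ u 0 (torus_monomial M (- a) (- b) u 0 (Hc u 0 (Hx u (Rle_refl _))))).
  apply cmean_ext; intros w Hw; apply cmean_Cauchy_0; intros y z H1 H2 Hz.
  apply Cdiff_mult; [apply Cdiff_mult|].
  + apply (Hd u y); auto.
  + apply Cdiff_const.
  + apply Cdiff_Czpow, (exp_neq_0 _ y), Hz.
- apply cmean_ext; intros z Hz; apply cmean_Cauchy_0; intros x w H1 H2 Hw.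
  apply Cdiff_mult; [apply Cdiff_mult|].
  + apply (Hd x 0); auto.
  + apply Cdiff_Czpow, (exp_neq_0 _ x), Hw.
  + apply Cdiff_const.
Qed.

Lemma Laurent_coef_bound K M u v : separately_holomorphic K M -> hexagon K u v ->
  exists B, 0 < B /\ forall a b,
    Cmod (Laurent_coef M a b) <= B * exp (- (IZR a * u + IZR b * v)).
Proof.
intros HM Huv; destruct (torus_bounded M u v) as [B [HB H]]; [now apply HM|].
exists B; split; auto; intros a b.
rewrite <- (Laurent_coef_radius K M a b u v) by auto.
apply dmean_bound; [apply torus_monomial, HM; auto|].
intros w z Hw Hz; rewrite !Cmod_mult, (Cmod_Czpow w u), (Cmod_Czpow z v), Rmult_assoc, <- exp_plus by auto.
replace (IZR (- a) * u + IZR (- b) * v) with (- (IZR a * u + IZR b * v)) by (rewrite !opp_IZR; ring).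
apply Rmult_le_compat_r; [apply Rlt_le, exp_pos|auto].
Qed.

(** The maximum of a u + b v over |u|, |v|, |u + v| <= 1, that is, the norm dual to the hexagon. *)
Definition zdeg (a b : Z) : Z := Z.max (Z.max (Z.abs a) (Z.abs b)) (Z.abs (a - b)).

(* The six vertices of the smaller hexagon give the six linear forms whose maximum is
   [zdeg]. *)
Lemma Laurent_coef_decay K K' M : separately_holomorphic K M -> 0 < K' < K ->
  exists B, 0 < B /\ forall a b,
    Cmod (Laurent_coef M a b) <= B * exp (- (K' * IZR (zdeg a b))).
Proof.
intros HM HK.
assert (Hv : forall u v, (u = 0 \/ u = K' \/ u = - K') -> (v = 0 \/ v = K' \/ v = - K') ->
  (u + v = 0 \/ u + v = K' \/ u + v = - K') -> exists B, 0 < B /\ forall a b,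
    Cmod (Laurent_coef M a b) <= B * exp (- (IZR a * u + IZR b * v))).
{ intros u v Hu Hv Huv; apply (Laurent_coef_bound K); auto.
  split; [|split]; apply Rabs_def1; lra. }
destruct (Hv K' 0) as [B1 [P1 H1]]; [lra|lra|lra|].
destruct (Hv (- K') 0) as [B2 [P2 H2]]; [lra|lra|lra|].
destruct (Hv 0 K') as [B3 [P3 H3]]; [lra|lra|lra|].
destruct (Hv 0 (- K')) as [B4 [P4 H4]]; [lra|lra|lra|].
destruct (Hv K' (- K')) as [B5 [P5 H5]]; [lra|lra|lra|].
destruct (Hv (- K') K') as [B6 [P6 H6]]; [lra|lra|lra|].
exists (B1 + B2 + B3 + B4 + B5 + B6); split; [lra|]; intros a b.
assert (Fin : forall B x, 0 < B -> B <= B1 + B2 + B3 + B4 + B5 + B6 -> x = K' * IZR (zdeg a b) ->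
  Cmod (Laurent_coef M a b) <= B * exp (- x) ->
  Cmod (Laurent_coef M a b) <= (B1 + B2 + B3 + B4 + B5 + B6) * exp (- (K' * IZR (zdeg a b)))).
{ intros B x HB HB' -> H; eapply Rle_trans; [exact H|].
  apply Rmult_le_compat_r; [apply Rlt_le, exp_pos|auto]. }
assert (D : (zdeg a b = a \/ zdeg a b = - a \/ zdeg a b = b \/ zdeg a b = - b
  \/ zdeg a b = a - b \/ zdeg a b = b - a)%Z) by (unfold zdeg; lia).
destruct D as [D|[D|[D|[D|[D|D]]]]].
- apply (Fin B1 _ P1 ltac:(lra)) with (2 := H1 a b); rewrite D; ring.
- apply (Fin B2 _ P2 ltac:(lra)) with (2 := H2 a b); rewrite D, opp_IZR; ring.
- apply (Fin B3 _ P3 ltac:(lra)) with (2 := H3 a b); rewrite D; ring.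
- apply (Fin B4 _ P4 ltac:(lra)) with (2 := H4 a b); rewrite D, opp_IZR; ring.
- apply (Fin B5 _ P5 ltac:(lra)) with (2 := H5 a b); rewrite D, minus_IZR; ring.
- apply (Fin B6 _ P6 ltac:(lra)) with (2 := H6 a b); rewrite D, minus_IZR; ring.
Qed.

(** Half of the rate d pays for one factor INR N + 1, through 1 + x <= exp x, and the other half for
    the remaining power. *)
Lemma pow_le_exp k d : 0 < d -> exists B, 0 < B /\
  forall N : nat, (INR N + 1) ^ k <= B * exp (d * INR N).
Proof.
revert d; induction k as [|k IH]; intros d Hd.
- exists 1; split; [lra|]; intros N; simpl; rewrite Rmult_1_l, <- exp_0.
  apply exp_le_exp; pose proof (pos_INR N); nra.
- destruct (IH (d / 2)) as [B [HB H]]; [lra|].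
  assert (Hp : 0 < 2 / d) by (apply Rdiv_lt_0_compat; lra).
  exists ((1 + 2 / d) * B); split; [apply Rmult_lt_0_compat; lra|]; intros N.
  pose proof (pos_INR N) as HN.
  replace (exp (d * INR N)) with (exp (d / 2 * INR N) * exp (d / 2 * INR N))
    by (rewrite <- exp_plus; f_equal; field).
  replace ((1 + 2 / d) * B * (exp (d / 2 * INR N) * exp (d / 2 * INR N)))
    with (((1 + 2 / d) * exp (d / 2 * INR N)) * (B * exp (d / 2 * INR N))) by ring.
  simpl; apply Rmult_le_compat; [lra|apply pow_le; lra| |auto].
  pose proof (exp_ineq1_le (d / 2 * INR N)) as E.
  apply Rle_trans with ((1 + 2 / d) * (1 + d / 2 * INR N)); [|apply Rmult_le_compat_l; lra].
  replace ((1 + 2 / d) * (1 + d / 2 * INR N)) with (1 + 2 / d + d / 2 * INR N + INR N) by (field; lra).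
  assert (0 <= d / 2 * INR N) by nra; lra.
Qed.

Lemma poly_exp_small B k d eps : 0 < d -> 0 < eps -> exists N0 : nat, forall N, (N0 <= N)%nat ->
  B * (INR N + 1) ^ k * exp (- (d * INR N)) <= eps.
Proof.
intros Hd He.
(* One power more than required, so that the quantity is O(1 / (N + 1)). *)
destruct (pow_le_exp (S k) d Hd) as [A [HA H]].
destruct (archimed (Rabs B * A / eps)) as [HN _].
set (N0 := Z.to_nat (up (Rabs B * A / eps))) in *.
exists N0; intros N HN0; pose proof (pos_INR N) as HNp.
assert (HN' : Rabs B * A / eps <= INR N).
{ apply Rle_trans with (INR N0); [|now apply le_INR].
  destruct (Z_le_gt_dec 0 (up (Rabs B * A / eps))) as [Hz|Hz].
  - unfold N0; rewrite INR_IZR_INZ, Z2Nat.id by auto; lra.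
  - pose proof (pos_INR N0); apply Z.gt_lt, IZR_lt in Hz; lra. }
assert (HB : Rabs B * A <= eps * INR N).
{ apply (Rmult_le_compat_l eps) in HN'; [|lra].
  replace (eps * (Rabs B * A / eps)) with (Rabs B * A) in HN' by (field; lra); auto. }
assert (HE : (INR N + 1) * ((INR N + 1) ^ k * exp (- (d * INR N))) <= A).
{ specialize (H N); simpl in H.
  apply (Rmult_le_compat_r (exp (- (d * INR N)))) in H; [|apply Rlt_le, exp_pos].
  rewrite (Rmult_assoc A), <- exp_plus, Rplus_opp_r, exp_0 in H; lra. }
assert (HP : 0 <= (INR N + 1) ^ k * exp (- (d * INR N)))
  by (apply Rmult_le_pos; [apply pow_le; lra|apply Rlt_le, exp_pos]).
set (P := (INR N + 1) ^ k * exp (- (d * INR N))) in *.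
rewrite Rmult_assoc; fold P.
pose proof (Rle_abs B) as HB'; pose proof (Rabs_pos B) as HB0.
apply Rle_trans with (Rabs B * P); [apply Rmult_le_compat_r; auto|].
apply Rmult_le_reg_l with (INR N + 1); [lra|].
replace ((INR N + 1) * (Rabs B * P)) with (Rabs B * ((INR N + 1) * P)) by ring.
apply Rle_trans with (Rabs B * A); [apply Rmult_le_compat_l; auto|lra].
Qed.

Definition Laurent_sum (c : Z -> Z -> C) (N : nat) (w z : C) : C :=
  Zsum (fun a => Zsum (fun b => c a b * (Czpow w a * Czpow z b))%C N) N.

(** The one-variable expansion is used in w with z fixed, then in z for each coefficient [m a]. The
    second remainder is uniform on the circle of w', and its weight exp (- a u) cancels against
    |w^a|; so 2N + 1 inner errors of size [Rem N] are added, which the exponential decay absorbs. *)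
Lemma Laurent_expansion K M w z : separately_holomorphic K M -> cyclic_annulus K (w, z) ->
  forall eps, 0 < eps -> exists N0 : nat, forall N, (N0 <= N)%nat ->
    Cmod (M w z - Laurent_sum (Laurent_coef M) N w z)%C <= eps.
Proof.
intros HM Hwz eps Heps.
destruct (annulus_log K w z Hwz) as (u & v & Hw & Hz & Huv).
(* Half the distance of the largest of the three absolute values to K: moving u or v by at most e
   stays strictly inside the hexagon. *)
set (e := (K - Rmax (Rmax (Rabs u) (Rabs v)) (Rabs (u + v))) / 2).
assert (He : 0 < e /\ Rabs u + e < K /\ Rabs v + e < K /\ Rabs (u + v) + e < K).
{ destruct Huv as (H1 & H2 & H3).
  assert (Rmax (Rmax (Rabs u) (Rabs v)) (Rabs (u + v)) < K) by (repeat apply Rmax_lub_lt; auto).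
  pose proof (Rmax_l (Rmax (Rabs u) (Rabs v)) (Rabs (u + v))).
  pose proof (Rmax_r (Rmax (Rabs u) (Rabs v)) (Rabs (u + v))).
  pose proof (Rmax_l (Rabs u) (Rabs v)); pose proof (Rmax_r (Rabs u) (Rabs v)).
  unfold e; lra. }
destruct He as (He & Heu & Hev & Heuv).
assert (near : forall x y, Rabs (x - u) + Rabs (y - v) <= e -> hexagon K x y).
{ intros x y Hxy; unfold hexagon.
  pose proof (Rabs_triang (x - u) u) as T1; replace (x - u + u) with x in T1 by ring.
  pose proof (Rabs_triang (y - v) v) as T2; replace (y - v + v) with y in T2 by ring.
  pose proof (Rabs_triang ((x - u) + (y - v)) (u + v)) as T3.
  pose proof (Rabs_triang (x - u) (y - v)) as T4.
  replace (x - u + (y - v) + (u + v)) with (x + y) in T3 by ring.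
  pose proof (Rabs_pos (x - u)); pose proof (Rabs_pos (y - v)); lra. }
assert (nearu : forall x, u - e <= x <= u + e -> hexagon K x v).
{ intros x Hx; apply near; rewrite Rminus_diag, Rabs_R0; pose proof (Rabs_le (x - u) e); lra. }
assert (nearv : forall y, v - e <= y <= v + e -> hexagon K u y).
{ intros y Hy; apply near; rewrite Rminus_diag, Rabs_R0; pose proof (Rabs_le (y - v) e); lra. }
destruct HM as [Hc Hd].
assert (HMM : separately_holomorphic K M) by (split; auto).
destruct (torus_bounded M u v) as [B0 [P0 H0]]; [apply Hc, nearu; lra|].
destruct (torus_bounded M (u - e) v) as [B1 [P1 H1]]; [apply Hc, nearu; lra|].
destruct (torus_bounded M (u + e) v) as [B2 [P2 H2]]; [apply Hc, nearu; lra|].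
destruct (torus_bounded M u (v - e)) as [B3 [P3 H3]]; [apply Hc, nearv; lra|].
destruct (torus_bounded M u (v + e)) as [B4 [P4 H4]]; [apply Hc, nearv; lra|].
set (B := B0 + B1 + B2 + B3 + B4).
set (Rem := fun N => 4 * B / (exp e - 1) * exp (- (INR N * e))).
set (m := fun a => cmean (fun w' => M w' z * Czpow w' (- a))%C u).
set (n := fun b w' => cmean (fun z' => M w' z' * Czpow z' (- b))%C v).
assert (Hm : forall N, Cmod (M w z - Zsum (fun a => m a * Czpow w a)%C N)%C <= Rem N).
{ intros N; apply (Laurent_remainder (fun w => M w z)); auto.
  - intros x Hx; destruct (Cmod_log _ _ _ Hx) as [y [Hy E]]; apply (Hd y v); auto.
  - intros x [E|[E|E]].
    + specialize (H1 x z E Hz); unfold B; lra.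
    + specialize (H0 x z E Hz); unfold B; lra.
    + specialize (H2 x z E Hz); unfold B; lra. }
assert (Hn : forall N w', Cmod w' = exp u ->
  Cmod (M w' z - Zsum (fun b => n b w' * Czpow z b)%C N)%C <= Rem N).
{ intros N w' Hw'; apply (Laurent_remainder (fun z => M w' z)); auto.
  - intros x Hx; destruct (Cmod_log _ _ _ Hx) as [y [Hy E]]; apply (Hd u y); auto.
  - intros x [E|[E|E]].
    + specialize (H3 w' x Hw' E); unfold B; lra.
    + specialize (H0 w' x Hw' E); unfold B; lra.
    + specialize (H4 w' x Hw' E); unfold B; lra. }
assert (Hcn : forall b, circle_continuous (n b) u).
{ intros b; apply (torus_mean (fun z' w' => M w' z' * Czpow z' (- b))%C).
  apply torus_continuous_mult.
  - apply torus_continuous_swap, Hc; auto.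
  - apply (torus_continuous_l (fun z' => Czpow z' (- b))), circle_continuous_Czpow. }
assert (Hcoef : forall a b, Laurent_coef M a b = cmean (fun w' => n b w' * Czpow w' (- a))%C u).
{ intros a b; rewrite <- (Laurent_coef_radius K M a b u v) by auto.
  rewrite (dmean_swap _ u v (torus_monomial M (- a) (- b) u v (Hc u v Huv))).
  apply cmean_ext; intros w' Hw'; destruct (circle_point w' u Hw') as [s ->].
  rewrite Cmult_comm; unfold n; rewrite <- cmean_scal.
  - apply cmean_ext; intros; ring.
  - apply circle_continuous_mult; [|apply circle_continuous_Czpow].
    apply (torus_slice_l (fun z' w' => M w' z')), torus_continuous_swap, Hc; auto. }
assert (HcM : circle_continuous (fun w' => M w' z) u).
{ destruct (circle_point z v Hz) as [t ->]; apply torus_slice_l, Hc; auto. }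
assert (Hmc : forall a N, Cmod (m a - Zsum (fun b => Laurent_coef M a b * Czpow z b)%C N)%C
  <= Rem N * exp (- (IZR a * u))).
{ intros a N.
  assert (Hcs : circle_continuous (fun w' => Zsum (fun b => n b w' * Czpow z b)%C N) u).
  { apply (circle_continuous_Zsum (fun b w' => n b w' * Czpow z b)%C); intros b.
    apply circle_continuous_mult; [apply Hcn|apply circle_continuous_const]. }
  replace (m a - Zsum (fun b => Laurent_coef M a b * Czpow z b)%C N)%C with
    (cmean (fun w' => (M w' z - Zsum (fun b => n b w' * Czpow z b)%C N) * Czpow w' (- a))%C u).
  - apply cmean_bound.
    + apply circle_continuous_mult; [|apply circle_continuous_Czpow].
      apply circle_continuous_minus; auto.
    + intros w' Hw'; rewrite Cmod_mult, (Cmod_Czpow w' u), opp_IZR, Ropp_mult_distr_l by auto.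
      apply Rmult_le_compat_r; [apply Rlt_le, exp_pos|now apply Hn].
  - rewrite (Zsum_ext _ (fun b => cmean (fun w' => Czpow z b * (n b w' * Czpow w' (- a)))%C u) N).
    + rewrite <- cmean_Zsum.
      * unfold m; rewrite <- cmean_minus.
        -- apply cmean_ext; intros w' _.
           replace ((M w' z - Zsum (fun b => n b w' * Czpow z b)%C N) * Czpow w' (- a))%C
             with (M w' z * Czpow w' (- a) - Czpow w' (- a) * Zsum (fun b => n b w' * Czpow z b)%C N)%C by ring.
           rewrite <- Zsum_scal; apply f_equal, Zsum_ext; intros; ring.
        -- apply circle_continuous_mult; [auto|apply circle_continuous_Czpow].
        -- apply (circle_continuous_Zsum (fun b w' => Czpow z b * (n b w' * Czpow w' (- a)))%C); intros b.
           apply circle_continuous_mult; [apply circle_continuous_const|].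
           apply circle_continuous_mult; [apply Hcn|apply circle_continuous_Czpow].
      * intros b; apply circle_continuous_mult; [apply circle_continuous_const|].
        apply circle_continuous_mult; [apply Hcn|apply circle_continuous_Czpow].
    + intros b _; rewrite cmean_scal, Hcoef; [ring|].
      apply circle_continuous_mult; [apply Hcn|apply circle_continuous_Czpow]. }
(* The factor 2 and the power 1 come from Rem N + (2N + 1) Rem N = 2 (N + 1) Rem N. *)
destruct (poly_exp_small (2 * (4 * B / (exp e - 1))) 1 e eps He Heps) as [N0 HN0].
exists N0; intros N HN; specialize (HN0 N HN).
replace (M w z - Laurent_sum (Laurent_coef M) N w z)%C with
  ((M w z - Zsum (fun a => m a * Czpow w a)%C N) +
   Zsum (fun a => (m a - Zsum (fun b => Laurent_coef M a b * Czpow z b)%C N) * Czpow w a)%C N)%C.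
- eapply Rle_trans; [apply Cmod_triangle|].
  apply Rle_trans with (Rem N + (2 * INR N + 1) * Rem N).
  + apply Rplus_le_compat; [apply Hm|apply Zsum_bound; intros a _].
    rewrite Cmod_mult, (Cmod_Czpow w u) by auto.
    replace (Rem N) with (Rem N * exp (- (IZR a * u)) * exp (IZR a * u)).
    * apply Rmult_le_compat_r; [apply Rlt_le, exp_pos|apply Hmc].
    * rewrite Rmult_assoc, <- exp_plus, Rplus_opp_l, exp_0; ring.
  + unfold Rem; rewrite (Rmult_comm (INR N) e).
    simpl in HN0; lra.
- rewrite (Zsum_ext (fun a => (m a - _) * _)%C
    (fun a => m a * Czpow w a - Zsum (fun b => Laurent_coef M a b * (Czpow w a * Czpow z b))%C N)%C).
  + rewrite Zsum_minus; unfold Laurent_sum; ring.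
  + intros a _; rewrite (Zsum_ext (fun b => Laurent_coef M a b * (Czpow w a * Czpow z b))%C
      (fun b => Czpow w a * (Laurent_coef M a b * Czpow z b))%C) by (intros; ring).
    rewrite Zsum_scal; ring.
Qed.

(** * The cyclic Leibniz rule for Laurent coefficients *)

Lemma CInt_periodic (h : R -> C) c : (forall t, Rcontinuous h t) ->
  (forall t, h (t + 2 * PI) = h t) -> CInt h c (c + 2 * PI) = CInt h 0 (2 * PI).
Proof.
intros Hc Hp.
assert (ex : forall a b, ex_CInt h a b).
{ intros; apply (ex_RInt_continuous (V := C_R_CompleteNormedModule)); intros; apply Hc. }
assert (S : CInt h 0 c = CInt h (2 * PI) (c + 2 * PI)).
{ pose proof (RInt_comp_lin (V := C_R_CompleteNormedModule) h 1 (2 * PI) 0 c) as H.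
  rewrite Rmult_0_r, Rplus_0_l, Rmult_1_l in H; unfold CInt; rewrite <- H by apply ex.
  apply (RInt_ext (V := C_R_CompleteNormedModule)); intros t _.
  rewrite Rmult_1_l, Hp; symmetry; apply (scal_one (K := R_AbsRing)). }
assert (Z : (CInt h c 0 + CInt h 0 c)%C = RtoC 0).
{ rewrite CInt_Chasles by apply ex; apply is_CInt_unique.
  exact (is_RInt_point (V := C_R_NormedModule) h c). }
rewrite <- (CInt_Chasles h c 0 (c + 2 * PI)), <- (CInt_Chasles h 0 (2 * PI) (c + 2 * PI)), <- S
  by apply ex.
transitivity (CInt h 0 (2 * PI) + (CInt h c 0 + CInt h 0 c))%C; [ring|rewrite Z; ring].
Qed.

Lemma inv_cexp_0 s t : (/ (cexp 0 s * cexp 0 t))%C = cexp 0 (- s - t).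
Proof.
assert (E : (cexp 0 (- s - t) * (cexp 0 s * cexp 0 t))%C = RtoC 1).
{ rewrite <- !cexp_plus, <- cexp_0; f_equal; ring. }
pose proof (cexp_neq_0 0 s); pose proof (cexp_neq_0 0 t).
rewrite <- (Cmult_1_l (/ _)), <- E; field; auto.
Qed.

(** On the unit circle w -> 1 / (w z) is the reflection t -> - t - p of the angle, which preserves
    means of periodic functions. *)
Lemma cmean_reflect f z : circle_continuous f 0 -> Cmod z = exp 0 ->
  cmean (fun w => f (/ (w * z))%C) 0 = cmean f 0.
Proof.
intros Hf Hz; destruct (circle_point z 0 Hz) as [p ->]; unfold cmean; f_equal.
pose proof TwoPI_pos; set (h := fun t => f (cexp 0 t)).
rewrite (CInt_ext _ (fun t => h (- t - p))); [|lra|intros; unfold h; now rewrite inv_cexp_0].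
assert (ex : forall a b, ex_CInt h a b).
{ intros; apply (ex_RInt_continuous (V := C_R_CompleteNormedModule)); intros; apply Hf. }
transitivity (CInt h (- (2 * PI) - p) (- (2 * PI) - p + 2 * PI)).
2: { apply CInt_periodic; [exact Hf|intros; unfold h; now rewrite cexp_2PI]. }
replace (- (2 * PI) - p + 2 * PI) with (- p) by ring.
assert (Hex : is_CInt (fun t => h (- t - p)) 0 (2 * PI) (- CInt h (- p) (- (2 * PI) - p))%C).
{ pose proof (is_RInt_comp_lin (V := C_R_NormedModule) h (- 1) (- p) 0 (2 * PI)
    (CInt h (- p) (- (2 * PI) - p))) as H1.
  replace (-1 * 0 + - p) with (- p) in H1 by ring.
  replace (-1 * (2 * PI) + - p) with (- (2 * PI) - p) in H1 by ring.
  apply (is_RInt_opp (V := C_R_NormedModule)) in H1; [|now apply CInt_correct].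
  revert H1; apply is_RInt_ext; intros t _.
  replace (-1 * t + - p) with (- t - p) by ring.
  destruct (h (- t - p)) as [x y]; unfold opp, scal; simpl.
  unfold prod_opp, prod_scal, opp, scal; simpl; unfold mult; simpl; apply f_equal2; ring. }
rewrite (is_CInt_unique _ _ _ _ Hex).
symmetry; apply is_CInt_unique.
pose proof (is_RInt_swap (V := C_R_NormedModule) h _ _ _
  (CInt_correct h (- p) (- (2 * PI) - p) (ex _ _))) as H1; exact H1.
Qed.

Lemma torus_cycle G : torus_continuous G 0 0 ->
  torus_continuous (fun w z => G z (/ (w * z))%C) 0 0.
Proof.
intros H s t.
apply continuous_ext with (fun p : R * R => G (cexp 0 (snd p)) (cexp 0 (- fst p - snd p))).
{ intros p; now rewrite inv_cexp_0. }
apply (continuous_comp_2 (U := prod_UniformSpace R_UniformSpace R_UniformSpace)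
    (V := R_UniformSpace) (W := R_UniformSpace) (X := C_UniformSpace)
    snd (fun p => - fst p - snd p) (fun s t => G (cexp 0 s) (cexp 0 t))).
- apply continuous_snd.
- apply (continuous_minus (V := R_NormedModule)); [|apply continuous_snd].
  apply (continuous_opp (V := R_NormedModule)), continuous_fst.
- apply H.
Qed.

(** The map (w, z) -> (z, 1 / (w z)), which permutes w, z, 1 / (w z) cyclically, is an exchange of
    variables followed by a reflection in one of them. *)
Lemma dmean_cycle G : torus_continuous G 0 0 ->
  dmean (fun w z => G z (/ (w * z))%C) 0 0 = dmean G 0 0.
Proof.
intros H; rewrite (dmean_swap G 0 0 H); apply cmean_ext; intros z Hz.
apply (cmean_reflect (fun y => G z y)); auto.
destruct (circle_point z 0 Hz) as [t ->].
apply (torus_slice_l (fun y z => G z y)), torus_continuous_swap, H.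
Qed.

Lemma torus_continuous_scal k f u v : torus_continuous f u v ->
  torus_continuous (fun w z => k * f w z)%C u v.
Proof.
intros Hf; exact (torus_continuous_mult (fun _ _ => k) f u v (torus_continuous_const k u v) Hf).
Qed.

Lemma hexagon_0 K : 0 < K -> hexagon K 0 0.
Proof. intros; unfold hexagon; rewrite Rplus_0_r, Rabs_R0; auto. Qed.

Lemma Laurent_coef_sym K M a b : 0 < K -> CLR_solution Delta_s K M ->
  Laurent_coef M a b = Laurent_coef M b a.
Proof.
intros HK HM; pose proof (hexagon_0 K HK) as hex0.
pose proof (holomorphic_separately K M (proj1 (proj1 HM))) as Hsep.
unfold Laurent_coef; rewrite dmean_swap by (apply torus_monomial, Hsep, hex0).
apply dmean_ext; intros z w Hz Hw; destruct HM as [[_ Hs] _].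
rewrite Hs by (apply (annulus_hexagon K 0 0); auto); ring.
Qed.

(** After multiplication by w^-p z^-q, the three terms of the rule are one function [G] evaluated
    along the orbit of the cyclic map, with exponents rotated as (p, q), (q - p, - p), (- q, p - q).
    Means are invariant under that map, and each of the three yields one difference of coefficients,
    since Delta_s (1 / (w z)) is half of 1 / (w z) - w z. *)
Lemma Leibniz_coef K M p q : 0 < K -> CLR_solution Delta_s K M ->
  let c := Laurent_coef M in
  (c (p + 1)%Z (q + 1)%Z - c (p - 1)%Z (q - 1)%Z
   + (c (q - p + 1)%Z (- p + 1)%Z - c (q - p - 1)%Z (- p - 1)%Z)
   + (c (- q + 1)%Z (p - q + 1)%Z - c (- q - 1)%Z (p - q - 1)%Z))%C = RtoC 0.
Proof.
intros HK HM c; pose proof (hexagon_0 K HK) as hex0.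
pose proof (holomorphic_separately K M (proj1 (proj1 HM))) as Hsep.
set (G := fun p q w z =>
  (/ 2 * (M w z * Czpow w (- (p + 1)) * Czpow z (- (q + 1)))
   + - / 2 * (M w z * Czpow w (- (p - 1)) * Czpow z (- (q - 1))))%C).
assert (Hmon : forall a b, torus_continuous (fun w z => M w z * Czpow w a * Czpow z b)%C 0 0)
  by (intros; apply torus_monomial, Hsep, hex0).
assert (HGc : forall p q, torus_continuous (G p q) 0 0).
{ intros p' q'; apply torus_continuous_plus;
  [exact (torus_continuous_scal _ _ 0 0 (Hmon (- (p' + 1))%Z (- (q' + 1))%Z))
  |exact (torus_continuous_scal _ _ 0 0 (Hmon (- (p' - 1))%Z (- (q' - 1))%Z))]. }
assert (HG : forall p q, dmean (G p q) 0 0 =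
  (/ 2 * (c (p + 1)%Z (q + 1)%Z - c (p - 1)%Z (q - 1)%Z))%C).
{ intros p' q'; unfold G; rewrite dmean_plus, !dmean_scal; auto.
  - unfold c, Laurent_coef; ring.
  - exact (torus_continuous_scal _ _ 0 0 (Hmon (- (p' + 1))%Z (- (q' + 1))%Z)).
  - exact (torus_continuous_scal _ _ 0 0 (Hmon (- (p' - 1))%Z (- (q' - 1))%Z)). }
assert (E2 : RtoC 2 <> RtoC 0) by (intros E; apply RtoC_inj in E; lra).
assert (GE : forall p q w z, w <> RtoC 0 -> z <> RtoC 0 ->
  G p q w z = (M w z * Delta_s (/ (w * z)) * (Czpow w (- p) * Czpow z (- q)))%C).
{ intros p' q' w z Hw Hz; unfold G, Delta_s.
  replace (- (p' + 1))%Z with (- p' - 1)%Z by lia; replace (- (q' + 1))%Z with (- q' - 1)%Z by lia.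
  replace (- (p' - 1))%Z with (- p' + 1)%Z by lia; replace (- (q' - 1))%Z with (- q' + 1)%Z by lia.
  rewrite !Czpow_pred, !Czpow_succ by auto; field; auto. }
(* The last argument is w, left unsimplified so that the third term is visibly the cyclic map
   applied twice. *)
assert (S : dmean (fun w z => G p q w z + G (q - p)%Z (- p)%Z z (/ (w * z))%C
   + G (- q)%Z (p - q)%Z (/ (w * z))%C (/ (z * / (w * z)))%C)%C 0 0 = RtoC 0).
{ assert (Z : forall u v, dmean (fun _ _ => RtoC 0) u v = RtoC 0)
    by (intros; unfold dmean; now rewrite !cmean_const).
  rewrite <- (Z 0 0); apply dmean_ext; intros w z Hw Hz.
  pose proof (exp_neq_0 w 0 Hw) as Hw0; pose proof (exp_neq_0 z 0 Hz) as Hz0.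
  assert (Hwz : (w * z)%C <> RtoC 0) by (apply Cmult_neq_0; auto).
  assert (Hi : (/ (w * z))%C <> RtoC 0).
  { intros E; assert (E1 : (w * z * / (w * z))%C = RtoC 1) by (field; auto).
    rewrite E, Cmult_0_r in E1; apply RtoC_inj in E1; lra. }
  replace (/ (z * / (w * z)))%C with w by (field; auto).
  rewrite !GE by auto.
  replace (/ (z * / (w * z)))%C with w by (field; auto).
  replace (/ (/ (w * z) * w))%C with z by (field; auto).
  rewrite !Czpow_inv, !Czpow_mult by auto.
  assert (A : (Czpow z (- (q - p)) * (Czpow w (- - - p) * Czpow z (- - - p)))%C
    = (Czpow w (- p) * Czpow z (- q))%C).
  { replace (- - - p)%Z with (- p)%Z by lia.
    replace (- q)%Z with (- (q - p) + - p)%Z by lia; rewrite (Czpow_add z) by auto; ring. }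
  assert (B : (Czpow w (- - - q) * Czpow z (- - - q) * Czpow w (- (p - q)))%C
    = (Czpow w (- p) * Czpow z (- q))%C).
  { replace (- - - q)%Z with (- q)%Z by lia.
    replace (- p)%Z with (- q + - (p - q))%Z by lia; rewrite (Czpow_add w) by auto; ring. }
  rewrite A, B.
  destruct HM as [_ HL].
  transitivity ((M w z * Delta_s (/ (w * z)) + M z (/ (w * z)) * Delta_s w
    + M (/ (w * z)) w * Delta_s z) * (Czpow w (- p) * Czpow z (- q)))%C; [ring|].
  rewrite HL by (apply (annulus_hexagon K 0 0); auto); ring. }
pose proof (torus_cycle _ (HGc (q - p)%Z (- p)%Z)) as C1.
pose proof (torus_cycle _ (HGc (- q)%Z (p - q)%Z)) as C2.
pose proof (torus_cycle _ C2) as C3.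
rewrite dmean_plus, dmean_plus in S; auto; [|apply torus_continuous_plus; auto].
rewrite (dmean_cycle _ (HGc (q - p)%Z (- p)%Z)) in S.
rewrite (dmean_cycle _ C2), (dmean_cycle _ (HGc (- q)%Z (p - q)%Z)), !HG in S.
transitivity (RtoC 2 * RtoC 0)%C; [rewrite <- S; field; auto|ring].
Qed.

(** * Minimal solutions as sums of monomials *)

Definition half_first (n i : Z) : list (Z * Z) :=
  ((n, n - 1 - i) :: (i, - (n - 1 - i)) :: (- n, - i) :: nil)%Z.

Definition half_second (n i : Z) : list (Z * Z) :=
  ((n - 1, n - i) :: (i, - (n - i)) :: (- (n - 1), - i) :: nil)%Z.

(** Concatenation keeps a monomial that is its own mirror image twice, as [add_swap] does. *)
Definition symmetrize (l : list (Z * Z)) : list (Z * Z) :=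
  l ++ map (fun p => (snd p, fst p)) l.

Definition L_support (n j : Z) : list (Z * Z) :=
  symmetrize (if Z.even (n - 1 - j) then half_first n ((n - 1 - j) / 2)
              else half_second n ((n - j) / 2)).

Definition list_sum (f : Z -> Z -> C) (l : list (Z * Z)) : C :=
  fold_right (fun p s => f (fst p) (snd p) + s)%C (RtoC 0) l.

Lemma L_support_first n i : L_support n (n - 1 - 2 * i) = symmetrize (half_first n i).
Proof.
unfold L_support; replace (n - 1 - (n - 1 - 2 * i))%Z with (i * 2)%Z by lia.
rewrite Z.even_mul, Bool.orb_true_r, Z.div_mul by lia; reflexivity.
Qed.

Lemma L_support_second n i : L_support n (n - 2 * i) = symmetrize (half_second n i).
Proof.
unfold L_support; replace (n - 1 - (n - 2 * i))%Z with (- (1) + 2 * i)%Z by lia.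
rewrite Z.even_add_mul_2; replace (n - (n - 2 * i))%Z with (i * 2)%Z by lia.
rewrite Z.div_mul by lia; reflexivity.
Qed.

Lemma L_index_cases (n j : Z) : (Z.abs j <= n - 1)%Z ->
  (exists i, 0 <= i < n /\ j = n - 1 - 2 * i)%Z \/
  (exists i, 1 <= i < n /\ j = n - 2 * i)%Z.
Proof.
intros H; destruct (Z.Even_or_Odd (n - 1 - j)) as [[i Hi]|[i Hi]].
- left; exists i; lia.
- right; exists (i + 1)%Z; lia.
Qed.

Lemma L_min_monomials (n : nat) (j : Z) (w z : C) : w <> RtoC 0 -> z <> RtoC 0 ->
  (Z.abs j <= Z.of_nat n - 1)%Z ->
  L_min n j w z = list_sum (fun x y => Czpow w x * Czpow z y)%C (L_support (Z.of_nat n) j).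
Proof.
intros Hw Hz Hj.
assert (Hwp : forall k, (w ^ k)%C <> RtoC 0) by (intros; now apply Cpow_nz).
assert (Hzp : forall k, (z ^ k)%C <> RtoC 0) by (intros; now apply Cpow_nz).
destruct (L_index_cases _ _ Hj) as [[i [Hi ->]]|[i [Hi ->]]].
- rewrite L_support_first.
  destruct (Z_of_nat_complete i ltac:(lia)) as [k ->].
  rewrite L_min_first by lia; unfold L_first, add_swap, list_sum, symmetrize, half_first.
  cbn [app map fold_right fst snd].
  replace (Z.of_nat n - 1 - Z.of_nat k)%Z with (Z.of_nat (n - 1 - k)) by lia.
  rewrite !Czpow_neg, !Czpow_nat by auto; field; repeat split; auto.
- rewrite L_support_second.
  destruct (Z_of_nat_complete i ltac:(lia)) as [k ->].
  rewrite L_min_second by lia; unfold L_second, add_swap, list_sum, symmetrize, half_second.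
  cbn [app map fold_right fst snd].
  replace (Z.of_nat n - Z.of_nat k)%Z with (Z.of_nat (n - k)) by lia.
  replace (Z.of_nat n - 1)%Z with (Z.of_nat (n - 1)) by lia.
  rewrite !Czpow_neg, !Czpow_nat by auto; field; repeat split; auto.
Qed.

(** With [L_support_zdeg_ge], this confines the monomials of degree n to the shells zdeg = n - 1 and
    zdeg = n. *)
Lemma L_support_zdeg n j x y : (Z.abs j <= n - 1)%Z -> In (x, y) (L_support n j) ->
  (zdeg x y <= n)%Z.
Proof.
intros Hj Hin; destruct (L_index_cases _ _ Hj) as [[i [Hi ->]]|[i [Hi ->]]];
rewrite ?L_support_first, ?L_support_second in Hin;
unfold symmetrize, half_first, half_second in Hin; cbn in Hin; unfold zdeg;
repeat destruct Hin as [Hin|Hin]; try (injection Hin as <- <-; lia); contradiction.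
Qed.

Definition delta (a b x y : Z) : C :=
  if andb (Z.eqb x a) (Z.eqb y b) then RtoC 1 else RtoC 0.

Lemma delta_1 a b x y : x = a -> y = b -> delta a b x y = RtoC 1.
Proof. intros -> ->; unfold delta; now rewrite !Z.eqb_refl. Qed.

Lemma delta_0 a b x y : (x <> a \/ y <> b) -> delta a b x y = RtoC 0.
Proof.
intros H; unfold delta; destruct (Z.eqb_spec x a), (Z.eqb_spec y b); simpl; auto; lia.
Qed.

Definition L_coef (n j a b : Z) : C := list_sum (delta a b) (L_support n j).

Lemma L_coef_first n i a b : L_coef n (n - 1 - 2 * i) a b =
  (delta a b n (n - 1 - i) + delta a b i (- (n - 1 - i)) + delta a b (- n) (- i)
   + (delta a b (n - 1 - i) n + delta a b (- (n - 1 - i)) i + delta a b (- i) (- n)))%C.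
Proof.
unfold L_coef; rewrite L_support_first; unfold list_sum; cbn; ring.
Qed.

Lemma L_coef_second n i a b : L_coef n (n - 2 * i) a b =
  (delta a b (n - 1) (n - i) + delta a b i (- (n - i)) + delta a b (- (n - 1)) (- i)
   + (delta a b (n - i) (n - 1) + delta a b (- (n - i)) i + delta a b (- i) (- (n - 1))))%C.
Proof.
unfold L_coef; rewrite L_support_second; unfold list_sum; cbn; ring.
Qed.

(** * Triangular sums *)

Definition in_triangle (N n : nat) (j : Z) : Prop :=
  (1 <= n <= N)%nat /\ (Z.abs j <= Z.of_nat n - 1)%Z.

Section Triangle.

Context {G : AbelianMonoid}.

Lemma sum_n_m_0 (f : nat -> G) a b : (forall k, (a <= k <= b)%nat -> f k = zero) ->
  sum_n_m f a b = zero.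
Proof.
intros H; rewrite (sum_n_m_ext_loc f (fun _ => zero)) by auto; apply sum_n_m_const_zero.
Qed.

Lemma sum_n_m_single (f : nat -> G) a b k : (a <= k <= b)%nat ->
  (forall i, (a <= i <= b)%nat -> i <> k -> f i = zero) -> sum_n_m f a b = f k.
Proof.
intros Hk H; rewrite (sum_n_m_Chasles f a k b) by lia.
rewrite (sum_n_m_0 f (S k) b) by (intros; apply H; lia); rewrite plus_zero_r.
destruct k as [|k].
- replace a with O by lia; apply sum_n_n.
- rewrite sum_n_Sm by lia; rewrite sum_n_m_0 by (intros; apply H; lia).
  apply plus_zero_l.
Qed.

Lemma triangle_sum_ext (f g : nat -> Z -> G) N :
  (forall n j, in_triangle N n j -> f n j = g n j) -> triangle_sum f N = triangle_sum g N.
Proof.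
intros H; apply sum_n_m_ext_loc; intros n Hn; apply sum_n_m_ext_loc; intros k Hk.
apply H; split; [auto|lia].
Qed.

Lemma triangle_sum_0 (f : nat -> Z -> G) N :
  (forall n j, in_triangle N n j -> f n j = zero) -> triangle_sum f N = zero.
Proof.
intros H; apply sum_n_m_0; intros n Hn; apply sum_n_m_0; intros k Hk.
apply H; split; [auto|lia].
Qed.

Lemma triangle_sum_1 (f : nat -> Z -> G) N n1 j1 : in_triangle N n1 j1 ->
  (forall n j, in_triangle N n j -> ~ (n = n1 /\ j = j1) -> f n j = zero) ->
  triangle_sum f N = f n1 j1.
Proof.
intros [Hn1 Hj1] H; unfold triangle_sum.
rewrite (sum_n_m_single _ 1 N n1); auto.
- unfold sum_n; rewrite (sum_n_m_single _ 0 (2 * n1 - 2) (Z.to_nat (j1 + (Z.of_nat n1 - 1)))).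
  + f_equal; lia.
  + lia.
  + intros i Hi Hne; apply H; [split; [auto|lia]|lia].
- intros n Hn Hne; apply sum_n_m_0; intros k Hk; apply H; [split; [auto|lia]|lia].
Qed.

Lemma triangle_sum_plus (f g : nat -> Z -> G) N :
  triangle_sum (fun n j => plus (f n j) (g n j)) N = plus (triangle_sum f N) (triangle_sum g N).
Proof.
unfold triangle_sum; rewrite <- sum_n_m_plus; apply sum_n_m_ext_loc; intros n _.
apply sum_n_m_plus.
Qed.

Lemma triangle_sum_2 (f : nat -> Z -> G) N n1 j1 n2 j2 :
  in_triangle N n1 j1 -> in_triangle N n2 j2 -> ~ (n1 = n2 /\ j1 = j2) ->
  (forall n j, in_triangle N n j -> ~ (n = n1 /\ j = j1) -> ~ (n = n2 /\ j = j2) ->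
     f n j = zero) ->
  triangle_sum f N = plus (f n1 j1) (f n2 j2).
Proof.
intros H1 H2 Hne H.
set (at1 := fun n j => if Nat.eq_dec n n1 then if Z.eq_dec j j1 then true else false else false).
rewrite (triangle_sum_ext f (fun n j => plus (if at1 n j then f n j else zero)
  (if at1 n j then zero else f n j))).
- rewrite triangle_sum_plus; f_equal.
  + rewrite (triangle_sum_1 _ N n1 j1); auto; unfold at1; intros;
    repeat (destruct Nat.eq_dec || destruct Z.eq_dec); tauto.
  + rewrite (triangle_sum_1 _ N n2 j2); auto; unfold at1; intros;
    repeat (destruct Nat.eq_dec || destruct Z.eq_dec); subst; try tauto; apply H; tauto.
- intros n j _; destruct (at1 n j); [now rewrite plus_zero_r|now rewrite plus_zero_l].
Qed.

Lemma triangle_sum_S (f : nat -> Z -> G) N :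
  triangle_sum f (S N) = plus (triangle_sum f N)
    (sum_n (fun k => f (S N) (Z.of_nat k - (Z.of_nat (S N) - 1))%Z) (2 * S N - 2)).
Proof. unfold triangle_sum; apply sum_n_Sm; lia. Qed.

End Triangle.

(** * Coefficients of the partial sums *)

Lemma L_coef_sym n j a b : (Z.abs j <= n - 1)%Z -> L_coef n j a b = L_coef n j b a.
Proof.
assert (D : forall x y, delta a b x y = delta b a y x)
  by (intros; unfold delta; now rewrite Bool.andb_comm).
intros Hj; destruct (L_index_cases _ _ Hj) as [[i [Hi ->]]|[i [Hi ->]]];
rewrite ?L_coef_first, ?L_coef_second, !D; ring.
Qed.

Definition partial_coef (beta : nat -> Z -> C) (N : nat) (a b : Z) : C :=
  triangle_sum (fun n j => beta n j * L_coef (Z.of_nat n) j a b)%C N.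

Lemma partial_coef_sym beta N a b : partial_coef beta N a b = partial_coef beta N b a.
Proof.
apply (triangle_sum_ext (G := C_AbelianMonoid)); intros n j [_ Hj]; now rewrite L_coef_sym.
Qed.

(** Each family is indexed by its own i instead of j, and by integers, so that shifts of n and i
    stay linear for [lia]. *)
Definition first_coef (beta : nat -> Z -> C) (n i : Z) : C := beta (Z.to_nat n) (n - 1 - 2 * i)%Z.
Definition second_coef (beta : nat -> Z -> C) (n i : Z) : C := beta (Z.to_nat n) (n - 2 * i)%Z.

Ltac eval_delta := repeat match goal with |- context [delta ?a ?b ?x ?y] =>
  (rewrite (delta_1 a b x y) by lia) || (rewrite (delta_0 a b x y) by lia) end.

Ltac outside_support :=
  let n := fresh "n" in let j := fresh "j" in let Hn := fresh in let Hj := fresh in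
  intros n j [Hn Hj] ? ?;
  destruct (L_index_cases _ _ Hj) as [[i [Hi ->]]|[i [Hi ->]]];
  [rewrite L_coef_first|rewrite L_coef_second]; eval_delta;
  match goal with |- ?x = zero => change (x = RtoC 0) end; ring.

Ltac on_support := rewrite ?Z2Nat.id by lia; rewrite ?L_coef_first, ?L_coef_second; eval_delta.

(** Off the diagonal, a monomial occurs in exactly one minimal solution of degree zdeg and one of
    degree zdeg + 1; the bound by N keeps the second inside the sum. This lemma and the next four
    treat one sector or axis each. *)
Lemma partial_coef_pos beta N a b : (1 <= b < a)%Z -> (a < Z.of_nat N)%Z ->
  partial_coef beta N a b = (first_coef beta a (a - 1 - b) + second_coef beta (a + 1) (a + 1 - b))%C.
Proof.
intros Hab HN; unfold partial_coef, first_coef, second_coef.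
rewrite (triangle_sum_2 (G := C_AbelianMonoid) _ N (Z.to_nat a) (a - 1 - 2 * (a - 1 - b))
  (Z.to_nat (a + 1)) (a + 1 - 2 * (a + 1 - b)));
  [|split; lia|split; lia|lia|outside_support].
on_support; unfold plus; simpl; ring.
Qed.

Lemma partial_coef_axis_pos beta N a : (1 <= a)%Z -> (a < Z.of_nat N)%Z ->
  partial_coef beta N a 0 = (first_coef beta a (a - 1) + first_coef beta (a + 1) a)%C.
Proof.
intros Hab HN; unfold partial_coef, first_coef, second_coef.
rewrite (triangle_sum_2 (G := C_AbelianMonoid) _ N (Z.to_nat a) (a - 1 - 2 * (a - 1))
  (Z.to_nat (a + 1)) (a + 1 - 1 - 2 * a));
  [|split; lia|split; lia|lia|outside_support].
on_support; unfold plus; simpl; ring.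
Qed.

Lemma partial_coef_axis_neg beta N m : (1 <= m)%Z -> (m < Z.of_nat N)%Z ->
  partial_coef beta N 0 (- m) = (first_coef beta (m + 1) 0 + first_coef beta m 0)%C.
Proof.
intros Hab HN; unfold partial_coef, first_coef, second_coef.
rewrite (triangle_sum_2 (G := C_AbelianMonoid) _ N (Z.to_nat (m + 1)) (m + 1 - 1 - 2 * 0)
  (Z.to_nat m) (m - 1 - 2 * 0));
  [|split; lia|split; lia|lia|outside_support].
on_support; unfold plus; simpl; ring.
Qed.

Lemma partial_coef_mixed beta N a m : (1 <= a)%Z -> (1 <= m)%Z -> (a + m < Z.of_nat N)%Z ->
  partial_coef beta N a (- m) = (second_coef beta (a + m) a + first_coef beta (a + m + 1) a)%C.
Proof.
intros Ha Hm HN; unfold partial_coef, first_coef, second_coef.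
rewrite (triangle_sum_2 (G := C_AbelianMonoid) _ N (Z.to_nat (a + m)) (a + m - 2 * a)
  (Z.to_nat (a + m + 1)) (a + m + 1 - 1 - 2 * a));
  [|split; lia|split; lia|lia|outside_support].
on_support; unfold plus; simpl; ring.
Qed.

Lemma partial_coef_neg beta N p q : (1 <= q < p)%Z -> (p < Z.of_nat N)%Z ->
  partial_coef beta N (- q) (- p) = (first_coef beta p q + second_coef beta (p + 1) q)%C.
Proof.
intros Ha HN; unfold partial_coef, first_coef, second_coef.
rewrite (triangle_sum_2 (G := C_AbelianMonoid) _ N (Z.to_nat p) (p - 1 - 2 * q)
  (Z.to_nat (p + 1)) (p + 1 - 2 * q));
  [|split; lia|split; lia|lia|outside_support].
on_support; unfold plus; simpl; ring.
Qed.

Ltac outside_support1 :=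
  let n := fresh "n" in let j := fresh "j" in let Hn := fresh in let Hj := fresh in
  intros n j [Hn Hj] ?;
  destruct (L_index_cases _ _ Hj) as [[i [Hi ->]]|[i [Hi ->]]];
  [rewrite L_coef_first|rewrite L_coef_second]; eval_delta;
  match goal with |- ?x = zero => change (x = RtoC 0) end; ring.

(** A diagonal monomial is its own mirror image: it occurs in a single minimal solution, counted
    twice. *)
Lemma partial_coef_diag_pos beta N a : (1 <= a)%Z -> (a < Z.of_nat N)%Z ->
  partial_coef beta N a a = (second_coef beta (a + 1) 1 + second_coef beta (a + 1) 1)%C.
Proof.
intros Ha HN; unfold partial_coef, first_coef, second_coef.
rewrite (triangle_sum_1 (G := C_AbelianMonoid) _ N (Z.to_nat (a + 1)) (a + 1 - 2 * 1));
  [|split; lia|outside_support1].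
on_support; ring.
Qed.

Lemma partial_coef_diag_neg beta N m : (1 <= m)%Z -> (m < Z.of_nat N)%Z ->
  partial_coef beta N (- m) (- m) = (second_coef beta (m + 1) m + second_coef beta (m + 1) m)%C.
Proof.
intros Ha HN; unfold partial_coef, first_coef, second_coef.
rewrite (triangle_sum_1 (G := C_AbelianMonoid) _ N (Z.to_nat (m + 1)) (m + 1 - 2 * m));
  [|split; lia|outside_support1].
on_support; ring.
Qed.

Lemma partial_coef_00 beta N : (1 <= N)%nat ->
  partial_coef beta N 0 0 = (first_coef beta 1 0 + first_coef beta 1 0)%C.
Proof.
intros HN; unfold partial_coef, first_coef, second_coef.
rewrite (triangle_sum_1 (G := C_AbelianMonoid) _ N (Z.to_nat 1) (1 - 1 - 2 * 0));
  [|split; lia|outside_support1].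
on_support; ring.
Qed.

Lemma order_cases a b : (b <= a)%Z ->
  (1 <= b < a)%Z \/ (1 <= a /\ b = 0)%Z \/ (a = 0 /\ b <= - 1)%Z \/
  (1 <= a /\ b <= - 1)%Z \/ (b < a <= - 1)%Z \/ (1 <= a /\ a = b)%Z \/
  (a <= - 1 /\ a = b)%Z \/ (a = 0 /\ b = 0)%Z.
Proof. lia. Qed.

Lemma C_double_inj (x y : C) : (x + x)%C = (y + y)%C -> x = y.
Proof.
intros H; assert (E2 : RtoC 2 <> RtoC 0) by (intros E; apply RtoC_inj in E; lra).
replace x with (/ 2 * (x + x))%C by (field; auto); rewrite H; field; auto.
Qed.

(** The origin gives F(1, 0); the axes propagate it to F(n, n - 1) and F(n, 0); the positive
    diagonal gives S(n, 1), hence F(n, 1) by the mixed sector. The other F follow by induction on i,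
    and S from F by the mixed sector. *)
Lemma partial_coef_inj (beta gamma : nat -> Z -> C) :
  (forall a b, exists N0, forall N, (N0 <= N)%nat ->
     partial_coef beta N a b = partial_coef gamma N a b) ->
  forall (n : nat) (j : Z), (1 <= n)%nat -> (Z.abs j <= Z.of_nat n - 1)%Z -> beta n j = gamma n j.
Proof.
intros H.
assert (E : forall a b, exists N, (Z.abs a + Z.abs b + 1 < Z.of_nat N)%Z /\
  partial_coef beta N a b = partial_coef gamma N a b).
{ intros a b; destruct (H a b) as [N0 H0].
  exists (N0 + Z.to_nat (Z.abs a + Z.abs b + 2))%nat; split; [lia|apply H0; lia]. }
pose (F := first_coef beta); pose (F' := first_coef gamma).
pose (S := second_coef beta); pose (S' := second_coef gamma).
assert (E1 : forall a b, (1 <= b < a)%Z ->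
  (F a (a - 1 - b)%Z + S (a + 1)%Z (a + 1 - b)%Z)%C = (F' a (a - 1 - b)%Z + S' (a + 1)%Z (a + 1 - b)%Z)%C).
{ intros a b Hab; destruct (E a b) as [N [HN HE]]; rewrite !partial_coef_pos in HE by lia; auto. }
assert (E2 : forall a, (1 <= a)%Z ->
  (F a (a - 1)%Z + F (a + 1)%Z a)%C = (F' a (a - 1)%Z + F' (a + 1)%Z a)%C).
{ intros a Ha; destruct (E a 0%Z) as [N [HN HE]]; rewrite !partial_coef_axis_pos in HE by lia; auto. }
assert (E3 : forall m, (1 <= m)%Z ->
  (F (m + 1)%Z 0%Z + F m 0%Z)%C = (F' (m + 1)%Z 0%Z + F' m 0%Z)%C).
{ intros a Ha; destruct (E 0%Z (- a)%Z) as [N [HN HE]]; rewrite !partial_coef_axis_neg in HE by lia; auto. }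
assert (E4 : forall a m, (1 <= a)%Z -> (1 <= m)%Z ->
  (S (a + m)%Z a + F (a + m + 1)%Z a)%C = (S' (a + m)%Z a + F' (a + m + 1)%Z a)%C).
{ intros a m Ha Hm; destruct (E a (- m)%Z) as [N [HN HE]]; rewrite !partial_coef_mixed in HE by lia; auto. }
assert (E6 : forall a, (1 <= a)%Z -> S (a + 1)%Z 1%Z = S' (a + 1)%Z 1%Z).
{ intros a Ha; destruct (E a a) as [N [HN HE]]; rewrite !partial_coef_diag_pos in HE by lia.
  now apply C_double_inj. }
assert (E8 : F 1%Z 0%Z = F' 1%Z 0%Z).
{ destruct (E 0%Z 0%Z) as [N [HN HE]]; rewrite !partial_coef_00 in HE by lia.
  now apply C_double_inj. }
assert (cancel_r : forall x y u v : C, (x + u)%C = (y + v)%C -> u = v -> x = y).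
{ intros x y u v Hxy ->; replace x with (x + v - v)%C by ring; rewrite Hxy; ring. }
assert (cancel_l : forall x y u v : C, (x + u)%C = (y + v)%C -> x = y -> u = v).
{ intros x y u v Hxy ->; replace u with (y + u - y)%C by ring; rewrite Hxy; ring. }
assert (Ftop : forall m : nat, F (Z.of_nat m + 1)%Z (Z.of_nat m) = F' (Z.of_nat m + 1)%Z (Z.of_nat m)).
{ induction m as [|m IH]; [exact E8|].
  specialize (E2 (Z.of_nat m + 1)%Z ltac:(lia)).
  replace (Z.of_nat m + 1 - 1)%Z with (Z.of_nat m) in E2 by lia.
  replace (Z.of_nat (Datatypes.S m)) with (Z.of_nat m + 1)%Z by lia.
  exact (cancel_l _ _ _ _ E2 IH). }
assert (F0 : forall m : nat, F (Z.of_nat m + 1)%Z 0%Z = F' (Z.of_nat m + 1)%Z 0%Z).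
{ induction m as [|m IH]; [exact E8|].
  specialize (E3 (Z.of_nat m + 1)%Z ltac:(lia)).
  replace (Z.of_nat (Datatypes.S m)) with (Z.of_nat m + 1)%Z by lia.
  exact (cancel_r _ _ _ _ E3 IH). }
assert (F1 : forall n, (2 <= n)%Z -> F n 1%Z = F' n 1%Z).
{ intros n Hn; destruct (Z.eq_dec n 2) as [->|Hne]; [exact (Ftop 1%nat)|].
  specialize (E4 1%Z (n - 2)%Z ltac:(lia) ltac:(lia)); specialize (E6 (n - 2)%Z ltac:(lia)).
  replace (1 + (n - 2))%Z with (n - 2 + 1)%Z in E4 by lia.
  replace (n - 2 + 1 + 1)%Z with n in E4 by lia.
  exact (cancel_l _ _ _ _ E4 E6). }
(* The chain is F(n - 2, i - 2), then S(n - 1, i) by the positive sector, then F(n, i) by the mixed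
   one: i drops by 2, which is why i = 0 and i = 1 are separate, and i = n - 1 leaves the
   sectors. *)
assert (HF : forall k : nat, forall n i, (0 <= i < n)%Z -> (i <= Z.of_nat k)%Z -> F n i = F' n i).
{ induction k as [|k IH]; intros n i Hi Hk.
  - replace i with 0%Z by lia; specialize (F0 (Z.to_nat (n - 1))).
    replace (Z.of_nat (Z.to_nat (n - 1)) + 1)%Z with n in F0 by lia; exact F0.
  - destruct (Z_le_gt_dec i (Z.of_nat k)) as [Hik|Hik]; [apply IH; lia|].
    destruct (Z.eq_dec i 0) as [->|Hi0]; [apply IH; lia|].
    destruct (Z.eq_dec i 1) as [->|Hi1]; [apply F1; lia|].
    destruct (Z.eq_dec i (n - 1)) as [Hin|Hin].
    + specialize (Ftop (Z.to_nat i)).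
      replace (Z.of_nat (Z.to_nat i)) with i in Ftop by lia.
      replace (i + 1)%Z with n in Ftop by lia; exact Ftop.
    + specialize (E1 (n - 2)%Z (n - 1 - i)%Z ltac:(lia)).
      replace (n - 2 - 1 - (n - 1 - i))%Z with (i - 2)%Z in E1 by lia.
      replace (n - 2 + 1 - (n - 1 - i))%Z with i in E1 by lia.
      assert (HS : S (n - 2 + 1)%Z i = S' (n - 2 + 1)%Z i)
        by exact (cancel_l _ _ _ _ E1 (IH (n - 2)%Z (i - 2)%Z ltac:(lia) ltac:(lia))).
      specialize (E4 i (n - 1 - i)%Z ltac:(lia) ltac:(lia)).
      replace (i + (n - 1 - i))%Z with (n - 2 + 1)%Z in E4 by lia.
      replace (n - 2 + 1 + 1)%Z with n in E4 by lia.
      exact (cancel_l _ _ _ _ E4 HS). }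
intros n j Hn Hj; destruct (L_index_cases _ _ Hj) as [[i [Hi ->]]|[i [Hi ->]]].
- specialize (HF (Z.to_nat i) (Z.of_nat n) i ltac:(lia) ltac:(lia)).
  unfold F, F', first_coef in HF; now rewrite Nat2Z.id in HF.
- specialize (E4 i (Z.of_nat n - i)%Z ltac:(lia) ltac:(lia)).
  pose proof (cancel_r _ _ _ _ E4 (HF (Z.to_nat i) (i + (Z.of_nat n - i) + 1)%Z i ltac:(lia) ltac:(lia))) as HS.
  unfold S, S', second_coef in HS.
  replace (i + (Z.of_nat n - i))%Z with (Z.of_nat n) in HS by lia.
  now rewrite Nat2Z.id in HS.
Qed.

(** * The coefficients of the expansion *)

Definition CSeries (f : nat -> C) : C := (Series (fun k => fst (f k)), Series (fun k => snd (f k))).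

Lemma fst_le_Cmod (x : C) : Rabs (fst x) <= Cmod x.
Proof. eapply Rle_trans; [apply Rmax_l|apply Rmax_Cmod]. Qed.

Lemma snd_le_Cmod (x : C) : Rabs (snd x) <= Cmod x.
Proof. eapply Rle_trans; [apply Rmax_r|apply Rmax_Cmod]. Qed.

Lemma ex_series_geom_bound (f : nat -> R) A q : 0 < q < 1 ->
  (forall k, Rabs (f k) <= A * q ^ k) ->
  ex_series f /\ Rabs (Series f) <= A / (1 - q).
Proof.
intros Hq H.
assert (G : is_series (fun k => A * q ^ k) (A / (1 - q))).
{ unfold Rdiv; apply (is_series_scal_l (K := R_AbsRing) A (fun k => q ^ k)), is_series_geom.
  rewrite Rabs_pos_eq; lra. }
assert (E : ex_series (fun k => Rabs (f k))).
{ apply (ex_series_le (K := R_AbsRing) (V := R_CompleteNormedModule)) with (fun k => A * q ^ k);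
  [|now exists (A / (1 - q))].
  intros k; change (Rabs (Rabs (f k)) <= A * q ^ k); rewrite Rabs_Rabsolu; apply H. }
split; [now apply ex_series_Rabs|].
eapply Rle_trans; [now apply Series_Rabs|].
rewrite <- (is_series_unique _ _ G); apply Series_le; [|now exists (A / (1 - q))].
intros k; split; [apply Rabs_pos|apply H].
Qed.

Lemma CSeries_step (f : nat -> C) A q : 0 < q < 1 -> (forall k, Cmod (f k) <= A * q ^ k) ->
  CSeries f = (f 0%nat + CSeries (fun k => f (S k)))%C.
Proof.
intros Hq H; unfold CSeries, Cplus; simpl; apply f_equal2; apply Series_incr_1.
- apply (ex_series_geom_bound _ A q); auto.
  intros k; eapply Rle_trans; [apply fst_le_Cmod|apply H].
- apply (ex_series_geom_bound _ A q); auto.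
  intros k; eapply Rle_trans; [apply snd_le_Cmod|apply H].
Qed.

Lemma CSeries_bound (f : nat -> C) A q : 0 < q < 1 -> (forall k, Cmod (f k) <= A * q ^ k) ->
  Cmod (CSeries f) <= 2 * A / (1 - q).
Proof.
intros Hq H.
replace (CSeries f) with (RtoC (Series (fun k => fst (f k))) + Ci * RtoC (Series (fun k => snd (f k))))%C.
- eapply Rle_trans; [apply Cmod_triangle|].
  rewrite Cmod_mult, Cmod_Ci, Rmult_1_l, !Cmod_R.
  replace (2 * A / (1 - q)) with (A / (1 - q) + A / (1 - q)) by (field; lra).
  apply Rplus_le_compat; apply ex_series_geom_bound; auto; intros k; eapply Rle_trans with (2 := H k);
    [apply fst_le_Cmod|apply snd_le_Cmod].
- unfold CSeries, RtoC, Ci, Cmult, Cplus; simpl; apply f_equal2; ring.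
Qed.

Definition decays (r : R) (c : Z -> Z -> C) : Prop :=
  exists B, 0 < B /\ forall a b, Cmod (c a b) <= B * exp (- (r * IZR (zdeg a b))).

(* Matching the coefficients of w^n z^b gives F(n, b) - F(n+2, b) = c(n, b) - c(n+1-b, -b)
   for the coefficient F(n, b) of L_{n, 2b+1-n}; summing this telescoping relation, with
   F(n, b) -> 0, gives the series. *)
Definition tail_series (c : Z -> Z -> C) (n b : Z) : C :=
  CSeries (fun k => c (n + 2 * Z.of_nat k)%Z b - c (n + 2 * Z.of_nat k + 1 - b)%Z (- b)%Z)%C.

(** The bound is asked at every integer, though it is weak for n < 0: the relations below can then
    be proved for all n at once. *)
Definition small (r : R) (X : Z -> C) : Prop :=
  exists A, 0 < A /\ forall n, Cmod (X n) <= A * exp (- (r * IZR n)).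

Lemma small_plus r X Y : small r X -> small r Y -> small r (fun n => X n + Y n)%C.
Proof.
intros [A [PA HA]] [B [PB HB]]; exists (A + B); split; [lra|]; intros n.
eapply Rle_trans; [apply Cmod_triangle|]; specialize (HA n); specialize (HB n); lra.
Qed.

Lemma small_opp r X : small r X -> small r (fun n => - X n)%C.
Proof. intros [A [PA HA]]; exists A; split; auto; intros n; now rewrite Cmod_opp. Qed.

Lemma small_minus r X Y : small r X -> small r Y -> small r (fun n => X n - Y n)%C.
Proof. intros HX HY; exact (small_plus r X _ HX (small_opp r Y HY)). Qed.

Lemma small_coef r c (x y : Z -> Z) k : 0 < r -> decays r c ->
  (forall n, n - k <= zdeg (x n) (y n))%Z -> small r (fun n => c (x n) (y n)).
Proof.
intros Hr [B [PB HB]] Hd; exists (B * exp (r * IZR k)); split.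
- apply Rmult_lt_0_compat; [auto|apply exp_pos].
- intros n; eapply Rle_trans; [apply HB|].
  rewrite Rmult_assoc, <- exp_plus; apply Rmult_le_compat_l; [lra|].
  apply exp_le_exp; specialize (Hd n); apply IZR_le in Hd; rewrite minus_IZR in Hd; nra.
Qed.

Lemma small_periodic r X : 0 < r -> small r X ->
  (forall n, X n = X (n + 2)%Z) -> forall n, X n = RtoC 0.
Proof.
intros Hr [A [PA HA]] HX n.
assert (E : forall k, X n = X (n + 2 * Z.of_nat k)%Z).
{ induction k as [|k IH]; [f_equal; lia|rewrite IH, HX; f_equal; lia]. }
apply Cmod_eq_0, Rle_antisym; [|apply Cmod_ge_0].
apply le_epsilon; intros eps He; rewrite Rplus_0_l.
destruct (poly_exp_small (A * exp (- (r * IZR n))) 0 (2 * r) eps) as [k Hk]; [lra|lra|].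
specialize (Hk k (le_n k)); rewrite (E k); eapply Rle_trans; [apply HA|].
rewrite pow_O, Rmult_1_r, Rmult_assoc, <- exp_plus in Hk.
replace (- (r * IZR (n + 2 * Z.of_nat k))) with (- (r * IZR n) + - (2 * r * INR k)); auto.
rewrite plus_IZR, mult_IZR, <- INR_IZR_INZ; ring.
Qed.

(** With m = n + 2k, both index pairs have [zdeg] at least m: the first through its first entry, the
    second through the difference m + 1 of its entries. Hence a bound uniform in b. *)
Lemma tail_term_bound r c : 0 < r -> decays r c -> exists A, 0 < A /\ forall n b k,
  Cmod (c (n + 2 * Z.of_nat k)%Z b - c (n + 2 * Z.of_nat k + 1 - b)%Z (- b)%Z)%C
    <= A * exp (- (r * IZR n)) * exp (- (2 * r)) ^ k.
Proof.
intros Hr [B [PB HB]]; exists (2 * B); split; [lra|]; intros n b k.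
assert (P : exp (- (2 * r)) ^ k = exp (- (r * (2 * INR k)))).
{ induction k as [|k IH]; [simpl; rewrite !Rmult_0_r, Ropp_0, exp_0; auto|].
  rewrite S_INR; simpl; rewrite IH, <- exp_plus; f_equal; ring. }
rewrite P, Rmult_assoc, <- exp_plus; clear P.
replace (- (r * IZR n) + - (r * (2 * INR k))) with (- (r * IZR (n + 2 * Z.of_nat k)))
  by (rewrite plus_IZR, mult_IZR, <- INR_IZR_INZ; ring).
unfold Cminus; eapply Rle_trans; [apply Cmod_triangle|]; rewrite Cmod_opp.
set (m := (n + 2 * Z.of_nat k)%Z).
assert (L : forall a b, (m <= zdeg a b)%Z -> Cmod (c a b) <= B * exp (- (r * IZR m))).
{ intros a' b' Hd; eapply Rle_trans; [apply HB|]; apply Rmult_le_compat_l; [lra|].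
  apply exp_le_exp; apply IZR_le in Hd; nra. }
pose proof (L m b ltac:(unfold zdeg; lia)).
pose proof (L (m + 1 - b)%Z (- b)%Z ltac:(unfold zdeg; lia)); lra.
Qed.

Lemma exp_neg_lt_1 r : 0 < r -> 0 < exp (- (2 * r)) < 1.
Proof.
intros Hr; split; [apply exp_pos|]; rewrite <- exp_0; apply exp_increasing; lra.
Qed.

Lemma tail_series_bound r c : 0 < r -> decays r c -> exists A, 0 < A /\
  forall n b, Cmod (tail_series c n b) <= A * exp (- (r * IZR n)).
Proof.
intros Hr Hc; destruct (tail_term_bound r c Hr Hc) as [A [PA HA]].
pose proof (exp_neg_lt_1 r Hr) as Hq; set (q := exp (- (2 * r))) in *.
exists (2 * A / (1 - q)); split; [apply Rdiv_lt_0_compat; lra|]; intros n b.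
eapply Rle_trans; [apply (CSeries_bound _ (A * exp (- (r * IZR n))) q Hq)|right; field; lra].
intros k; apply HA.
Qed.

Lemma small_tail r c b : 0 < r -> decays r c -> small r (fun n => tail_series c n (b n)).
Proof.
intros Hr Hc; destruct (tail_series_bound r c Hr Hc) as [A [PA HA]]; exists A; auto.
Qed.

Lemma small_tail_shift r c b k : 0 < r -> decays r c ->
  small r (fun n => tail_series c (n + k) (b n)).
Proof.
intros Hr Hc; destruct (tail_series_bound r c Hr Hc) as [A [PA HA]].
exists (A * exp (- (r * IZR k))); split.
- apply Rmult_lt_0_compat; [auto|apply exp_pos].
- intros n; rewrite Rmult_assoc, <- exp_plus.
  replace (- (r * IZR k) + - (r * IZR n)) with (- (r * IZR (n + k))) by (rewrite plus_IZR; ring).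
  apply HA.
Qed.

Definition Leibniz_relation (c : Z -> Z -> C) : Prop := forall p q,
  (c (p + 1)%Z (q + 1)%Z - c (p - 1)%Z (q - 1)%Z
   + (c (q - p + 1)%Z (- p + 1)%Z - c (q - p - 1)%Z (- p - 1)%Z)
   + (c (- q + 1)%Z (p - q + 1)%Z - c (- q - 1)%Z (p - q - 1)%Z))%C = RtoC 0.

Lemma tail_series_step r c n b : 0 < r -> decays r c ->
  tail_series c n b = (c n b - c (n + 1 - b)%Z (- b)%Z + tail_series c (n + 2) b)%C.
Proof.
intros Hr Hc; destruct (tail_term_bound r c Hr Hc) as [A [PA HA]].
unfold tail_series at 1.
rewrite (CSeries_step _ (A * exp (- (r * IZR n))) (exp (- (2 * r))) (exp_neg_lt_1 r Hr))
  by (intros k; apply HA).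
replace (n + 2 * Z.of_nat 0)%Z with n by lia; apply f_equal.
unfold tail_series, CSeries; apply f_equal2; apply Series_ext; intros k;
replace (n + 2 * Z.of_nat (S k))%Z with (n + 2 + 2 * Z.of_nat k)%Z by lia; reflexivity.
Qed.

Lemma C_eq_by (x y e : C) : e = RtoC 0 -> (x - y)%C = (- e)%C -> x = y.
Proof. intros -> H; apply Cminus_eq_0; rewrite H; ring. Qed.

Lemma C_eq_by2 (x y e : C) : e = RtoC 0 -> (x - y)%C = e -> x = y.
Proof. intros -> H; now apply Cminus_eq_0. Qed.

Section Existence.

Context {r : R} {c : Z -> Z -> C}.
Context (Hr : 0 < r) (Hc : decays r c).
Context (Hsym : forall a b, c a b = c b a) (Hrel : Leibniz_relation c).

(** Rewrites coefficients that agree up to symmetry and linear arithmetic to one form, so that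
    [ring] sees the same atom. *)
Ltac canon c a b := repeat match goal with |- context [c ?x ?y] =>
  lazymatch constr:((x, y)) with
  | (a, b) => fail
  | _ => (replace (c x y) with (c a b) by (apply f_equal2; lia)) ||
         (replace (c x y) with (c a b) by (rewrite Hsym; apply f_equal2; lia))
  end end.

(* Each relation X n = 0 below holds because X is 2-periodic (by the Leibniz relation
   and [tail_series_step]) and tends to 0. *)

Lemma tail_diagonal_step n b :
  (tail_series c n b - tail_series c (n + 2)%Z (b + 2)%Z)%C =
  (c (b + 1 - n)%Z (- n)%Z - c (n - 1 - b)%Z (- 2 - b)%Z)%C.
Proof.
apply Cminus_eq_0; revert n.
apply (small_periodic r); auto.
- apply small_minus; apply small_minus.
  + now apply (small_tail r c (fun _ => b)).
  + now apply (small_tail_shift r c (fun _ => (b + 2)%Z) 2).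
  + apply (small_coef r c _ _ 0); auto; intros; unfold zdeg; lia.
  + apply (small_coef r c _ _ 1); auto; intros; unfold zdeg; lia.
- intros n; rewrite (tail_series_step r c n b), (tail_series_step r c (n + 2) (b + 2)) by auto.
  (* At (n + 1, b + 1) the first pair of the relation is c(n + 2, b + 2) - c(n, b), left over by the
     two series steps; the other boundary terms make up the remaining pairs. *)
  generalize (Hrel (n + 1)%Z (b + 1)%Z).
  canon c n b; canon c (n + 2)%Z (b + 2)%Z; canon c (n + 1 - b)%Z (- b)%Z;
  canon c (b + 1 - n)%Z (- n)%Z; canon c (b - 1 - n)%Z (- 2 - n)%Z;
  canon c (n - 1 - b)%Z (- 2 - b)%Z; canon c (n + 1 - b)%Z (- 2 - b)%Z.
  intros H; apply (C_eq_by _ _ _ H); ring.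
Qed.

(** This is the comparison at w^-n z^-n. In the relation at (n + 1, 0), symmetry identifies the
    first and third pairs. *)
Lemma tail_one n : (tail_series c (n + 2)%Z 1 + tail_series c (n + 2)%Z 1)%C =
  (c n (- 1)%Z + c n (- 1)%Z - c (- n)%Z (- n)%Z)%C.
Proof.
apply Cminus_eq_0; revert n; apply (small_periodic r); auto.
- apply small_minus; [apply small_plus|apply small_minus; [apply small_plus|]];
  try (apply (small_tail_shift r c (fun _ => 1%Z) 2); auto);
  apply (small_coef r c _ _ 0); auto; intros; unfold zdeg; lia.
- intros n; rewrite (tail_series_step r c (n + 2) 1) by auto.
  generalize (Hrel (n + 1)%Z 0%Z).
  canon c (n + 2)%Z 1%Z; canon c (n + 2)%Z (- 1)%Z; canon c n (- 1)%Z;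
  canon c (- n)%Z (- n)%Z; canon c (- n - 2)%Z (- n - 2)%Z.
  intros H; apply (C_eq_by2 _ _ _ H); ring.
Qed.

(** This is the comparison at w^n z^n. Both arguments of the series move with n, so
    [tail_diagonal_step] takes the place of [tail_series_step]. *)
Lemma tail_top n : (tail_series c (n + 2)%Z n + tail_series c (n + 2)%Z n)%C =
  (c 1%Z (- n)%Z + c 1%Z (- n)%Z - c n n)%C.
Proof.
apply Cminus_eq_0; revert n; apply (small_periodic r); auto.
- apply small_minus; [apply small_plus|apply small_minus; [apply small_plus|]];
  try (apply (small_tail_shift r c (fun n => n) 2); auto);
  apply (small_coef r c _ _ 0); auto; intros; unfold zdeg; lia.
- intros n; pose proof (tail_diagonal_step (n + 2) n) as T.
  revert T; generalize (Hrel (n + 1)%Z (n + 1)%Z).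
  canon c 1%Z (- n)%Z; canon c 1%Z (- n - 2)%Z; canon c n n; canon c (n + 2)%Z (n + 2)%Z;
  canon c (- 1)%Z (- 2 - n)%Z.
  intros H T.
  set (g := tail_series c (n + 2 + 2)%Z (n + 2)%Z) in *.
  replace (tail_series c (n + 2)%Z n) with (tail_series c (n + 2)%Z n - g + g)%C by ring.
  rewrite T; apply (C_eq_by _ _ _ H); ring.
Qed.

(** The comparison on the negative axis. Two diagonal steps are added, and of their boundary terms
    only those on the axis survive. *)
Lemma tail_consecutive n :
  (tail_series c (n + 1)%Z n + tail_series c n (n - 1)%Z)%C = c 0%Z (- n)%Z.
Proof.
apply Cminus_eq_0; revert n; apply (small_periodic r); auto.
- apply small_minus; [apply small_plus|].
  + apply (small_tail_shift r c (fun n => n) 1); auto.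
  + apply (small_tail r c (fun n => n - 1)%Z); auto.
  + apply (small_coef r c _ _ 0); auto; intros; unfold zdeg; lia.
- intros n; pose proof (tail_diagonal_step (n + 1) n) as T1.
  pose proof (tail_diagonal_step n (n - 1)) as T2; revert T1 T2.
  replace (n + 1 + 2)%Z with (n + 2 + 1)%Z by lia.
  replace (n - 1 + 2)%Z with (n + 2 - 1)%Z by lia.
  canon c 0%Z (- n)%Z; canon c 0%Z (- n - 1)%Z; canon c 0%Z (- n - 2)%Z.
  intros T1 T2.
  set (g1 := tail_series c (n + 2 + 1)%Z (n + 2)%Z) in *.
  set (g2 := tail_series c (n + 2)%Z (n + 2 - 1)%Z) in *.
  replace (tail_series c (n + 1)%Z n) with (tail_series c (n + 1)%Z n - g1 + g1)%C by ring.
  replace (tail_series c n (n - 1)%Z) with (tail_series c n (n - 1)%Z - g2 + g2)%C by ring.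
  rewrite T1, T2; canon c 0%Z (- n - 2)%Z; ring.
Qed.

(** The comparison on the positive axis. For b = 0 the two series interleave to the telescoping sum
    of c(m, 0) - c(m + 1, 0) over m >= n. *)
Lemma tail_zero n : (tail_series c n 0 + tail_series c (n + 1)%Z 0)%C = c n 0%Z.
Proof.
apply Cminus_eq_0; revert n; apply (small_periodic r); auto.
- apply small_minus; [apply small_plus|].
  + apply (small_tail r c (fun n => 0)%Z); auto.
  + apply (small_tail_shift r c (fun n => 0%Z) 1); auto.
  + apply (small_coef r c _ _ 0); auto; intros; unfold zdeg; lia.
- intros n; rewrite (tail_series_step r c n 0), (tail_series_step r c (n + 1) 0) by auto.
  replace (n + 1 + 2)%Z with (n + 2 + 1)%Z by lia.
  canon c n 0%Z; canon c (n + 1)%Z 0%Z; canon c (n + 2)%Z 0%Z; ring.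
Qed.

(** The origin is linked to the rest through T(2, 1), which occurs both in [tail_one] at 0 and in
    [tail_consecutive] at 1. *)
Lemma tail_origin : (tail_series c 1 0 + tail_series c 1 0)%C = c 0%Z 0%Z.
Proof.
pose proof (tail_one 0) as H1; pose proof (tail_consecutive 1) as H2.
revert H1 H2; change (0 + 2)%Z with 2%Z; change (1 + 1)%Z with 2%Z; change (1 - 1)%Z with 0%Z.
canon c 0%Z (- 1)%Z; canon c 0%Z 0%Z; intros H1 H2.
rewrite <- H2 in H1.
transitivity (- (tail_series c 2 1 + tail_series c 2 1)
  + (tail_series c 2 1 + tail_series c 1 0 + (tail_series c 2 1 + tail_series c 1 0)))%C; [ring|].
rewrite H1; ring.
Qed.

(** With i the index within the family, the second value is forced by the comparison at w^i z^-(n -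
    i), whose other unknown is the first family coefficient of degree n + 1 and the same i. *)
Definition expansion_coef (n : nat) (j : Z) : C :=
  let n := Z.of_nat n in
  if Z.even (n - 1 - j) then tail_series c n (n - 1 - (n - 1 - j) / 2)
  else (c ((n - j) / 2)%Z (- (n - (n - j) / 2))%Z - tail_series c (n + 1) (n - (n - j) / 2))%C.

Lemma expansion_first n i : (0 <= n)%Z ->
  first_coef expansion_coef n i = tail_series c n (n - 1 - i).
Proof.
intros Hn; unfold first_coef, expansion_coef; rewrite Z2Nat.id by auto.
replace (n - 1 - (n - 1 - 2 * i))%Z with (i * 2)%Z by lia.
rewrite Z.even_mul, Bool.orb_true_r, Z.div_mul by lia; reflexivity.
Qed.

Lemma expansion_second n i : (0 <= n)%Z ->
  second_coef expansion_coef n i = (c i (- (n - i))%Z - tail_series c (n + 1) (n - i))%C.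
Proof.
intros Hn; unfold second_coef, expansion_coef; rewrite Z2Nat.id by auto.
replace (n - 1 - (n - 2 * i))%Z with (- (1) + 2 * i)%Z by lia.
rewrite Z.even_add_mul_2; replace (n - (n - 2 * i))%Z with (i * 2)%Z by lia.
rewrite Z.div_mul by lia; reflexivity.
Qed.

Lemma expansion_coef_bound : exists A, 0 < A /\ forall n j, (Z.abs j <= Z.of_nat n - 1)%Z ->
  Cmod (expansion_coef n j) <= A * exp (- (r * INR n)).
Proof.
destruct (tail_series_bound r c Hr Hc) as [A [PA HA]]; destruct Hc as [B [PB HB]].
exists (A + B); split; [lra|]; intros n j Hj.
pose proof (exp_pos (- (r * INR n))) as HE; rewrite INR_IZR_INZ in *.
unfold expansion_coef; cbv zeta; destruct Z.even.
- eapply Rle_trans; [apply HA|]; nra.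
- unfold Cminus; eapply Rle_trans; [apply Cmod_triangle|]; rewrite Cmod_opp.
  set (i := ((Z.of_nat n - j) / 2)%Z).
  specialize (HA (Z.of_nat n + 1)%Z (Z.of_nat n - i)%Z); specialize (HB i (- (Z.of_nat n - i))%Z).
  assert (E1 : exp (- (r * IZR (Z.of_nat n + 1))) <= exp (- (r * IZR (Z.of_nat n))))
    by (apply exp_le_exp; rewrite plus_IZR; nra).
  assert (E2 : exp (- (r * IZR (zdeg i (- (Z.of_nat n - i))))) <= exp (- (r * IZR (Z.of_nat n)))).
  { apply exp_le_exp; assert (L : (Z.of_nat n <= zdeg i (- (Z.of_nat n - i)))%Z) by (unfold zdeg; lia).
    apply IZR_le in L; nra. }
  nra.
Qed.

(** In the positive sector this is the recursion of the series, in the mixed sector the choice of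
    the second family; the negative sector is [tail_diagonal_step], and the axes, diagonals and
    origin are the other tail relations. *)
Lemma partial_coef_expansion N a b : (zdeg a b < Z.of_nat N)%Z ->
  partial_coef expansion_coef N a b = c a b.
Proof.
revert a b.
assert (W : forall a b, (b <= a)%Z -> (zdeg a b < Z.of_nat N)%Z ->
  partial_coef expansion_coef N a b = c a b).
{ intros a b Hab Hd; unfold zdeg in Hd.
  destruct (order_cases a b Hab) as [H|[[H ->]|[[-> H]|[[H1 H2]|[H|[[H <-]|[[H <-]|[-> ->]]]]]]]].
  - rewrite partial_coef_pos, expansion_first, expansion_second by lia.
    replace (a - 1 - (a - 1 - b))%Z with b by lia.
    replace (a + 1 - (a + 1 - b))%Z with b by lia; replace (a + 1 + 1)%Z with (a + 2)%Z by lia.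
    rewrite (tail_series_step r c a b) by auto; ring.
  - rewrite partial_coef_axis_pos, !expansion_first by lia.
    replace (a - 1 - (a - 1))%Z with 0%Z by lia; replace (a + 1 - 1 - a)%Z with 0%Z by lia.
    apply tail_zero.
  - replace b with (- - b)%Z by lia; rewrite partial_coef_axis_neg, !expansion_first by lia.
    replace (- b + 1 - 1 - 0)%Z with (- b)%Z by lia; replace (- b - 1 - 0)%Z with (- b - 1)%Z by lia.
    apply tail_consecutive.
  - replace b with (- - b)%Z by lia; rewrite partial_coef_mixed, expansion_first, expansion_second by lia.
    replace (a + - b + 1 - 1 - a)%Z with (- b)%Z by lia.
    replace (a + - b - a)%Z with (- b)%Z by lia; ring.
  - replace a with (- - a)%Z by lia; replace b with (- - b)%Z by lia.
    rewrite partial_coef_neg, expansion_first, expansion_second by lia.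
    pose proof (tail_diagonal_step (- b) (- b - 1 - - a)) as T; revert T.
    replace (- b - 1 - - a + 2)%Z with (- b + 1 - - a)%Z by lia.
    replace (- b + 1 + 1)%Z with (- b + 2)%Z by lia.
    canon c (- - a)%Z (- - b)%Z; canon c (- a)%Z (- (- b + 1 - - a))%Z.
    intros T; transitivity (tail_series c (- b)%Z (- b - 1 - - a)%Z
      - tail_series c (- b + 2)%Z (- b + 1 - - a)%Z + c (- a)%Z (- (- b + 1 - - a))%Z)%C; [ring|].
    rewrite T; ring.
  - rewrite partial_coef_diag_pos, expansion_second by lia.
    replace (a + 1 + 1)%Z with (a + 2)%Z by lia; replace (a + 1 - 1)%Z with a by lia.
    pose proof (tail_top a) as T.
    transitivity (c 1%Z (- a)%Z + c 1%Z (- a)%Z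
      - (tail_series c (a + 2)%Z a + tail_series c (a + 2)%Z a))%C; [ring|rewrite T; ring].
  - replace a with (- - a)%Z by lia; rewrite partial_coef_diag_neg, expansion_second by lia.
    replace (- a + 1 + 1)%Z with (- a + 2)%Z by lia; replace (- a + 1 - - a)%Z with 1%Z by lia.
    pose proof (tail_one (- a)) as T; canon c (- a)%Z (- 1)%Z.
    transitivity (c (- a)%Z (- 1)%Z + c (- a)%Z (- 1)%Z
      - (tail_series c (- a + 2)%Z 1 + tail_series c (- a + 2)%Z 1))%C; [ring|rewrite T; ring].
  - rewrite partial_coef_00, expansion_first by lia.
    change (1 - 1 - 0)%Z with 0%Z; apply tail_origin. }
intros a b Hd; destruct (Z_le_gt_dec b a); [now apply W|].
rewrite partial_coef_sym, Hsym; apply W; [lia|unfold zdeg in *; lia].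
Qed.

End Existence.

(** * Convergence of the expansion *)

Notation Ctriangle := (triangle_sum (G := C_AbelianMonoid)).
Notation Rtriangle := (triangle_sum (G := R_AbelianMonoid)).

Lemma triangle_sum_Zsum (f : nat -> Z -> Z -> C) N N' :
  Ctriangle (fun n j => Zsum (fun a => f n j a) N') N =
  Zsum (fun a => Ctriangle (fun n j => f n j a) N) N'.
Proof.
induction N' as [|N' IH]; [reflexivity|].
rewrite Zsum_S, <- IH.
etransitivity; [exact (triangle_sum_plus (G := C_AbelianMonoid) _ _ N)|].
apply f_equal; exact (triangle_sum_plus (G := C_AbelianMonoid) _ _ N).
Qed.

Lemma triangle_sum_Cmult_r (f : nat -> Z -> C) k N :
  Ctriangle (fun n j => f n j * k)%C N = (Ctriangle f N * k)%C.
Proof.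
unfold triangle_sum; etransitivity;
[|exact (sum_n_m_mult_r (K := C_Ring) k (fun n => sum_n (G := C_AbelianMonoid) _ _) 1 N)].
apply sum_n_m_ext_loc; intros n _; exact (sum_n_m_mult_r (K := C_Ring) k _ 0 _).
Qed.

Lemma Laurent_sum_plus f g N w z :
  Laurent_sum (fun a b => f a b + g a b)%C N w z = (Laurent_sum f N w z + Laurent_sum g N w z)%C.
Proof.
unfold Laurent_sum; rewrite <- Zsum_plus; apply Zsum_ext; intros a _.
rewrite <- Zsum_plus; apply Zsum_ext; intros b _; ring.
Qed.

Lemma Laurent_sum_minus f g N w z :
  Laurent_sum (fun a b => f a b - g a b)%C N w z = (Laurent_sum f N w z - Laurent_sum g N w z)%C.
Proof.
unfold Laurent_sum; rewrite <- Zsum_minus; apply Zsum_ext; intros a _.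
rewrite <- Zsum_minus; apply Zsum_ext; intros b _; ring.
Qed.

Lemma Laurent_sum_delta x y N w z : (Z.abs x <= Z.of_nat N)%Z -> (Z.abs y <= Z.of_nat N)%Z ->
  Laurent_sum (fun a b => delta a b x y) N w z = (Czpow w x * Czpow z y)%C.
Proof.
intros Hx Hy; unfold Laurent_sum; rewrite (Zsum_single _ N x); auto.
- rewrite (Zsum_single _ N y); auto.
  + rewrite delta_1 by auto; ring.
  + intros b Hb; rewrite delta_0 by lia; ring.
- intros a Ha; apply Zsum_0; intros b _; rewrite delta_0 by lia; ring.
Qed.

Lemma Laurent_sum_list l N w z :
  (forall x y, In (x, y) l -> (Z.abs x <= Z.of_nat N)%Z /\ (Z.abs y <= Z.of_nat N)%Z) ->
  Laurent_sum (fun a b => list_sum (delta a b) l) N w z =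
  list_sum (fun x y => Czpow w x * Czpow z y)%C l.
Proof.
induction l as [|[x y] l IH]; intros H.
- unfold Laurent_sum; apply Zsum_0; intros a _; apply Zsum_0; intros b _; simpl; ring.
- simpl list_sum; rewrite <- IH by (intros; apply H; now right).
  destruct (H x y (or_introl eq_refl)); rewrite <- (Laurent_sum_delta x y N) by auto.
  apply Laurent_sum_plus.
Qed.

(** The monomials of the first N blocks have zdeg <= N, so the square cutoff of [Laurent_sum] loses
    none of them. *)
Lemma partial_expansion beta N w z : w <> RtoC 0 -> z <> RtoC 0 ->
  Ctriangle (L_term beta (w, z)) N = Laurent_sum (partial_coef beta N) N w z.
Proof.
intros Hw Hz; unfold Laurent_sum, partial_coef.
transitivity (Ctriangle (fun n j => Zsum (fun a => Zsum (fun b =>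
  beta n j * L_coef (Z.of_nat n) j a b * (Czpow w a * Czpow z b))%C N) N) N).
- apply triangle_sum_ext; intros n j [Hn Hj]; unfold L_term; cbn [fst snd].
  rewrite L_min_monomials by auto.
  rewrite <- (Laurent_sum_list _ N); unfold Laurent_sum.
  + rewrite <- Zsum_scal; apply Zsum_ext; intros a _.
    rewrite <- Zsum_scal; apply Zsum_ext; intros b _; unfold L_coef; ring.
  + intros x y Hin; apply L_support_zdeg in Hin; auto; unfold zdeg in Hin; lia.
- rewrite triangle_sum_Zsum; apply Zsum_ext; intros a _.
  rewrite triangle_sum_Zsum; apply Zsum_ext; intros b _.
  apply triangle_sum_Cmult_r.
Qed.

Lemma list_sum_bound f l B : (forall x y, In (x, y) l -> Cmod (f x y) <= B) ->
  Cmod (list_sum f l) <= INR (length l) * B.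
Proof.
induction l as [|[x y] l IH]; intros H.
- simpl; rewrite Cmod_0; lra.
- cbn [length list_sum fold_right fst snd]; rewrite S_INR.
  eapply Rle_trans; [apply Cmod_triangle|].
  specialize (IH (fun x y Hin => H x y (or_intror Hin))); unfold list_sum in IH.
  specialize (H x y (or_introl eq_refl)); lra.
Qed.

Lemma list_sum_0 f l : (forall x y, In (x, y) l -> f x y = RtoC 0) -> list_sum f l = RtoC 0.
Proof.
induction l as [|[x y] l IH]; intros H; [reflexivity|].
cbn [list_sum fold_right fst snd]; fold (list_sum f l).
rewrite IH by (intros; apply H; now right); rewrite H by (now left); ring.
Qed.

Lemma L_support_length n j : length (L_support n j) = 6%nat.
Proof. unfold L_support; now destruct Z.even. Qed.

Lemma L_support_zdeg_ge n j x y : (Z.abs j <= n - 1)%Z -> In (x, y) (L_support n j) ->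
  (n - 1 <= zdeg x y)%Z.
Proof.
intros Hj Hin; destruct (L_index_cases _ _ Hj) as [[i [Hi ->]]|[i [Hi ->]]];
rewrite ?L_support_first, ?L_support_second in Hin;
unfold symmetrize, half_first, half_second in Hin; cbn in Hin; unfold zdeg;
repeat destruct Hin as [Hin|Hin]; try (injection Hin as <- <-; lia); contradiction.
Qed.

Lemma L_coef_0 n j a b : (Z.abs j <= n - 1)%Z -> (n < zdeg a b \/ zdeg a b < n - 1)%Z ->
  L_coef n j a b = RtoC 0.
Proof.
intros Hj H; apply list_sum_0; intros x y Hin; apply delta_0.
pose proof (L_support_zdeg _ _ _ _ Hj Hin); pose proof (L_support_zdeg_ge _ _ _ _ Hj Hin).
destruct (Z.eq_dec x a), (Z.eq_dec y b); subst; lia.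
Qed.

Lemma L_coef_bound n j a b : Cmod (L_coef n j a b) <= 6.
Proof.
replace 6 with (INR (length (L_support n j)) * 1) by (rewrite L_support_length; simpl; ring).
apply list_sum_bound; intros x y _; unfold delta; destruct andb; rewrite ?Cmod_1, ?Cmod_0; lra.
Qed.

Definition closed_hexagon (k u v : R) : Prop := Rabs u <= k /\ Rabs v <= k /\ Rabs (u + v) <= k.

(** In each of six sectors, a u + b v is a nonnegative combination of two of the forms u, v, u + v
    up to sign; for a >= b >= 0 it is (a - b) u + b (u + v). The weights add up to zdeg. *)
Lemma monomial_bound k u v w z a b : closed_hexagon k u v -> Cmod w = exp u -> Cmod z = exp v ->
  Cmod (Czpow w a * Czpow z b)%C <= exp (k * IZR (zdeg a b)).
Proof.
intros (Hu & Hv & Huv) Hw Hz; rewrite Cmod_mult, (Cmod_Czpow w u), (Cmod_Czpow z v), <- exp_plus by auto.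
apply exp_le_exp; apply Rabs_le_between in Hu, Hv, Huv.
set (d := zdeg a b).
assert (D1 : (a <= d)%Z) by (unfold d, zdeg; lia); assert (D2 : (- a <= d)%Z) by (unfold d, zdeg; lia).
assert (D3 : (b <= d)%Z) by (unfold d, zdeg; lia); assert (D4 : (- b <= d)%Z) by (unfold d, zdeg; lia).
assert (D5 : (a - b <= d)%Z) by (unfold d, zdeg; lia); assert (D6 : (b - a <= d)%Z) by (unfold d, zdeg; lia).
apply IZR_le in D1, D2, D3, D4, D5, D6; rewrite ?minus_IZR, ?opp_IZR in *.
set (x := IZR a) in *; set (y := IZR b) in *; set (m := IZR d) in *; clearbody x y m.
assert (P : forall s t : R, 0 <= s -> t <= k -> s * t <= s * k) by (intros; now apply Rmult_le_compat_l).
assert (Hk : forall s, s <= m -> s * k <= k * m) by (intros; rewrite Rmult_comm; apply Rmult_le_compat_l; lra).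
destruct (Rle_dec 0 x), (Rle_dec 0 y).
- destruct (Rle_dec y x).
  + pose proof (P (x - y) u); pose proof (P y (u + v)); pose proof (Hk x); nra.
  + pose proof (P (y - x) v); pose proof (P x (u + v)); pose proof (Hk y); nra.
- pose proof (P x u); pose proof (P (- y) (- v)); pose proof (Hk (x - y)); nra.
- pose proof (P (- x) (- u)); pose proof (P y v); pose proof (Hk (y - x)); nra.
- destruct (Rle_dec y x).
  + pose proof (P (x - y) (- v)); pose proof (P (- x) (- (u + v))); pose proof (Hk (- y)); nra.
  + pose proof (P (y - x) (- u)); pose proof (P (- y) (- (u + v))); pose proof (Hk (- x)); nra.
Qed.

Lemma L_min_bound k u v w z (n : nat) j : 0 <= k -> closed_hexagon k u v ->
  Cmod w = exp u -> Cmod z = exp v -> (Z.abs j <= Z.of_nat n - 1)%Z ->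
  Cmod (L_min n j w z) <= 6 * exp (k * INR n).
Proof.
intros Hk Hh Hw Hz Hj.
rewrite L_min_monomials by (auto; eapply exp_neq_0; eassumption).
replace 6 with (INR (length (L_support (Z.of_nat n) j))) by (rewrite L_support_length; simpl; ring).
apply list_sum_bound; intros x y Hin.
eapply Rle_trans; [apply (monomial_bound k u v); auto|].
apply exp_le_exp; rewrite INR_IZR_INZ; apply Rmult_le_compat_l; auto.
apply IZR_le; exact (L_support_zdeg _ _ _ _ Hj Hin).
Qed.

Lemma sum_n_Cmod_bound (f : nat -> C) m B : (forall k, (k <= m)%nat -> Cmod (f k) <= B) ->
  Cmod (sum_n (G := C_AbelianMonoid) f m) <= (INR m + 1) * B.
Proof.
induction m as [|m IH]; intros H.
- rewrite sum_O; simpl; specialize (H 0%nat (le_n _)); lra.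
- rewrite sum_Sn, S_INR; eapply Rle_trans; [apply Cmod_triangle|].
  specialize (IH (fun k Hk => H k (le_S _ _ Hk))); specialize (H (S m) (le_n _)); lra.
Qed.

(* For [zdeg a b >= N] only the outermost block n = N contributes. *)
Lemma partial_coef_bound beta A r N a b : 0 <= A ->
  (forall n j, (Z.abs j <= Z.of_nat n - 1)%Z -> Cmod (beta n j) <= A * exp (- (r * INR n))) ->
  (Z.of_nat N <= zdeg a b)%Z ->
  (zdeg a b = Z.of_nat N \/ partial_coef beta N a b = RtoC 0) /\
  Cmod (partial_coef beta N a b) <= 12 * A * (INR N + 1) * exp (- (r * INR N)).
Proof.
intros HA Hb Hd.
destruct (Z.eq_dec (zdeg a b) (Z.of_nat N)) as [He|He].
- split; [now left|]; destruct N as [|N].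
  + unfold partial_coef, triangle_sum; rewrite sum_n_m_zero by lia; change (Cmod (RtoC 0) <= 12 * A * (INR 0 + 1) * exp (- (r * INR 0))).
    rewrite Cmod_0; simpl; rewrite Rmult_0_r, Ropp_0, exp_0; lra.
  + unfold partial_coef; rewrite triangle_sum_S.
    rewrite (triangle_sum_0 (G := C_AbelianMonoid)).
    * rewrite plus_zero_l; eapply Rle_trans.
      -- apply sum_n_Cmod_bound with (B := A * exp (- (r * INR (S N))) * 6); intros k Hk.
         rewrite Cmod_mult; apply Rmult_le_compat; try apply Cmod_ge_0; [apply Hb; lia|].
         apply L_coef_bound.
      (* The 12 is 6, the bound on [L_coef], times 2, since a block has fewer than 2 (N + 2) terms
         when its index is S N. *)
      -- assert (E : INR (2 * S N - 2) + 1 <= 2 * (INR (S N) + 1)).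
         { rewrite minus_INR by lia; rewrite mult_INR; change (INR 2) with 2; lra. }
         pose proof (exp_pos (- (r * INR (S N)))).
         replace (12 * A * (INR (S N) + 1) * exp (- (r * INR (S N))))
           with (2 * (INR (S N) + 1) * (A * exp (- (r * INR (S N))) * 6)) by ring.
         apply Rmult_le_compat_r; [apply Rmult_le_pos; [apply Rmult_le_pos|]|]; lra.
    * intros n j [Hn Hj]; rewrite L_coef_0 by (auto; lia).
      change (beta n j * RtoC 0 = RtoC 0)%C; ring.
- assert (E : partial_coef beta N a b = RtoC 0).
  { apply (triangle_sum_0 (G := C_AbelianMonoid)); intros n j [Hn Hj]; rewrite L_coef_0 by (auto; lia).
    change (beta n j * RtoC 0 = RtoC 0)%C; ring. }
  split; [now right|]; rewrite E, Cmod_0.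
  pose proof (exp_pos (- (r * INR N))); pose proof (pos_INR N).
  apply Rmult_le_pos; [apply Rmult_le_pos; lra|lra].
Qed.

(** The partial sum is compared with the square partial sum of the Laurent series. Their
    coefficients agree for zdeg < N, and the at most (2N + 1)^2 other terms are exponentially
    small. *)
Lemma expansion_cv K M w z : 0 < K -> CLR_solution Delta_s K M -> cyclic_annulus K (w, z) ->
  forall eps, 0 < eps -> exists N0, forall N, (N0 <= N)%nat ->
    Cmod (M w z - Ctriangle (L_term (expansion_coef (c := Laurent_coef M)) (w, z)) N)%C <= eps.
Proof.
intros HK HM Hwz eps He.
pose proof (holomorphic_separately K M (proj1 (proj1 HM))) as Hsep.
destruct (annulus_log K w z Hwz) as (u & v & Hw & Hz & Huv).
set (k := Rmax (Rmax (Rabs u) (Rabs v)) (Rabs (u + v))).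
assert (Hk : 0 <= k < K /\ closed_hexagon k u v).
{ destruct Huv as (H1 & H2 & H3); split; [split|split; [|split]].
  - eapply Rle_trans; [apply Rabs_pos|apply Rmax_r].
  - repeat apply Rmax_lub_lt; auto.
  - eapply Rle_trans; [apply Rmax_l|apply Rmax_l].
  - eapply Rle_trans; [apply Rmax_r|apply Rmax_l].
  - apply Rmax_r. }
destruct Hk as [Hk Hhex]; clearbody k.
(* Any r strictly between works: r < K gives decay of the coefficients at rate r, and k < r makes it
   beat the growth of the monomials. *)
set (r := (k + K) / 2); assert (Hr : k < r < K) by (unfold r; lra); clearbody r.
destruct (Laurent_coef_decay K r M Hsep ltac:(lra)) as [B [PB HB]].
assert (Hdec : decays r (Laurent_coef M)) by (exists B; auto).
assert (Hr0 : 0 < r) by lra.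
destruct (expansion_coef_bound Hr0 Hdec) as [A [PA HA]].
pose proof (partial_coef_expansion Hr0 Hdec
  (fun a b => Laurent_coef_sym K M a b HK HM) (fun p q => Leibniz_coef K M p q HK HM)) as Hpc.
set (alpha := expansion_coef (c := Laurent_coef M)) in *.
destruct (Laurent_expansion K M w z Hsep Hwz (eps / 2)) as [N1 HN1]; [lra|].
(* Here (2N + 1)^2 <= 4 (N + 1)^2, and [partial_coef_bound] supplies the third factor N + 1 along
   with 12 A. *)
destruct (poly_exp_small (4 * (B + 12 * A)) 3 (r - k) (eps / 2)) as [N2 HN2]; [lra|lra|].
exists (max N1 N2); intros N HN.
specialize (HN1 N ltac:(lia)); specialize (HN2 N ltac:(lia)).
rewrite partial_expansion by (eapply exp_neq_0; eassumption).
replace (M w z - Laurent_sum (partial_coef alpha N) N w z)%C with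
  ((M w z - Laurent_sum (Laurent_coef M) N w z) +
   Laurent_sum (fun a b => Laurent_coef M a b - partial_coef alpha N a b)%C N w z)%C
  by (rewrite Laurent_sum_minus; ring).
eapply Rle_trans; [apply Cmod_triangle|].
replace eps with (eps / 2 + eps / 2) by lra; apply Rplus_le_compat; [exact HN1|].
eapply Rle_trans; [|exact HN2].
pose proof (pos_INR N) as HNp; pose proof (exp_pos (- ((r - k) * INR N))) as HE.
set (E := exp (- ((r - k) * INR N))) in *.
set (T := (B + 12 * A * (INR N + 1)) * E).
assert (HT : 0 <= T).
{ apply Rmult_le_pos; [|lra]; apply Rplus_le_le_0_compat; [lra|apply Rmult_le_pos; lra]. }
apply Rle_trans with ((2 * INR N + 1) * ((2 * INR N + 1) * T)).
- apply Zsum_bound; intros a _; apply Zsum_bound; intros b _.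
  rewrite Cmod_mult.
  destruct (Z_lt_le_dec (zdeg a b) (Z.of_nat N)) as [Hd|Hd].
  + rewrite (Hpc N a b Hd).
    replace (Laurent_coef M a b - Laurent_coef M a b)%C with (RtoC 0) by ring.
    rewrite Cmod_0, Rmult_0_l; exact HT.
  + pose proof (monomial_bound k u v w z a b Hhex Hw Hz) as Hmon.
    destruct (partial_coef_bound alpha A r N a b ltac:(lra) HA Hd) as [Hor Hpb].
    assert (Hdk : exp (- (r * IZR (zdeg a b))) * exp (k * IZR (zdeg a b)) <= E).
    { rewrite <- exp_plus; apply exp_le_exp; apply IZR_le in Hd; rewrite <- INR_IZR_INZ in Hd; nra. }
    (* The bound on the partial coefficient decays in N, while the monomial grows with zdeg; they
       can be combined only because the coefficient vanishes beyond zdeg = N. *)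
    assert (Hp : Cmod (partial_coef alpha N a b) * Cmod (Czpow w a * Czpow z b)%C
      <= 12 * A * (INR N + 1) * E).
    { destruct Hor as [Hor|Hor].
      - rewrite Hor, <- INR_IZR_INZ in *.
        apply Rle_trans with (12 * A * (INR N + 1) * exp (- (r * INR N)) * exp (k * INR N)).
        + apply Rmult_le_compat; auto; apply Cmod_ge_0.
        + rewrite Rmult_assoc; apply Rmult_le_compat_l; [apply Rmult_le_pos; lra|exact Hdk].
      - rewrite Hor, Cmod_0, Rmult_0_l; apply Rmult_le_pos; [apply Rmult_le_pos|]; lra. }
    assert (Hq : Cmod (Laurent_coef M a b) * Cmod (Czpow w a * Czpow z b)%C <= B * E).
    { apply Rle_trans with (B * exp (- (r * IZR (zdeg a b))) * exp (k * IZR (zdeg a b))).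
      - apply Rmult_le_compat; auto; apply Cmod_ge_0.
      - rewrite Rmult_assoc; apply Rmult_le_compat_l; [lra|exact Hdk]. }
    unfold Cminus; pose proof (Cmod_triangle (Laurent_coef M a b) (- partial_coef alpha N a b)%C) as HTr.
    rewrite Cmod_opp in HTr.
    apply (Rmult_le_compat_r (Cmod (Czpow w a * Czpow z b)%C)) in HTr; [|apply Cmod_ge_0].
    unfold T; lra.
- unfold T; simpl; rewrite Rmult_1_r, <- !Rmult_assoc.
  apply Rmult_le_compat_r; [lra|].
  assert (H1 : B + 12 * A * (INR N + 1) <= (B + 12 * A) * (INR N + 1)) by nra.
  assert (H2 : (2 * INR N + 1) * (2 * INR N + 1) <= 4 * ((INR N + 1) * (INR N + 1))) by nra.
  apply Rle_trans with (4 * ((INR N + 1) * (INR N + 1)) * ((B + 12 * A) * (INR N + 1))); [|right; ring].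
  apply Rmult_le_compat; auto; nra.
Qed.

(** * Uniform convergence from block estimates *)

Definition in_closed (k : R) (p : C * C) : Prop :=
  exists u v, Cmod (fst p) = exp u /\ Cmod (snd p) = exp v /\ closed_hexagon k u v.

Definition block {G : AbelianMonoid} (f : nat -> Z -> G) (n : nat) : G :=
  sum_n (fun k => f n (Z.of_nat k - (Z.of_nat n - 1))%Z) (2 * n - 2).

Lemma sum_n_Rle (f : nat -> R) m B : (forall k, (k <= m)%nat -> f k <= B) ->
  sum_n (G := R_AbelianMonoid) f m <= (INR m + 1) * B.
Proof.
induction m as [|m IH]; intros H.
- rewrite sum_O; simpl; specialize (H 0%nat (le_n _)); lra.
- rewrite sum_Sn, S_INR; unfold plus; simpl.
  specialize (IH (fun k Hk => H k (le_S _ _ Hk))); specialize (H (S m) (le_n _)); lra.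
Qed.

(** Half of the margin r - k absorbs the number of terms in a block, the other half remains as the
    rate d. *)
Lemma block_bound beta A r k : 0 <= k < r -> 0 <= A ->
  (forall n j, (Z.abs j <= Z.of_nat n - 1)%Z -> Cmod (beta n j) <= A * exp (- (r * INR n))) ->
  exists D d, 0 < D /\ 0 < d /\ forall p n, in_closed k p -> (1 <= n)%nat ->
    block (G := R_AbelianMonoid) (fun n j => Cmod (L_term beta p n j)) n <= D * exp (- (d * INR n)).
Proof.
intros Hk HA Hb; destruct (pow_le_exp 1 ((r - k) / 2)) as [B [PB HB]]; [lra|].
(* The 12 is 2 for the number of terms times 6 for the monomials; the + 1 keeps D positive when A =
   0. *)
exists (12 * A * B + 1), ((r - k) / 2); split; [|split; [lra|]].
{ assert (0 <= A * B) by (apply Rmult_le_pos; lra); lra. }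
intros [w z] n (u & v & Hw & Hz & Hh) Hn; cbn [fst snd] in Hw, Hz.
apply Rle_trans with ((INR (2 * n - 2) + 1) * (A * exp (- (r * INR n)) * (6 * exp (k * INR n)))).
- apply sum_n_Rle; intros i Hi; unfold L_term; rewrite Cmod_mult.
  apply Rmult_le_compat; try apply Cmod_ge_0; [apply Hb; lia|].
  apply (L_min_bound k u v); auto; [lra|lia].
- assert (E : INR (2 * n - 2) + 1 <= 2 * (INR n + 1)).
  { rewrite minus_INR by lia; rewrite mult_INR; change (INR 2) with 2; lra. }
  specialize (HB n); rewrite pow_1 in HB; set (e := exp ((r - k) / 2 * INR n)) in *.
  assert (Ee : exp (- (r * INR n)) * exp (k * INR n) = exp (- ((r - k) / 2 * INR n)) * exp (- ((r - k) / 2 * INR n)))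
    by (rewrite <- !exp_plus; f_equal; field).
  assert (E1 : e * exp (- ((r - k) / 2 * INR n)) = 1)
    by (unfold e; rewrite <- exp_plus, Rplus_opp_r; apply exp_0).
  set (e' := exp (- ((r - k) / 2 * INR n))) in *.
  assert (0 < e') by apply exp_pos.
  replace (A * exp (- (r * INR n)) * (6 * exp (k * INR n))) with (6 * A * (e' * e')) by (rewrite <- Ee; ring).
  apply Rle_trans with (2 * (B * e) * (6 * A * (e' * e'))).
  + apply Rmult_le_compat_r; [|lra]; apply Rmult_le_pos; [lra|apply Rmult_le_pos; lra].
  + replace (2 * (B * e) * (6 * A * (e' * e'))) with (12 * A * B * e' * (e * e')) by ring.
    rewrite E1; lra.
Qed.

(** The closed form of the sum of D exp (- d n) over n > N. *)
Definition geometric_tail (D d : R) (N : nat) : R := D / (exp d - 1) * exp (- (d * INR N)).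

Lemma geometric_tail_S D d N : 0 < d ->
  geometric_tail D d (S N) + D * exp (- (d * INR (S N))) = geometric_tail D d N.
Proof.
intros Hd; unfold geometric_tail; rewrite S_INR.
replace (exp (- (d * INR N))) with (exp (- (d * (INR N + 1))) * exp d)
  by (rewrite <- exp_plus; f_equal; ring).
pose proof (exp_ineq1 d); field; lra.
Qed.

Lemma geometric_tail_pos D d N : 0 < D -> 0 < d -> 0 < geometric_tail D d N.
Proof.
intros HD Hd; pose proof (exp_ineq1 d); apply Rmult_lt_0_compat; [|apply exp_pos].
apply Rdiv_lt_0_compat; lra.
Qed.

Lemma Cmod_block f n : Cmod (block (G := C_AbelianMonoid) f n) <=
  block (G := R_AbelianMonoid) (fun n j => Cmod (f n j)) n.
Proof.
unfold block; induction (2 * n - 2)%nat as [|m IH]; [rewrite !sum_O; lra|].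
rewrite !sum_Sn; eapply Rle_trans; [apply Cmod_triangle|].
apply Rplus_le_compat; [exact IH|lra].
Qed.

Lemma block_ge_0 f n : 0 <= block (G := R_AbelianMonoid) (fun n j => Cmod (f n j)) n.
Proof. eapply Rle_trans; [apply Cmod_ge_0|apply Cmod_block]. Qed.

Lemma geometric_tail_small D d eps : 0 < d -> 0 < eps ->
  exists N0, forall N, (N0 <= N)%nat -> geometric_tail D d N < eps.
Proof.
intros Hd He; destruct (poly_exp_small (D / (exp d - 1)) 0 d (eps / 2)) as [N0 H]; [lra|lra|].
exists N0; intros N HN; specialize (H N HN); rewrite pow_O, Rmult_1_r in H.
unfold geometric_tail; lra.
Qed.

(** The block bound makes the partial sums Cauchy at a rate independent of p; the pointwise limit
    then turns this into a bound on the remainder. *)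
Lemma uniform_expansion M beta k D d p : 0 < D -> 0 < d -> in_closed k p ->
  (forall p n, in_closed k p -> (1 <= n)%nat ->
    block (G := R_AbelianMonoid) (fun n j => Cmod (L_term beta p n j)) n <= D * exp (- (d * INR n))) ->
  (forall eps, 0 < eps -> exists N0, forall N, (N0 <= N)%nat ->
    Cmod (M - Ctriangle (L_term beta p) N)%C <= eps) ->
  forall N, Cmod (M - Ctriangle (L_term beta p) N)%C <= geometric_tail D d N.
Proof.
intros HD Hd Hp Hblock Hcv N.
assert (Hm : forall m, Cmod (Ctriangle (L_term beta p) (N + m) - Ctriangle (L_term beta p) N)%C
  <= geometric_tail D d N - geometric_tail D d (N + m)).
{ induction m as [|m IH].
  - rewrite Nat.add_0_r; replace (_ - _)%C with (RtoC 0) by ring; rewrite Cmod_0; lra.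
  - rewrite Nat.add_succ_r, triangle_sum_S.
    fold (block (G := C_AbelianMonoid) (L_term beta p) (S (N + m))).
    match goal with |- Cmod (plus ?x ?y - ?z)%C <= _ => change (plus x y) with (x + y)%C;
      replace (x + y - z)%C with ((x - z) + y)%C by ring end.
    eapply Rle_trans; [apply Cmod_triangle|].
    pose proof (Rle_trans _ _ _ (Cmod_block (L_term beta p) (S (N + m))) (Hblock p (S (N + m)) Hp ltac:(lia))).
    pose proof (geometric_tail_S D d (N + m) Hd); lra. }
apply le_epsilon; intros eps He; destruct (Hcv eps He) as [N0 HN0].
specialize (HN0 (N + N0)%nat ltac:(lia)); specialize (Hm N0).
pose proof (geometric_tail_pos D d (N + N0) HD Hd).
replace (M - Ctriangle (L_term beta p) N)%C with
  ((M - Ctriangle (L_term beta p) (N + N0)) +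
   (Ctriangle (L_term beta p) (N + N0) - Ctriangle (L_term beta p) N))%C by ring.
eapply Rle_trans; [apply Cmod_triangle|]; lra.
Qed.

Lemma monotone_limit (T : nat -> R) D d : 0 < D -> 0 < d ->
  (forall N, T N <= T (S N) <= T N + D * exp (- (d * INR (S N)))) ->
  forall N, Rabs (T N - real (Lim_seq T)) <= geometric_tail D d N.
Proof.
intros HD Hd HT N.
assert (Hup : forall N m, T (N + m)%nat <= T N + geometric_tail D d N - geometric_tail D d (N + m)).
{ intros N' m; induction m as [|m IH]; [rewrite Nat.add_0_r; lra|].
  rewrite Nat.add_succ_r; pose proof (HT (N' + m)%nat); pose proof (geometric_tail_S D d (N' + m) Hd); lra. }
assert (Hlow : forall N m, T N <= T (N + m)%nat).
{ intros N' m; induction m as [|m IH]; [rewrite Nat.add_0_r; lra|].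
  rewrite Nat.add_succ_r; pose proof (HT (N' + m)%nat); lra. }
assert (Hex : ex_finite_lim_seq T).
{ apply (ex_finite_lim_seq_incr T (T 0%nat + geometric_tail D d 0)); [apply HT|].
  intros n; pose proof (Hup 0%nat n); simpl in H; pose proof (geometric_tail_pos D d n HD Hd); lra. }
apply Lim_seq_correct' in Hex; set (l := real (Lim_seq T)) in *.
pose proof (proj1 (is_lim_seq_incr_n T N l) Hex) as Hl.
assert (L1 : Rbar_le (T N) l).
{ apply (is_lim_seq_le (fun _ => T N) (fun n => T (n + N)%nat)); auto using is_lim_seq_const.
  intros n; rewrite Nat.add_comm; apply Hlow. }
assert (L2 : Rbar_le l (T N + geometric_tail D d N)).
{ apply (is_lim_seq_le (fun n => T (n + N)%nat) (fun _ => T N + geometric_tail D d N)); auto using is_lim_seq_const.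
  intros n; rewrite Nat.add_comm; pose proof (Hup N n); pose proof (geometric_tail_pos D d (N + n) HD Hd); lra. }
simpl in L1, L2; apply Rabs_le; lra.
Qed.

(** * Compact sets *)

Notation Cpair := (prod_UniformSpace C_UniformSpace C_UniformSpace).

Lemma open_Cmod_between (f : C * C -> C) a b :
  (forall p, continuous (T := Cpair) (U := C_UniformSpace) f p) ->
  open (T := Cpair) (fun p => a < Cmod (f p) < b).
Proof.
intros Hf; assert (Hc : forall p, continuous (T := Cpair) (U := R_UniformSpace) (fun p => Cmod (f p)) p).
{ intros p; apply (continuous_comp (V := C_UniformSpace) f Cmod); [apply Hf|].
  exact (filterlim_norm (K := C_AbsRing) (V := C_NormedModule) (f p)). }
apply (open_and (T := Cpair) (fun p => a < Cmod (f p)) (fun p => Cmod (f p) < b)).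
- apply (open_comp (T := Cpair) (U := R_UniformSpace) (fun p => Cmod (f p)) (fun x => a < x));
    [intros p _; apply Hc|apply open_gt].
- apply (open_comp (T := Cpair) (U := R_UniformSpace) (fun p => Cmod (f p)) (fun x => x < b));
    [intros p _; apply Hc|apply open_lt].
Qed.

Lemma open_annulus K : open (T := Cpair) (cyclic_annulus K).
Proof.
assert (H1 : forall p, continuous (T := Cpair) (U := C_UniformSpace) fst p)
  by (intros [x y]; apply (continuous_fst (U := C_UniformSpace) (V := C_UniformSpace))).
assert (H2 : forall p, continuous (T := Cpair) (U := C_UniformSpace) snd p)
  by (intros [x y]; apply (continuous_snd (U := C_UniformSpace) (V := C_UniformSpace))).
unfold cyclic_annulus; apply open_and; [|apply open_and]; apply open_Cmod_between; auto.
intros p; apply (continuous_Cmult (U := Cpair) fst snd); auto.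
Qed.

(** The open annuli of size K (1 - 1 / (i + 1)) increase to the whole annulus, so the largest index
    in a finite subcover suffices. *)
Lemma compact_in_closed K (Q : C * C -> Prop) : 0 < K -> compact_set (T := Cpair) Q ->
  (forall p, Q p -> cyclic_annulus K p) ->
  exists k, 0 <= k < K /\ forall p, Q p -> in_closed k p.
Proof.
intros HK HQ Hin.
set (k := fun i : nat => K * (1 - / (INR i + 1))).
assert (Hpos : forall i, 0 < / (INR i + 1) <= 1).
{ intros i; pose proof (pos_INR i); split; [apply Rinv_0_lt_compat; lra|].
  rewrite <- Rinv_1; apply Rinv_le_contravar; lra. }
assert (Hk : forall i, 0 <= k i < K) by (intros i; specialize (Hpos i); unfold k; nra).
assert (Hmono : forall i j, (i <= j)%nat -> k i <= k j).
{ intros i j Hij; apply le_INR in Hij; pose proof (pos_INR i).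
  assert (/ (INR j + 1) <= / (INR i + 1)) by (apply Rinv_le_contravar; lra); unfold k; nra. }
destruct (HQ nat (fun i => cyclic_annulus (k i))) as [l Hl].
- intros i; apply open_annulus.
- intros [w z] Hp; destruct (annulus_log K w z (Hin _ Hp)) as (u & v & Hw & Hz & H1 & H2 & H3).
  set (m := Rmax (Rmax (Rabs u) (Rabs v)) (Rabs (u + v))).
  assert (Hm : m < K) by (repeat apply Rmax_lub_lt; auto).
  destruct (archimed_cor1 ((K - m) / K)) as [n [Hn Hn0]]; [apply Rdiv_lt_0_compat; lra|].
  exists n; apply (annulus_hexagon (k n) u v); auto.
  assert (Hmk : m < k n).
  { unfold k; assert (/ (INR n + 1) <= / INR n)
      by (apply Rinv_le_contravar; [now apply lt_0_INR|lra]).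
    assert (K * / (INR n + 1) < K * ((K - m) / K)) by (apply Rmult_lt_compat_l; lra).
    replace (K * ((K - m) / K)) with (K - m) in * by (field; lra); lra. }
  pose proof (Rmax_l (Rmax (Rabs u) (Rabs v)) (Rabs (u + v))).
  pose proof (Rmax_r (Rmax (Rabs u) (Rabs v)) (Rabs (u + v))).
  pose proof (Rmax_l (Rabs u) (Rabs v)); pose proof (Rmax_r (Rabs u) (Rabs v)).
  fold m in H, H0; unfold hexagon; lra.
- assert (Hmax : exists n, forall i, In i l -> (i <= n)%nat).
  { clear; induction l as [|i l [n IH]]; [exists 0%nat; contradiction|].
    exists (max i n); intros j [->|Hj]; [lia|specialize (IH j Hj); lia]. }
  destruct Hmax as [n Hn]; exists (k n); split; [apply Hk|].
  intros [w z] Hp; destruct (Hl _ Hp) as [i [Hi Ha]].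
  destruct (annulus_log _ _ _ Ha) as (u & v & Hw & Hz & H1 & H2 & H3).
  specialize (Hmono i n (Hn i Hi)).
  exists u, v; repeat split; auto; lra.
Qed.

Definition unit_torus (p : C * C) : Prop := Cmod (fst p) = exp 0 /\ Cmod (snd p) = exp 0.

(** The compact set on which uniqueness tests the expansion. Bisection is run on squares of angles
    whose image has a finite subcover. *)
Lemma compact_torus : compact_set (T := Cpair) unit_torus.
Proof.
intros I U Hopen Hcov; pose proof PI_RGT_0.
pose (P := fun x y s => exists l : list I, forall a b, x <= a <= x + s * (2 * PI) ->
  y <= b <= y + s * (2 * PI) -> exists i, In i l /\ U i (cexp 0 a, cexp 0 b)).
assert (HP : P (- PI) (- PI) 1).
{ apply (rectangle_induction (- PI) (- PI) (2 * PI) (2 * PI)); [lra|lra| |].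
  - intros x y s Hs _ _ _ _ [l1 H1] [l2 H2] [l3 H3] [l4 H4].
    exists (l1 ++ l2 ++ l3 ++ l4); intros a b Ha Hb.
    assert (Hs2 : s * (2 * PI) = s / 2 * (2 * PI) + s / 2 * (2 * PI)) by field.
    destruct (Rle_dec a (x + s / 2 * (2 * PI))); destruct (Rle_dec b (y + s / 2 * (2 * PI)));
    [destruct (H1 a b) as [i Hi]|destruct (H3 a b) as [i Hi]
    |destruct (H2 a b) as [i Hi]|destruct (H4 a b) as [i Hi]]; try lra;
    exists i; rewrite !in_app_iff; tauto.
  - intros x0 y0 _ _.
    destruct (Hcov (cexp 0 x0, cexp 0 y0)) as [i Hi]; [split; apply Cmod_cexp|].
    assert (Hc : continuous (T := prod_UniformSpace R_UniformSpace R_UniformSpace) (U := Cpair)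
      (fun p => (cexp 0 (fst p), cexp 0 (snd p))) (x0, y0)).
    { apply (continuous_comp_2 (U := prod_UniformSpace R_UniformSpace R_UniformSpace)
        (V := C_UniformSpace) (W := C_UniformSpace) (X := Cpair)
        (fun p => cexp 0 (fst p)) (fun p => cexp 0 (snd p)) (fun w z => (w, z))).
      - apply (continuous_comp (U := prod_UniformSpace R_UniformSpace R_UniformSpace)
          (V := R_UniformSpace) (W := C_UniformSpace) fst (cexp 0));
          [apply continuous_fst|apply (continuous2_r cexp), continuous_cexp].
      - apply (continuous_comp (U := prod_UniformSpace R_UniformSpace R_UniformSpace)
          (V := R_UniformSpace) (W := C_UniformSpace) snd (cexp 0));
          [apply continuous_snd|apply (continuous2_r cexp), continuous_cexp].
      - apply continuous_ext with (fun p => p); [intros []; reflexivity|apply continuous_id]. }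
    destruct (Hc _ (Hopen i _ Hi)) as [[d Hd] Hb].
    exists (d / (2 * PI)); split; [apply Rdiv_lt_0_compat; lra|].
    intros x y s [Hs Hsd] _ _ _ _ Hx Hy; exists (i :: nil); intros a b Ha Hb'.
    apply (Rmult_lt_compat_r (2 * PI)) in Hsd; [|lra].
    unfold Rdiv in Hsd; rewrite Rmult_assoc, Rinv_l, Rmult_1_r in Hsd by lra.
    exists i; split; [now left|]; apply (Hb (a, b)); split; apply Rabs_def1; simpl;
      unfold minus, plus, opp; simpl; lra. }
destruct HP as [l Hl]; exists l; intros [w z] [Hw Hz]; cbn [fst snd] in *.
destruct (circle_angle w 0 Hw) as [s [Hs ->]]; destruct (circle_angle z 0 Hz) as [t [Ht ->]].
apply Hl; lra.
Qed.

(** * Uniqueness *)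

Lemma dmean_Zsum (F : Z -> C -> C -> C) N u v : (forall a, torus_continuous (F a) u v) ->
  torus_continuous (fun w z => Zsum (fun a => F a w z) N) u v /\
  dmean (fun w z => Zsum (fun a => F a w z) N) u v = Zsum (fun a => dmean (F a) u v) N.
Proof.
intros H; induction N as [|N [IH1 IH2]]; [split; [apply H|reflexivity]|].
pose proof (torus_continuous_plus _ _ u v (H (Z.of_nat (S N))) (H (- Z.of_nat (S N))%Z)) as H2.
split; [exact (torus_continuous_plus _ _ u v IH1 H2)|].
rewrite Zsum_S, <- IH2, <- dmean_plus by auto.
exact (dmean_plus _ _ u v IH1 H2).
Qed.

Lemma dmean_monomial k x y : dmean (fun w z => k * Czpow w x * Czpow z y)%C 0 0 =
  if Z.eq_dec x 0 then if Z.eq_dec y 0 then k else RtoC 0 else RtoC 0.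
Proof.
unfold dmean; rewrite (cmean_ext _ (fun z => k * cmean (fun w => Czpow w x) 0 * Czpow z y)%C).
- rewrite cmean_scal, !cmean_Czpow by apply circle_continuous_Czpow.
  destruct (Z.eq_dec x 0), (Z.eq_dec y 0); ring.
- intros z _; rewrite <- Cmult_assoc, (Cmult_comm (cmean _ _)), Cmult_assoc.
  rewrite <- cmean_scal by apply circle_continuous_Czpow; apply cmean_ext; intros; ring.
Qed.

Lemma dmean_Laurent_sum d N a b : (Z.abs a <= Z.of_nat N)%Z -> (Z.abs b <= Z.of_nat N)%Z ->
  torus_continuous (Laurent_sum d N) 0 0 /\
  dmean (fun w z => Laurent_sum d N w z * Czpow w (- a) * Czpow z (- b))%C 0 0 = d a b.
Proof.
intros Ha Hb.
assert (T : forall k x y, torus_continuous (fun w z => k * Czpow w x * Czpow z y)%C 0 0)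
  by (intros k x y; exact (torus_monomial (fun _ _ => k) x y 0 0 (torus_continuous_const k 0 0))).
assert (T' : forall x y, torus_continuous (fun w z => d x y * (Czpow w x * Czpow z y))%C 0 0).
{ intros x y; apply torus_continuous_scal.
  apply (torus_continuous_mult (fun w _ => Czpow w x) (fun _ z => Czpow z y)).
  - apply torus_continuous_l, circle_continuous_Czpow.
  - apply torus_continuous_r, circle_continuous_Czpow. }
split.
{ apply (dmean_Zsum (fun x w z => Zsum (fun y => d x y * (Czpow w x * Czpow z y))%C N)); intros x.
  apply (dmean_Zsum (fun y w z => d x y * (Czpow w x * Czpow z y))%C); intros y; apply T'. }
set (F := fun x y w z => (d x y * Czpow w (x - a) * Czpow z (y - b))%C).
transitivity (dmean (fun w z => Zsum (fun x => Zsum (fun y => F x y w z) N) N) 0 0).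
- apply dmean_ext; intros w z Hw Hz.
  pose proof (exp_neq_0 w 0 Hw); pose proof (exp_neq_0 z 0 Hz).
  rewrite <- Cmult_assoc, Cmult_comm; unfold Laurent_sum; rewrite <- Zsum_scal.
  apply Zsum_ext; intros x _; rewrite <- Zsum_scal; apply Zsum_ext; intros y _.
  unfold F, Z.sub; rewrite !Czpow_add by auto; ring.
- assert (H1 : forall x, torus_continuous (fun w z => Zsum (fun y => F x y w z) N) 0 0)
    by (intros x; apply (dmean_Zsum (F x)); intros y; apply T).
  rewrite (proj2 (dmean_Zsum (fun x w z => Zsum (fun y => F x y w z) N) N 0 0 H1)).
  rewrite (Zsum_single _ N a); auto.
  + rewrite (proj2 (dmean_Zsum (F a) N 0 0 (fun y => T _ _ _))).
    rewrite (Zsum_single _ N b); auto.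
    * unfold F; rewrite dmean_monomial, !Z.sub_diag; reflexivity.
    * intros y Hy; unfold F; rewrite dmean_monomial; destruct (Z.eq_dec (y - b) 0); [lia|].
      destruct Z.eq_dec; auto.
  + intros x Hx; rewrite (proj2 (dmean_Zsum (F x) N 0 0 (fun y => T _ _ _))).
    apply Zsum_0; intros y _; unfold F; rewrite dmean_monomial; destruct Z.eq_dec; [lia|auto].
Qed.

Lemma partial_coef_stable beta N a b : (zdeg a b + 2 <= Z.of_nat N)%Z ->
  partial_coef beta (S N) a b = partial_coef beta N a b.
Proof.
intros H; unfold partial_coef; rewrite triangle_sum_S.
unfold sum_n; rewrite sum_n_m_0; [apply plus_zero_r|].
intros k Hk; rewrite L_coef_0 by lia; change (beta (S N) (Z.of_nat k - (Z.of_nat (S N) - 1))%Z * RtoC 0 = RtoC 0)%C; ring.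
Qed.

(** Uniform convergence on the unit torus passes to the means that extract the coefficient of w^a
    z^b, and on the side of the partial sums this coefficient no longer depends on N. No decay of
    beta enters. *)
Lemma L_expansion_coef K M beta a b : 0 < K -> CLR_solution Delta_s K M -> L_expansion K beta M ->
  forall N, (zdeg a b + 2 <= Z.of_nat N)%Z -> partial_coef beta N a b = Laurent_coef M a b.
Proof.
intros HK HM Hb N0 HN0.
pose proof (holomorphic_separately K M (proj1 (proj1 HM))) as Hsep.
assert (Htor : forall p, unit_torus p -> cyclic_annulus K p).
{ intros [w z] [Hw Hz]; apply (annulus_hexagon K 0 0 w z Hw Hz), hexagon_0, HK. }
specialize (Hb unit_torus compact_torus Htor).
assert (Hst : forall m, partial_coef beta (N0 + m) a b = partial_coef beta N0 a b).
{ induction m as [|m IH]; [now rewrite Nat.add_0_r|].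
  rewrite Nat.add_succ_r, partial_coef_stable by lia; exact IH. }
apply Cminus_eq_0, Cmod_eq_0, Rle_antisym; [|apply Cmod_ge_0].
apply le_epsilon; intros eps He; rewrite Rplus_0_l.
assert (He2 : 0 < eps / 2) by lra.
destruct (Hb (mkposreal _ He2)) as [N1 HN1].
set (N := (N0 + N1)%nat); rewrite <- (Hst N1); fold N.
assert (Hab : (Z.abs a <= Z.of_nat N)%Z /\ (Z.abs b <= Z.of_nat N)%Z) by (unfold N, zdeg in *; lia).
destruct (dmean_Laurent_sum (partial_coef beta N) N a b (proj1 Hab) (proj2 Hab)) as [Hc Hd].
rewrite <- Hd; unfold Laurent_coef.
pose proof (proj1 Hsep 0 0 (hexagon_0 K HK)) as HMc.
pose proof (torus_monomial _ (- a) (- b) 0 0 Hc) as T1.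
pose proof (torus_monomial _ (- a) (- b) 0 0 HMc) as T2.
pose proof (torus_continuous_scal (- RtoC 1)%C _ 0 0 T2) as T3.
match goal with |- Cmod (?x - ?y)%C <= _ => replace (x - y)%C with (x + (- RtoC 1) * y)%C
  by ring end.
rewrite <- dmean_scal, <- dmean_plus by auto.
apply dmean_bound; [exact (torus_continuous_plus _ _ 0 0 T1 T3)|].
intros w z Hw Hz.
replace (Laurent_sum (partial_coef beta N) N w z * Czpow w (- a) * Czpow z (- b)
  + (- RtoC 1) * (M w z * Czpow w (- a) * Czpow z (- b)))%C with
  ((Laurent_sum (partial_coef beta N) N w z - M w z) * (Czpow w (- a) * Czpow z (- b)))%C
  by ring.
rewrite !Cmod_mult, (Cmod_Czpow w 0), (Cmod_Czpow z 0), !Rmult_0_r, exp_0, !Rmult_1_r by auto.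
rewrite <- partial_expansion by (eapply exp_neq_0; eassumption).
specialize (HN1 N ltac:(unfold N; lia) (w, z) (conj Hw Hz)).
(* Balls in C are boxes, so the modulus is only bounded by sqrt 2 times the radius; the radius eps /
   2 makes up for it. *)
apply C_NormedModule_mixin_compat2 in HN1; simpl in HN1.
apply Rlt_le, Rlt_le_trans with (1 := HN1).
assert (sqrt 2 <= 2) by (rewrite <- (sqrt_square 2) at 2 by lra; apply sqrt_le_1; lra).
nra.
Qed.

Theorem theoremB :
  forall (K : R) (M : C -> C -> C),
    0 < K ->
    CLR_solution Delta_s K M ->
    exists alpha : nat -> Z -> C,
      L_expansion K alpha M /\
      L_abs_unif_cv K alpha /\
      (forall K' : R, 0 < K' < K ->
         exists C' : R, 0 < C' /\
           forall (n : nat) (i : Z),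
             (1 <= n)%nat -> (Z.abs i <= Z.of_nat n - 1)%Z ->
             Cmod (alpha n i) <= C' * exp (- K' * INR n)) /\
      (forall beta : nat -> Z -> C,
         L_expansion K beta M ->
         forall (n : nat) (i : Z),
           (1 <= n)%nat -> (Z.abs i <= Z.of_nat n - 1)%Z ->
           beta n i = alpha n i).
Proof.
intros K M HK HM.
pose proof (holomorphic_separately K M (proj1 (proj1 HM))) as Hsep.
set (alpha := expansion_coef (c := Laurent_coef M)).
assert (Hbound : forall r, 0 < r < K -> exists A, 0 < A /\ forall n j,
  (Z.abs j <= Z.of_nat n - 1)%Z -> Cmod (alpha n j) <= A * exp (- (r * INR n))).
{ intros r Hr; exact (expansion_coef_bound (proj1 Hr) (Laurent_coef_decay K r M Hsep Hr)). }
assert (Hblock : forall Q : C * C -> Prop, compact_set (T := Cpair) Q ->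
  (forall p, Q p -> cyclic_annulus K p) -> exists k D d, 0 < D /\ 0 < d /\
    (forall p, Q p -> in_closed k p) /\
    forall p n, in_closed k p -> (1 <= n)%nat ->
      block (G := R_AbelianMonoid) (fun n j => Cmod (L_term alpha p n j)) n <= D * exp (- (d * INR n))).
{ intros Q HQ Hin; destruct (compact_in_closed K Q HK HQ Hin) as [k [Hk HQk]].
  destruct (Hbound ((k + K) / 2)) as [A [PA HA]]; [lra|].
  destruct (block_bound alpha A ((k + K) / 2) k) as [D [d (HD & Hd & H)]]; [lra|lra|auto|].
  exists k, D, d; auto. }
assert (Hexp : L_expansion K alpha M).
{ intros Q HQ Hin; destruct (Hblock Q HQ Hin) as (k & D & d & HD & Hd & HQk & Hb).
  intros [eps He]; destruct (geometric_tail_small D d eps Hd He) as [N0 HN0].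
  exists N0; intros N HN [w z] Hp; apply C_NormedModule_mixin_compat1.
  change (Cmod (Ctriangle (L_term alpha (w, z)) N - M w z)%C < eps).
  rewrite <- Cmod_opp; replace (- (Ctriangle (L_term alpha (w, z)) N - M w z))%C
    with (M w z - Ctriangle (L_term alpha (w, z)) N)%C by ring.
  eapply Rle_lt_trans with (2 := HN0 N HN).
  apply (uniform_expansion (M w z) alpha k); auto.
  exact (expansion_cv K M w z HK HM (Hin _ Hp)). }
exists alpha; split; [exact Hexp|split; [|split]].
- intros Q HQ Hin; destruct (Hblock Q HQ Hin) as (k & D & d & HD & Hd & HQk & Hb).
  exists (fun p => real (Lim_seq (Rtriangle (fun n j => Cmod (L_term alpha p n j))))).
  intros [eps He]; destruct (geometric_tail_small D d eps Hd He) as [N0 HN0].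
  exists N0; intros N HN p Hp.
  refine (Rle_lt_trans _ _ _ _ (HN0 N HN)).
  apply (monotone_limit (Rtriangle (fun n j => Cmod (L_term alpha p n j))) D d HD Hd); intros m.
  rewrite triangle_sum_S.
  fold (block (G := R_AbelianMonoid) (fun n j => Cmod (L_term alpha p n j)) (S m)).
  pose proof (block_ge_0 (L_term alpha p) (S m)).
  specialize (Hb p (S m) (HQk p Hp) ltac:(lia)).
  match goal with |- context [plus ?x ?y] => change (plus x y) with (x + y)%R end; lra.
- intros K' HK'; destruct (Hbound K' HK') as [A [PA HA]]; exists A; split; auto.
  intros n i _ Hi; rewrite <- Ropp_mult_distr_l; auto.
- intros beta Hbeta; apply partial_coef_inj; intros a b.
  exists (Z.to_nat (zdeg a b + 2)); intros N HN.
  rewrite (L_expansion_coef K M beta a b HK HM Hbeta N) by lia.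
  symmetry; apply (L_expansion_coef K M alpha a b HK HM Hexp N); lia.
Qed.
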